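(* The singular $l$-type is a biholomorphic invariant of the germ of a CR-regular set. That is: let $M_p$ and $M'_{p'}$ be (locally connected, irreducible) germs of CR-regular sets in $\mathbb{C}^r$ at singular points $p\in\Sigma$ and $p'\in\Sigma'$ respectively, and suppose there is a biholomorphic map $F$ from a neighborhood of $p$ in $\mathbb{C}^r$ onto a neighborhood of $p'$ in $\mathbb{C}^r$ with $F(p)=p'$ which maps the germ $M_p$ onto the germ $M'_{p'}$. Then for each of the three ways $j\in\{1,2,3\}$ of defining limit values and every integer $l\ge0$, the singular $l$-types coincide: $$\big(\dim_{\mathbb{C}}\langle\mathcal{C}_j(M,\mathcal{L}^0,p)\rangle,\dots,\dim_{\mathbb{C}}\langle\mathcal{C}_j(M,\mathcal{L}^l,p)\rangle\big)=\big(\dim_{\mathbb{C}}\langle\mathcal{C}_j(M',\mathcal{L}'^0,p')\rangle,\dots,\dim_{\mathbb{C}}\langle\mathcal{C}_j(M',\mathcal{L}'^l,p')\rangle\big),$$ where $\mathcal{L}^\nu$ and $\mathcal{L}'^\nu$ are the families of spaces associated with $M$ and $M'$ respectively.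
   Context: **CR-regular sets.** Let $z=(z_1,\dots,z_r)$ be coordinates in $\mathbb{C}^r$, $r=n+k$. A CR-regular set is a set $M$, defined in some open set $U\subset\mathbb{C}^r$ as the set of common zeros of real-analytic functions, such that outside some proper real-analytic subset $\Sigma\subset M$ it is a generic CR manifold of fixed CR type $(n,k)$: a real-analytic submanifold of real codimension $k$ whose complex tangent space $T_{p'}M\cap iT_{p'}M$ has constant complex dimension $n$. The points at which $M$ is such a CR manifold are called CR-regular, their set is $\mathrm{reg}\,M$, and $\Sigma=M\setminus \mathrm{reg}\,M$ is the set of singular points: these are either RC-singular points (points at which $M$ is smooth but the dimension of the complex tangent space is greater than $n$) or singular points of the smooth structure of $M$. Standing conventions: $\mathrm{reg}\,M$ is dense in $M$; germs are irreducible, and $M$ is connected in some neighborhood of the singular point under consideration. All constructions are made for a representative $M$ of the germ $M_p$. **The spaces $\mathcal{L}^\nu$ at CR-regular points.** A CR field on a CR manifold $M$ is a vector field tangent to $M$ of the form $F_1(z,\bar z)\frac{\partial}{\partial\bar z_1}+\dots+F_r(z,\bar z)\frac{\partial}{\partial\bar z_r}$ with smooth complex-valued $F_i$ (type $(0,1)$). Let $q\in\mathrm{reg}\,M$, let $\{\rho_s=0,\ 1\le s\le k\}$ be a system of defining equations of $M$ near $q$ ($\rho_s$ real-valued, real-analytic, with linearly independent differentials), and let $L_1,\dots,L_n$ be a basis of CR fields on $M$ near $q$. Put $\frac{\partial\rho_s}{\partial z}=\big(\frac{\partial\rho_s}{\partial z_1},\dots,\frac{\partial\rho_s}{\partial z_r}\big)$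 and $L^\alpha=L_1^{\alpha_1}\cdots L_n^{\alpha_n}$ for a multi-index $\alpha$, acting componentwise on vector-valued functions. For $\nu\ge0$ define $$\mathcal{L}^\nu(q)=\mathrm{span}_{\mathbb{C}}\Big\{L^\alpha\Big(\frac{\partial\rho_s}{\partial z}\Big)(q,\bar q):\ |\alpha|\le\nu,\ 1\le s\le k\Big\}\subset\mathbb{C}^r .$$ **Limit values at a singular point $p\in\Sigma$.** (1) $v\in\mathbb{C}^r$ belongs to $\mathcal{C}_1(M,\mathcal{L}^\nu,p)$ if there is a (real-)analytic $\mathbb{C}^r$-valued map $V$ in some neighborhood $U'$ of $p$ with $V(q)\in\mathcal{L}^\nu(q)$ for every $q\in\mathrm{reg}\,M\cap U'$ and $V(p)=v$. (2) $v\in\mathbb{C}^r$ belongs to $\mathcal{C}_2(M,\mathcal{L}^\nu,p)$ if for every $\varepsilon>0$ there is $\delta>0$ such that for every $q\in\mathrm{reg}\,M$ with $|q-p|<\delta$ there is $v'\in\mathcal{L}^\nu(q)$ with $\|v'-v\|<\varepsilon$. (3) $v\in\mathbb{C}^r$ belongs to $\mathcal{C}_3(M,\mathcal{L}^\nu,p)$ if there are sequences $q^i\in\mathrm{reg}\,M$ and $v^i\in\mathcal{L}^\nu(q^i)$ with $q^i\to p$ and $v^i\to v$. **Singular $l$-type.** With $\langle\cdot\rangle$ denoting the linear span over $\mathbb{C}$ and $j\in\{1,2,3\}$ fixed, the singular $l$-type of $M_p$ is the sequence $$\mathfrak{l}(p)=\big(\dim\langle\mathcal{C}_j(M,\mathcal{L}^0,p)\rangle,\dim\langle\mathcal{C}_j(M,\mathcal{L}^1,p)\rangle,\dots,\dim\langle\mathcal{C}_j(M,\mathcal{L}^l,p)\rangle\big).$$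 *)

(* Defs.v *)
From HB Require Import structures.
From mathcomp Require Import all_boot all_order all_algebra.
From mathcomp Require Import all_classical all_reals all_analysis.
From mathcomp Require Import complex.

Set Implicit Arguments.
Unset Strict Implicit.
Unset Printing Implicit Defensive.

Import Order.TTheory GRing.Theory Num.Theory.
Import numFieldNormedType.Exports.

Local Open Scope classical_set_scope.
Local Open Scope ring_scope.
Local Open Scope complex_scope.

(* Makes the usual topology of R[i], and hence of 'rV[R[i]]_r, canonical. *)
HB.instance Definition _ (R : realType) := NormedModule.copy R[i] R[i]^o.

(* C^r is 'rV[R[i]]_r. *)

Definition is_lspan (R : realType) (r : nat) (S : set 'rV[R[i]]_r)
    (V : {vspace 'rV[R[i]]_r}) : Prop :=
  (forall v, S v -> v \in V) /\
  (forall V' : {vspace 'rV[R[i]]_r},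
     (forall v, S v -> v \in V') -> (V <= V')%VS).

(* Unlike <<_>>%VS, this takes an arbitrary, possibly infinite, set. *)
Definition lspan (R : realType) (r : nat) (S : set 'rV[R[i]]_r) :
    {vspace 'rV[R[i]]_r} :=
  xget 0%VS [set V | is_lspan S V].

Lemma lspanP (R : realType) (r : nat) (S : set 'rV[R[i]]_r) :
  is_lspan S (lspan S).
Proof.
suff [V SV] : exists V, is_lspan S V.
  exact: (@xgetPex _ _ [set V | is_lspan S V] (ex_intro _ V SV)).
pose P d := `[< exists V : {vspace 'rV[R[i]]_r},
  (forall v, S v -> v \in V) /\ \dim V = d >].
have exP : exists d, P d.
  exists (\dim {: 'rV[R[i]]_r}); apply/asboolP; exists fullv.
  by split => // v _; exact: memvf.
case: (ex_minnP exP) => d /asboolP[V [SV dV]] dmin.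
exists V; split => // V' SV'.
apply/capv_idPl/eqP; rewrite eqEdim capvSl dV dmin//.
apply/asboolP; exists (V :&: V')%VS; split => // v Sv.
by rewrite memv_cap SV ?SV'.
Qed.

Definition monomial (R : realType) (N : nat) (a : {ffun 'I_N -> nat})
    (u : 'rV[R[i]]_N) : R[i] :=
  \prod_(i < N) u 0 i ^+ a i.

(* The power series with coefficients c converges absolutely at u, with sum s;
   the sum is the limit over the boxes {a | forall i, a i < m}. *)
Definition has_power_sum (R : realType) (N : nat)
    (c : {ffun 'I_N -> nat} -> R[i]) (u : 'rV[R[i]]_N) (s : R[i]) : Prop :=
  summable [set: {ffun 'I_N -> nat}]
    (fun a => (complex.Re `|c a * monomial a u|)%:E) /\
  (fun m : nat => \sum_(b : {ffun 'I_N -> 'I_m})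
     let a := [ffun i => nat_of_ord (b i)] in c a * monomial a u)
    @ \oo --> s.

(* (z_1, ..., z_r) |-> (x_1, ..., x_r, y_1, ..., y_r), z_j = x_j + i y_j. *)
Definition real_coords (R : realType) (r : nat) (z : 'rV[R[i]]_r) :
    'rV[R[i]]_(r + r) :=
  row_mx (\row_j (complex.Re (z 0 j))%:C) (\row_j (complex.Im (z 0 j))%:C).

Definition real_analytic_at (R : realType) (r : nat)
    (f : 'rV[R[i]]_r -> R[i]) (p : 'rV[R[i]]_r) : Prop :=
  exists c : {ffun 'I_(r + r) -> nat} -> R[i],
    \forall z \near p, has_power_sum c (real_coords (z - p)) (f z).

Definition holomorphic_at (R : realType) (r : nat)
    (f : 'rV[R[i]]_r -> R[i]) (p : 'rV[R[i]]_r) : Prop :=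
  exists c : {ffun 'I_r -> nat} -> R[i],
    \forall z \near p, has_power_sum c (z - p) (f z).

Definition real_analytic_on (R : realType) (r : nat) (W : set 'rV[R[i]]_r)
    (f : 'rV[R[i]]_r -> R[i]) : Prop :=
  forall z, W z -> real_analytic_at f z.

Definition holomorphic_map_on (R : realType) (r m : nat)
    (W : set 'rV[R[i]]_r) (F : 'rV[R[i]]_r -> 'rV[R[i]]_m) : Prop :=
  forall z, W z -> forall i : 'I_m, holomorphic_at (fun w => F w 0 i) z.

Definition biholomorphic (R : realType) (r : nat) (D D' : set 'rV[R[i]]_r)
    (F : 'rV[R[i]]_r -> 'rV[R[i]]_r) : Prop :=
  [/\ open D, open D', set_bij D D' F, holomorphic_map_on D F &
      exists G : 'rV[R[i]]_r -> 'rV[R[i]]_r,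
        (forall z, D z -> G (F z) = z) /\ holomorphic_map_on D' G].

Definition toC (R : realType) (r : nat) (f : 'rV[R[i]]_r -> R) :
    'rV[R[i]]_r -> R[i] :=
  fun z => (f z)%:C.

Definition line (R : realType) (r : nat) (z v : 'rV[R[i]]_r) (t : R) :
    'rV[R[i]]_r :=
  z + t%:C *: v.

Definition rdiff (R : realType) (r : nat) (f : 'rV[R[i]]_r -> R)
    (z v : 'rV[R[i]]_r) : R :=
  derive1 (f \o line z v) 0.

Definition cdiff (R : realType) (r : nat) (f : 'rV[R[i]]_r -> R[i])
    (z v : 'rV[R[i]]_r) : R[i] :=
  rdiff (fun w => complex.Re (f w)) z v +i*
  rdiff (fun w => complex.Im (f w)) z v.

Definition cderivable (R : realType) (r : nat) (f : 'rV[R[i]]_r -> R[i])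
    (z v : 'rV[R[i]]_r) : Prop :=
  derivable ((fun w => complex.Re (f w)) \o line z v) 0 1 /\
  derivable ((fun w => complex.Im (f w)) \o line z v) 0 1.

(* The Wirtinger operators d/dz_j and d/d(conj z_j). *)
Definition dz (R : realType) (r : nat) (j : 'I_r) (f : 'rV[R[i]]_r -> R[i])
    (z : 'rV[R[i]]_r) : R[i] :=
  2^-1 * (cdiff f z (delta_mx 0 j) - 'i * cdiff f z ('i *: delta_mx 0 j)).

Definition dzbar (R : realType) (r : nat) (j : 'I_r) (f : 'rV[R[i]]_r -> R[i])
    (z : 'rV[R[i]]_r) : R[i] :=
  2^-1 * (cdiff f z (delta_mx 0 j) + 'i * cdiff f z ('i *: delta_mx 0 j)).

(* C^oo in the real sense: all iterated directional derivatives exist and are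
   continuous. *)
Definition smooth_on (R : realType) (r : nat) (W : set 'rV[R[i]]_r)
    (f : 'rV[R[i]]_r -> R[i]) : Prop :=
  forall s : seq 'rV[R[i]]_r,
    let g := foldr (fun v h => cdiff h ^~ v) f s in
    forall z, W z -> {for z, continuous g} /\ forall v, cderivable g z v.

Definition analytic_subset (R : realType) (r : nat) (U A : set 'rV[R[i]]_r) :
    Prop :=
  exists G : set ('rV[R[i]]_r -> R),
    (forall g, G g -> real_analytic_on U (toC g)) /\
    A = [set z | U z /\ forall g, G g -> g z = 0].

Definition defining_system (R : realType) (r k : nat)
    (W M : set 'rV[R[i]]_r) (rho : 'I_k -> 'rV[R[i]]_r -> R) : Prop :=
  [/\ open W,
      forall s, real_analytic_on W (toC (rho s)),
      (forall z, W z -> forall a : 'I_k -> R,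
         (forall v, \sum_(s < k) a s * rdiff (rho s) z v = 0) ->
         forall s, a s = 0) &
      (forall z, W z -> (M z <-> forall s, rho s z = 0))].

Definition tangent (R : realType) (r k : nat)
    (rho : 'I_k -> 'rV[R[i]]_r -> R) (z : 'rV[R[i]]_r) : set 'rV[R[i]]_r :=
  [set v | forall s, rdiff (rho s) z v = 0].

(* T_z M `&` i T_z M; it is already a complex subspace. *)
Definition complex_tangent (R : realType) (r k : nat)
    (rho : 'I_k -> 'rV[R[i]]_r -> R) (z : 'rV[R[i]]_r) :
    {vspace 'rV[R[i]]_r} :=
  lspan (tangent rho z `&` [set 'i *: v | v in tangent rho z]).

Definition reg (R : realType) (r n k : nat) (M : set 'rV[R[i]]_r) :
    set 'rV[R[i]]_r :=
  [set q | M q /\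
     exists (W : set 'rV[R[i]]_r) (rho : 'I_k -> 'rV[R[i]]_r -> R),
       [/\ W q, defining_system W M rho &
           forall z, W z -> M z -> \dim (complex_tangent rho z) = n]].

Definition sing (R : realType) (r n k : nat) (M : set 'rV[R[i]]_r) :
    set 'rV[R[i]]_r :=
  M `\` reg n k M.

Definition CR_regular_set (R : realType) (r n k : nat)
    (U M : set 'rV[R[i]]_r) : Prop :=
  [/\ r = (n + k)%N,
      open U,
      analytic_subset U M,
      (exists S : set 'rV[R[i]]_r,
         [/\ analytic_subset U S, S `<` M & M `\` S `<=` reg n k M]) &
      M `<=` closure (reg n k M)].

Definition germ_eq (R : realType) (r : nat) (A B : set 'rV[R[i]]_r)
    (p : 'rV[R[i]]_r) : Prop :=
  \forall z \near p, A z <-> B z.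

Definition irreducible_germ (R : realType) (r : nat) (M : set 'rV[R[i]]_r)
    (p : 'rV[R[i]]_r) : Prop :=
  forall W A B : set 'rV[R[i]]_r,
    open W -> W p -> analytic_subset W A -> analytic_subset W B ->
    germ_eq M (A `|` B) p -> germ_eq M A p \/ germ_eq M B p.

Definition connected_near (R : realType) (r : nat) (M : set 'rV[R[i]]_r)
    (p : 'rV[R[i]]_r) : Prop :=
  exists W : set 'rV[R[i]]_r, [/\ open W, W p & connected (M `&` W)].

Definition maps_germ (R : realType) (r : nat)
    (D : set 'rV[R[i]]_r) (F : 'rV[R[i]]_r -> 'rV[R[i]]_r)
    (M : set 'rV[R[i]]_r) (p : 'rV[R[i]]_r) (M' : set 'rV[R[i]]_r) : Prop :=
  exists W : set 'rV[R[i]]_r,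
    [/\ open W, W p, W `<=` D & F @` (M `&` W) = M' `&` F @` W].

(* The vector field F_1 d/d(conj z_1) + ... + F_r d/d(conj z_r) as an
   operator on functions. *)
Definition act01 (R : realType) (r : nat)
    (F : 'rV[R[i]]_r -> 'rV[R[i]]_r) (f : 'rV[R[i]]_r -> R[i])
    (z : 'rV[R[i]]_r) : R[i] :=
  \sum_(j < r) F z 0 j * dzbar j f z.

(* The coefficient vectors at z of the (0,1)-vectors tangent to M. *)
Definition T01 (R : realType) (r k : nat)
    (rho : 'I_k -> 'rV[R[i]]_r -> R) (z : 'rV[R[i]]_r) :
    {vspace 'rV[R[i]]_r} :=
  lspan [set w | forall s, \sum_(j < r) w 0 j * dzbar j (toC (rho s)) z = 0].

(* The fields are smooth on W and tangent to M along M; their values off M do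
   not matter. *)
Definition CR_basis (R : realType) (r n k : nat) (W M : set 'rV[R[i]]_r)
    (rho : 'I_k -> 'rV[R[i]]_r -> R)
    (L : 'I_n -> 'rV[R[i]]_r -> 'rV[R[i]]_r) : Prop :=
  (forall i j, smooth_on W (fun z => L i z 0 j)) /\
  (forall z, W z -> M z -> basis_of (T01 rho z) [tuple L i z | i < n]).

(* The field with the largest index acts first. *)
Definition act_multi (R : realType) (r n : nat)
    (L : 'I_n -> 'rV[R[i]]_r -> 'rV[R[i]]_r) (a : {ffun 'I_n -> nat})
    (f : 'rV[R[i]]_r -> R[i]) : 'rV[R[i]]_r -> R[i] :=
  foldr (fun i g => iter (a i) (act01 (L i)) g) f (enum 'I_n).

Definition L_generators (R : realType) (r n k : nat)
    (rho : 'I_k -> 'rV[R[i]]_r -> R)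
    (L : 'I_n -> 'rV[R[i]]_r -> 'rV[R[i]]_r) (nu : nat) (q : 'rV[R[i]]_r) :
    set 'rV[R[i]]_r :=
  [set v | exists (a : {ffun 'I_n -> nat}) (s : 'I_k),
     (\sum_(i < n) a i <= nu)%N /\
     v = \row_j act_multi L a (dz j (toC (rho s))) q].

Definition is_Lspace (R : realType) (r n k : nat) (M : set 'rV[R[i]]_r)
    (nu : nat) (q : 'rV[R[i]]_r) (V : {vspace 'rV[R[i]]_r}) : Prop :=
  exists (W : set 'rV[R[i]]_r) (rho : 'I_k -> 'rV[R[i]]_r -> R)
         (L : 'I_n -> 'rV[R[i]]_r -> 'rV[R[i]]_r),
    [/\ W q, defining_system W M rho, CR_basis W M rho L &
        V = lspan (L_generators rho L nu q)].

(* The space attached to an arbitrary choice of defining system and of basis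
   of CR fields; it is meaningful for q in reg n k M, where it does not depend
   on the choice. *)
Definition Lspace (R : realType) (r n k : nat) (M : set 'rV[R[i]]_r)
    (nu : nat) (q : 'rV[R[i]]_r) : {vspace 'rV[R[i]]_r} :=
  xget 0%VS [set V | is_Lspace n k M nu q V].

Definition limits_analytic (R : realType) (r : nat) (Q : set 'rV[R[i]]_r)
    (LL : 'rV[R[i]]_r -> {vspace 'rV[R[i]]_r}) (p : 'rV[R[i]]_r) :
    set 'rV[R[i]]_r :=
  [set v | exists (U' : set 'rV[R[i]]_r) (V : 'rV[R[i]]_r -> 'rV[R[i]]_r),
     [/\ open U', U' p,
         forall i : 'I_r, real_analytic_on U' (fun z => V z 0 i),
         (forall q, Q q -> U' q -> V q \in LL q) &
         V p = v]].

(* The norm of 'rV[R[i]]_r is the maximum norm, with values in R[i]. *)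
Definition limits_uniform (R : realType) (r : nat) (Q : set 'rV[R[i]]_r)
    (LL : 'rV[R[i]]_r -> {vspace 'rV[R[i]]_r}) (p : 'rV[R[i]]_r) :
    set 'rV[R[i]]_r :=
  [set v | forall e : R, 0 < e -> exists d : R, 0 < d /\
     forall q, Q q -> `|q - p| < d%:C ->
       exists v', v' \in LL q /\ `|v' - v| < e%:C].

Definition limits_sequential (R : realType) (r : nat) (Q : set 'rV[R[i]]_r)
    (LL : 'rV[R[i]]_r -> {vspace 'rV[R[i]]_r}) (p : 'rV[R[i]]_r) :
    set 'rV[R[i]]_r :=
  [set v | exists q_ v_ : nat -> 'rV[R[i]]_r,
     [/\ forall m, Q (q_ m), forall m, v_ m \in LL (q_ m),
         q_ @ \oo --> p & v_ @ \oo --> v]].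

Inductive limit_kind : Set := C1 | C2 | C3.

Definition limit_values (j : limit_kind) (R : realType) (r : nat)
    (Q : set 'rV[R[i]]_r) (LL : 'rV[R[i]]_r -> {vspace 'rV[R[i]]_r})
    (p : 'rV[R[i]]_r) : set 'rV[R[i]]_r :=
  match j with
  | C1 => limits_analytic Q LL p
  | C2 => limits_uniform Q LL p
  | C3 => limits_sequential Q LL p
  end.

Definition singular_type (j : limit_kind) (R : realType) (r n k : nat)
    (M : set 'rV[R[i]]_r) (l : nat) (p : 'rV[R[i]]_r) : seq nat :=
  [seq \dim (lspan (limit_values j (reg n k M) (Lspace n k M nu) p))
     | nu <- iota 0 l.+1].

(* Main.v *)
(** The [nu]-th space attached to a regular point is spanned by the vectors
  [L^alpha (d rho_s / d z)], and the whole theorem reduces to a transformation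
  law for it: if F is biholomorphic with Jacobian [J] and maps M to M', then
  [Lspace M q = Lspace M' (F q) *m J q].  Pulling back the defining functions
  by F and the CR fields by the conjugate of [J^-1] turns the generators at
  [F q] into those at [q], because (0,1)-fields annihilate the holomorphic
  entries of [J].  As [J] is analytic and invertible up to the singular point,
  the three kinds of limit values at [p] and [F p] correspond under [J p].

  That the space does not depend on the defining functions or on the basis of
  fields rests on two facts.  A smooth function vanishing on M has zero
  derivative along the kernel of [d rho], since that kernel consists of limits
  of secants of M (Newton's method); so different choices differ, along M, by
  smooth matrices.  And the bundle of (0,1)-vectors is involutive, so words in
  the fields can be reordered modulo shorter words, as in the
  Poincare-Birkhoff-Witt theorem.

  Real-analytic and holomorphic functions are handled through the Banach
  algebra of power series with finite weighted l1-norm on a polydisc: closure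
  under countable sums gives products, compositions and derivatives. *)

(* Analyticity in the statement only asserts absolute convergence near the centre. At a point all of
   whose coordinates equal some [t > 0], the sum of the moduli of the terms is exactly the weighted
   l1-norm, which is how this norm enters. Two defining systems, or two bases of fields, are related
   only along M, while iterated derivatives see values off M. The transition matrices are therefore
   built from inverse Gram matrices, smooth on a full neighbourhood, and identities are read modulo
   functions vanishing on M, a relation that tangential fields respect. Real independence of the
   differentials of the defining functions does not make their complex gradients independent; this
   comes from the dimension n = r - k of the space of (0,1)-vectors, or of the complex tangent
   space. The two sets carry separate types (n, k) and (n', k'), which must be identified before the
   two sequences can be compared; since p is singular, this happens at a nearby regular point. Limit
   values are compared by one inequality of dimensions, reversed by exchanging F and its inverse. *)
Require Import Defs.
From mathcomp Require Import all_boot all_order all_algebra.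
From mathcomp Require Import finmap.
From mathcomp Require Import all_classical all_reals all_analysis.
From mathcomp Require Import complex.
From mathcomp Require Import ring lra.
Set Implicit Arguments.
Unset Strict Implicit.
Unset Printing Implicit Defensive.
Import Order.TTheory GRing.Theory Num.Theory.
Import numFieldNormedType.Exports.
Local Open Scope classical_set_scope.
Local Open Scope ring_scope.
Local Open Scope complex_scope.
Import ComplexField.Normc.

(** * Real-valued norms *)

Section Modulus.
Variable R : realType.
Local Notation C := R[i].
(** The norm of [R[i]] takes its values in [R[i]], where the order is partial. The real-valued
    copies [nc] and, for row vectors, [nv] allow estimates in a totally ordered field. *)
Definition nc (z : C) : R := normc z.
Lemma normE (z : C) : `|z| = (nc z)%:C. Proof. by []. Qed.

Lemma nc_ge0 (z : C) : 0 <= nc z.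
Proof. by rewrite -lecR -normE normr_ge0. Qed.

Lemma nc0 : nc 0 = 0. Proof. by apply: complexI; rewrite -normE normr0. Qed.

Lemma nc1 : nc 1 = 1. Proof. by apply: complexI; rewrite -normE normr1. Qed.

Lemma ncM x y : nc (x * y) = nc x * nc y.
Proof. exact: normcM. Qed.

Lemma ncN x : nc (- x) = nc x. Proof. exact: normcN. Qed.

Lemma ncV x : nc x^-1 = (nc x)^-1. Proof. exact: normcV. Qed.

Lemma ncD x y : nc (x + y) <= nc x + nc y. Proof. exact: le_normcD. Qed.

Lemma ncB x y : nc (x - y) <= nc x + nc y. Proof. by rewrite -(ncN y) ncD. Qed.

Lemma ncR (x : R) : nc x%:C = `|x|.
Proof. by rewrite /nc /normc /= expr0n addr0 sqrtr_sqr. Qed.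

Lemma nci : nc 'i = 1.
Proof. by rewrite /nc /normc /= expr0n add0r expr1n sqrtr1. Qed.

Lemma ncJ (x : C) : nc (conjc x) = nc x.
Proof. by case: x => a b; rewrite /nc /normc /= sqrrN. Qed.

Lemma ncX x n : nc (x ^+ n) = nc x ^+ n.
Proof. by elim: n => [|n IH]; rewrite ?expr0 ?nc1// !exprS ncM IH. Qed.

Lemma nc_eq0 x : (nc x == 0) = (x == 0).
Proof. by rewrite -(inj_eq (@complexI R)) -normE normr_eq0. Qed.

Lemma nc_le0 x : nc x <= 0 -> x = 0.
Proof. by move=> h; apply/eqP; rewrite -nc_eq0 eq_le h nc_ge0. Qed.

Lemma nc_sum (I : Type) (s : seq I) (P : pred I) (F : I -> C) :
  nc (\sum_(i <- s | P i) F i) <= \sum_(i <- s | P i) nc (F i).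
Proof.
elim/big_ind2: _ => [|x a y b h1 h2|//]; first by rewrite nc0.
by rewrite (le_trans (ncD _ _))// lerD.
Qed.

Lemma nc_Re (x : C) : `|complex.Re x| <= nc x.
Proof. by rewrite -lecR; have := normc_ge_Re x; rewrite normE. Qed.

Lemma nc_Im (x : C) : `|complex.Im x| <= nc x.
Proof.
have := nc_Re ('i * x); rewrite ncM nci mul1r; case: x => a b /=.
by rewrite mul0r mul1r sub0r normrN.
Qed.

Lemma nc_le_ReIm (x : C) : nc x <= `|complex.Re x| + `|complex.Im x|.
Proof.
by rewrite {1}(complexE x) (le_trans (ncD _ _))// ncM nci mul1r !ncR.
Qed.

Lemma ncprod (I : Type) (s : seq I) (P : pred I) (F : I -> C) :
  nc (\prod_(i <- s | P i) F i) = \prod_(i <- s | P i) nc (F i).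
Proof. exact: (big_morph _ (@ncM) nc1). Qed.

Lemma conjcD (x y : C) : conjc (x + y) = conjc x + conjc y.
Proof. exact: rmorphD. Qed.

Lemma conjcB (x y : C) : conjc (x - y) = conjc x - conjc y.
Proof. exact: rmorphB. Qed.

Lemma conjcM (x y : C) : conjc (x * y) = conjc x * conjc y.
Proof. exact: rmorphM. Qed.

Lemma conjc_i : conjc 'i = - 'i :> C.
Proof. by rewrite /conjc; congr Complex; rewrite oppr0. Qed.

End Modulus.

Section Vnorm.
Variable R : realType.
Local Notation C := R[i].
Variable N : nat.
Implicit Types z v w : 'rV[C]_N.
Definition nv (z : 'rV[C]_N) : R := complex.Re `|z|.
Lemma nvE z : `|z| = (nv z)%:C.
Proof. by rewrite /nv RRe_real// normr_real. Qed.

Lemma nv_ge0 z : 0 <= nv z. Proof. by rewrite -lecR -nvE normr_ge0. Qed.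

Lemma nv0 : nv 0 = 0. Proof. by rewrite /nv normr0. Qed.

Lemma nvD z w : nv (z + w) <= nv z + nv w.
Proof. by rewrite -lecR rmorphD /= -!nvE ler_normD. Qed.

Lemma nvN z : nv (- z) = nv z. Proof. by rewrite /nv normrN. Qed.

Lemma nvZ (c : C) z : nv (c *: z) = nc c * nv z.
Proof.
apply: complexI; rewrite rmorphM /= -!nvE -normE.
by rewrite (@normrZ _ 'rV[C]_N).
Qed.

Lemma nv_comp z i : nc (z 0 i) <= nv z.
Proof.
have e : `|z| = mx_norm z by [].
rewrite -lecR -nvE -normE e mx_normE -[X in X <= _]nngE num_le.
exact: (le_bigmax _ (fun ij : 'I_1 * 'I_N => `|z ij.1 ij.2|%:nng) (0, i)).
Qed.

Lemma nv_le z (d : R) : 0 <= d -> (forall i, nc (z 0 i) <= d) -> nv z <= d.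
Proof.
move=> d0 h; have [->|z0] := eqVneq z 0; first by rewrite nv0.
have : mx_norm z != 0 by apply: contra z0 => /eqP /mx_norm_eq0 ->.
move=> /mx_norm_neq0 [[i j] /=]; rewrite ord1 => e.
have e1 : `|z| = mx_norm z by [].
by rewrite -lecR -nvE e1 e normE lecR h.
Qed.

Lemma nearP (P : 'rV[C]_N -> Prop) (p : 'rV[C]_N) :
  (\forall z \near p, P z) <->
  exists d : R, 0 < d /\ forall z, nv (z - p) < d -> P z.
Proof.
split.
  move=> /nbhs_normP[e /= e0 h].
  have er : e \is Num.real by rewrite realE ltW.
  exists (complex.Re e); split; first by rewrite -ltcR RRe_real.
  move=> z hz; apply: h => /=; rewrite distrC nvE -(RRe_real er) ltcR//.
move=> [d [d0 h]]; apply/nbhs_normP; exists d%:C => /=; first by rewrite ltcR.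
by move=> z /=; rewrite distrC nvE ltcR => /h.
Qed.

Lemma cvgvP (u : nat -> 'rV[C]_N) (p : 'rV[C]_N) :
  u @ \oo --> p <->
  forall e : R, 0 < e -> exists m0, forall m, (m0 <= m)%N -> nv (u m - p) < e.
Proof.
split => [h e e0|h].
  have : \forall z \near p, nv (z - p) < e by apply/nearP; exists e.
  by move=> /h [m0 _ hm]; exists m0 => m mm; apply: hm.
move=> A /nearP[d [d0 hd]]; have [m0 hm] := h _ d0.
by exists m0 => // m mm; apply: hd; apply: hm.
Qed.

Lemma openP (W : set 'rV[C]_N) : open W <->
  forall p, W p -> exists d : R, 0 < d /\ forall z, nv (z - p) < d -> W z.
Proof.
rewrite openE; split => h p.
  by move=> /h /nearP.
by move=> /h ?; apply/nearP.
Qed.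

End Vnorm.

Section Cnorm.
Variable R : realType.
Local Notation C := R[i].
Lemma nearCP (P : C -> Prop) (p : C) :
  (\forall z \near p, P z) <->
  exists d : R, 0 < d /\ forall z, nc (z - p) < d -> P z.
Proof.
split.
  move=> /nbhs_normP[e /= e0 h].
  have er : e \is Num.real by rewrite realE ltW.
  exists (complex.Re e); split; first by rewrite -ltcR RRe_real.
  move=> z hz; apply: h => /=; rewrite distrC normE -(RRe_real er) ltcR//.
move=> [d [d0 h]]; apply/nbhs_normP; exists d%:C => /=; first by rewrite ltcR.
by move=> z /=; rewrite distrC normE ltcR => /h.
Qed.

Lemma cvgCP (u : nat -> C) (p : C) :
  u @ \oo --> p <->
  forall e : R, 0 < e -> exists m0, forall m, (m0 <= m)%N -> nc (u m - p) < e.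
Proof.
split => [h e e0|h].
  have : \forall z \near p, nc (z - p) < e by apply/nearCP; exists e.
  by move=> /h [m0 _ hm]; exists m0 => m mm; apply: hm.
move=> A /nearCP[d [d0 hd]]; have [m0 hm] := h _ d0.
by exists m0 => // m mm; apply: hd; apply: hm.
Qed.

Lemma contP N (f : 'rV[C]_N -> C) (p : 'rV[C]_N) :
  {for p, continuous f} <->
  forall e : R, 0 < e -> exists d : R, 0 < d /\
    forall z, nv (z - p) < d -> nc (f z - f p) < e.
Proof.
split => [h e e0|h].
  apply/nearP; apply: (h (fun y => nc (y - f p) < e)).
  by apply/nearCP; exists e.
move=> A /nearCP[e [e0 he]]; apply/nearP.
have [d [d0 hd]] := h _ e0; exists d; split => // z /hd /he.
by [].
Qed.

End Cnorm.

(** * Unordered sums *)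

Section Hsum.
Variable R : realType.
Local Notation C := R[i].
Section OneIndex.
Variable I : choiceType.
Implicit Types (f g : I -> C) (A : {fset I}).
Definition abd (B : R) f := forall A, \sum_(i <- A) nc (f i) <= B.
(** Convergence along the directed set of finite subsets: no enumeration of the multi-indices has to
    be fixed, and reindexing and exchange become statements about finite sets. *)
Definition hsum f (s : C) := forall e : R, 0 < e -> exists A0 : {fset I},
  forall A, (A0 `<=` A)%fset -> nc (\sum_(i <- A) f i - s) <= e.

Lemma abd_ge0 B f : abd B f -> 0 <= B.
Proof. by move/(_ fset0); rewrite big_seq_fset0. Qed.

Lemma sum_fsetU (V : zmodType) (F : I -> V) (A B : {fset I}) :
  fdisjoint A B ->
  \sum_(i <- (A `|` B)%fset) F i = \sum_(i <- A) F i + \sum_(i <- B) F i.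
Proof.
move=> dAB; rewrite -big_cat /=; apply: perm_big; apply: uniq_perm => //.
  rewrite cat_uniq !fset_uniq /= andbT; apply/hasPn => x xB.
  by apply/negP => xA; move/fdisjointP: dAB => /(_ _ xA); rewrite xB.
by move=> i; rewrite mem_cat inE.
Qed.

Lemma sum_fset_split (V : zmodType) (F : I -> V) (A0 A : {fset I}) :
  (A0 `<=` A)%fset ->
  \sum_(i <- A) F i = \sum_(i <- A0) F i + \sum_(i <- (A `\` A0)%fset) F i.
Proof.
move=> sA; rewrite -{1}(fsetID A0 A) (fsetIidPr sA) sum_fsetU//.
by apply/fdisjointP => i iA; rewrite inE iA.
Qed.

(** A finite sum within [e] of the supremum of all finite sums leaves at most [e] for any set
    disjoint from it. *)
Lemma abd_tail B f : abd B f -> forall e : R, 0 < e -> exists A0 : {fset I},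
  forall A, fdisjoint A0 A -> \sum_(i <- A) nc (f i) <= e.
Proof.
move=> fB e e0.
pose S := [set x : R | exists A : {fset I}, x = \sum_(i <- A) nc (f i)].
have hS : has_sup S.
  split; first by exists 0, fset0; rewrite big_seq_fset0.
  by exists B => x [A ->].
have [x [A0 ->] h] := sup_adherent e0 hS.
exists A0 => A dA.
have : \sum_(i <- (A0 `|` A)%fset) nc (f i) <= sup S.
  by apply: ub_le_sup; [exact: hS.2|exists (A0 `|` A)%fset].
rewrite sum_fsetU//= => h2.
rewrite -(lerD2l (\sum_(i <- A0) nc (f i))); apply: (le_trans h2).
by rewrite -lerBlDr ltW.
Qed.

(** Estimates on all large partial sums pass to the sum; uniqueness, the bound [hsum_le] and the
    exchange of sums rest on this. *)
Lemma hsum_near f s c (K : R) : hsum f s ->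
  (exists A0 : {fset I}, forall A, (A0 `<=` A)%fset ->
     nc (\sum_(i <- A) f i - c) <= K) -> nc (s - c) <= K.
Proof.
move=> fs [A0 h]; apply/ler_addgt0Pr => e e0.
have [A1 h1] := fs _ e0.
pose A := (A0 `|` A1)%fset.
have := h A (fsubsetUl _ _); have := h1 A (fsubsetUr _ _).
move=> h2 h3.
rewrite (_ : s - c = (\sum_(i <- A) f i - c) - (\sum_(i <- A) f i - s)); last by ring.
by apply: (le_trans (ncB _ _)); rewrite lerD.
Qed.

Lemma hsum_uniq f s s' : hsum f s -> hsum f s' -> s = s'.
Proof.
move=> h h'; apply/eqP; rewrite -subr_eq0; apply/eqP/nc_le0.
apply/ler_addgt0Pl => e e0; rewrite addr0; apply: (hsum_near h).
exact: h'.
Qed.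

Lemma hsum_le B f s : abd B f -> hsum f s -> nc s <= B.
Proof.
move=> fB fs; rewrite -[s]subr0; apply: (hsum_near fs).
exists fset0 => A _; rewrite subr0; exact: le_trans (nc_sum _ _ _) (fB A).
Qed.

Lemma eq_hsum f g s : f =1 g -> hsum f s -> hsum g s.
Proof.
move=> fg h e e0; have [A0 hA] := h _ e0; exists A0 => A /hA.
by rewrite (eq_bigr g).
Qed.

Lemma le_abd B f g : (forall i, nc (g i) <= nc (f i)) -> abd B f -> abd B g.
Proof. by move=> h fB A; apply: le_trans (fB A); apply: ler_sum. Qed.

Lemma hsum0 : hsum (fun=> 0) 0.
Proof. by move=> e e0; exists fset0 => A _; rewrite big1// subr0 nc0 ltW. Qed.

Lemma hsumD f g s t : hsum f s -> hsum g t -> hsum (fun i => f i + g i) (s + t).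
Proof.
move=> fs gt e e0; have e2 : 0 < e / 2 by rewrite divr_gt0.
have [A0 h0] := fs _ e2; have [A1 h1] := gt _ e2.
exists (A0 `|` A1)%fset => A sA; rewrite big_split /=.
rewrite opprD addrACA (le_trans (ncD _ _))// (splitr e) lerD//.
- by apply: h0; apply: fsubset_trans sA; exact: fsubsetUl.
- by apply: h1; apply: fsubset_trans sA; exact: fsubsetUr.
Qed.

Lemma hsumZ c f s : hsum f s -> hsum (fun i => c * f i) (c * s).
Proof.
move=> fs e e0; have d0 : 0 < nc c + 1 by rewrite ltr_wpDl// nc_ge0.
have [A0 h0] := fs (e / (nc c + 1)) (divr_gt0 e0 d0).
exists A0 => A /h0; rewrite -mulr_sumr -mulrBr ncM => h.
apply: (@le_trans _ _ ((nc c + 1) * (e / (nc c + 1)))).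
  by rewrite ler_pM ?nc_ge0// lerDl.
by rewrite mulrC divfK ?gt_eqF.
Qed.

Lemma hsumN f s : hsum f s -> hsum (fun i => - f i) (- s).
Proof.
by move=> /(hsumZ (-1)); rewrite mulN1r; apply: eq_hsum => i; rewrite mulN1r.
Qed.

Lemma hsumB f g s t : hsum f s -> hsum g t -> hsum (fun i => f i - g i) (s - t).
Proof. by move=> fs gt; apply: hsumD => //; apply: hsumN. Qed.

Lemma hsum_sum (J : Type) (r : seq J) (F : J -> I -> C) (S : J -> C) :
  (forall j, hsum (F j) (S j)) ->
  hsum (fun i => \sum_(j <- r) F j i) (\sum_(j <- r) S j).
Proof.
move=> h; elim: r => [|j r IH].
  by rewrite big_nil; apply: eq_hsum hsum0 => i; rewrite big_nil.
rewrite big_cons; apply: eq_hsum (hsumD (h j) IH) => i.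
by rewrite big_cons.
Qed.

Lemma hsum_conj f s : hsum f s -> hsum (fun i => conjc (f i)) (conjc s).
Proof.
move=> fs e e0; have [A0 h] := fs _ e0; exists A0 => A /h.
by rewrite -ncJ rmorphB rmorph_sum.
Qed.

Lemma hsum1 i0 c : hsum (fun i => if i == i0 then c else 0) c.
Proof.
move=> e e0; exists [fset i0]%fset => A; rewrite fsub1set => iA.
rewrite (big_fsetD1 i0)//= eqxx big_seq big1 ?addr0 ?subrr ?nc0 ?ltW//.
by move=> i; rewrite !inE => /andP[/negPf ->].
Qed.

Lemma hsum_nneg (f : I -> R) B : (forall i, 0 <= f i) ->
  (forall A, \sum_(i <- A) f i <= B) -> exists s : R, hsum (fun i => (f i)%:C) s%:C.
Proof.
move=> f0 fB.
pose S := [set x : R | exists A : {fset I}, x = \sum_(i <- A) f i].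
have hS : has_sup S.
  split; first by exists 0, fset0; rewrite big_seq_fset0.
  by exists B => x [A ->].
exists (sup S) => e e0.
have [x [A0 ->] h] := sup_adherent e0 hS.
exists A0 => A sA.
have -> : \sum_(i <- A) (f i)%:C - (sup S)%:C = (\sum_(i <- A) f i - sup S)%:C.
  by rewrite rmorphB rmorph_sum.
rewrite ncR.
have h1 : \sum_(i <- A) f i <= sup S.
  by apply: ub_le_sup; [exact: hS.2|exists A].
have h2 : \sum_(i <- A0) f i <= \sum_(i <- A) f i.
  by rewrite (sum_fset_split _ sA) lerDl sumr_ge0.
by rewrite ler_norml; lra.
Qed.

(** Written as [(|f| + f) - |f|], a difference of two nonnegative families with bounded finite
    sums. *)
Lemma hsum_real (f : I -> R) B : (forall A, \sum_(i <- A) `|f i| <= B) ->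
  exists s : R, hsum (fun i => (f i)%:C) s%:C.
Proof.
move=> fB.
have [|A|s1 h1] := @hsum_nneg (fun i => (`|f i| + f i)) (B + B).
- by move=> i; have := ler_norm (- f i); rewrite normrN; lra.
- rewrite big_split lerD//.
  by apply: le_trans (fB A); apply: ler_sum => i _; exact: ler_norm.
have [|s2 h2] := @hsum_nneg (fun i => `|f i|) B _ fB; first by [].
exists (s1 - s2); rewrite rmorphB /=; apply: eq_hsum (hsumB h1 h2) => i.
by rewrite -rmorphB /= addrC addKr.
Qed.

Lemma abd_hsum B f : abd B f -> exists s, hsum f s.
Proof.
move=> fB.
have [A|s1 h1] := @hsum_real (fun i => complex.Re (f i)) B.
  by apply: le_trans (fB A); apply: ler_sum => i _; exact: nc_Re.
have [A|s2 h2] := @hsum_real (fun i => complex.Im (f i)) B.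
  by apply: le_trans (fB A); apply: ler_sum => i _; exact: nc_Im.
exists (s1%:C + 'i * s2%:C).
by apply: eq_hsum (hsumD h1 (hsumZ 'i h2)) => i; rewrite -complexE.
Qed.

End OneIndex.

(** Made for the shift [incr i] of multi-indices, a bijection onto those with positive exponent at
    [i]: [decr i] inverts it there, and the terms elsewhere are required to vanish. *)
Lemma hsum_reindex (I J : choiceType) (h : J -> I) (h' : I -> J) (f : I -> C) s :
  cancel h h' -> (forall i, f i != 0 -> h (h' i) = i) ->
  hsum (f \o h) s -> hsum f s.
Proof.
move=> hK h'K fs e e0; have [A0 hA] := fs _ e0.
exists (h @` A0)%fset => A sA.
pose B := (h' @` [fset i in A | h (h' i) == i])%fset.
have -> : \sum_(i <- A) f i = \sum_(j <- B) f (h j).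
  rewrite (bigID (fun i => h (h' i) == i)) /= [X in _ + X]big1 ?addr0; last first.
    by move=> i hi; apply/eqP; apply: contraNT hi => /h'K ->.
  rewrite -big_filter.
  have -> : \sum_(i <- [seq i <- A | h (h' i) == i]) f i =
     \sum_(j <- [seq h' i | i <- [seq i <- A | h (h' i) == i]]) f (h j).
    rewrite big_map; apply: eq_big_seq => i; rewrite mem_filter => /andP[/eqP fi _].
    by rewrite fi.
  apply: perm_big; apply: uniq_perm => //.
    rewrite map_inj_in_uniq ?filter_uniq ?fset_uniq//.
    move=> x y; rewrite !mem_filter => /andP[/eqP fx _] /andP[/eqP fy _] e1.
    by rewrite -fx e1 fy.
  move=> j; apply/mapP/imfsetP; rewrite /=.
    by move=> [i0]; rewrite mem_filter => /andP[fi iA] ->; exists i0 => //; rewrite !inE iA.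
  by move=> [i0]; rewrite !inE /= => /andP[iA fi] ->; exists i0 => //; rewrite mem_filter fi.
apply: hA; apply/fsubsetP => j jA; apply/imfsetP; exists (h j); last by rewrite hK.
rewrite !inE hK eqxx andbT; apply: (fsubsetP sA); apply/imfsetP.
by exists j.
Qed.

Lemma abd_reindex (I J : choiceType) (h : J -> I) (f : I -> C) B :
  injective h -> abd B f -> abd B (f \o h).
Proof.
move=> hI fB A; apply: le_trans (fB (h @` A)%fset).
rewrite le_eqVlt; apply/orP; left; apply/eqP.
rewrite -(big_map h predT (fun i => nc (f i))); apply: perm_big; apply: uniq_perm => //.
  by rewrite map_inj_uniq.
by move=> i; apply/mapP/imfsetP => /= -[j jA ->]; exists j.
Qed.

Lemma abd_reindexV (I J : choiceType) (h : J -> I) (h' : I -> J) (f : I -> C) B :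
  cancel h h' -> (forall i, f i != 0 -> h (h' i) = i) ->
  abd B (f \o h) -> abd B f.
Proof.
move=> hK h'K fB A; apply: le_trans (fB (h' @` [fset i in A | h (h' i) == i])%fset).
rewrite (bigID (fun i => h (h' i) == i)) /= [X in _ + X]big1 ?addr0; last first.
  by move=> i hi; apply/eqP; rewrite nc_eq0; apply: contraNT hi => /h'K ->.
rewrite -big_filter le_eqVlt; apply/orP; left; apply/eqP.
have -> : \sum_(i <- [seq i <- A | h (h' i) == i]) nc (f i) =
   \sum_(j <- [seq h' i | i <- [seq i <- A | h (h' i) == i]]) nc (f (h j)).
  rewrite big_map; apply: eq_big_seq => i; rewrite mem_filter => /andP[/eqP fi _].
  by rewrite fi.
apply: perm_big; apply: uniq_perm => //.
  rewrite map_inj_in_uniq ?filter_uniq ?fset_uniq//.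
  move=> x y; rewrite !mem_filter => /andP[/eqP fx _] /andP[/eqP fy _] e1.
  by rewrite -fx e1 fy.
move=> j; apply/mapP/imfsetP; rewrite /=.
  by move=> [i0]; rewrite mem_filter => /andP[fi iA] ->; exists i0 => //; rewrite !inE iA.
by move=> [i0]; rewrite !inE /= => /andP[iA fi] ->; exists i0 => //; rewrite mem_filter fi.
Qed.

(** Up to a small error everything happens in finitely many rows: the others contribute at most the
    tail of [b], uniformly in the finite set of columns. This double sum is what completeness,
    [An_sum], needs. *)
Lemma hsum_exchange (I J : choiceType) (f : I -> J -> C) (b : I -> R) (B : R)
    (r : I -> C) (d : J -> C) :
  (forall i, abd (b i) (f i)) -> (forall A : {fset I}, \sum_(i <- A) b i <= B) ->
  (forall i, hsum (f i) (r i)) -> (forall j, hsum (f ^~ j) (d j)) ->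
  exists2 S, hsum r S & hsum d S.
Proof.
move=> fb bB fr fd.
have b0 i : 0 <= b i := abd_ge0 (fb i).
have cb : abd B (fun i => (b i)%:C).
  by move=> A; under eq_bigr do rewrite ncR ger0_norm//.
have rb i : nc (r i) <= b i := hsum_le (fb i) (fr i).
have [S rS] : exists S, hsum r S.
  apply: (@abd_hsum _ B); apply: le_abd cb => i.
  by rewrite ncR ger0_norm.
exists S; first by []. 
move=> e e0; have e3 : 0 < e / 3 by rewrite divr_gt0.
have [M1 hM1] := abd_tail cb e3.
have [M2 hM2] := rS _ e3.
pose M := (M1 `|` M2)%fset.
have := hsum_sum M fr; move=> /(_ _ e3)[A0 hA].
exists A0 => A sA.
have h1 := hA _ sA.
have h2 := hM2 M (fsubsetUr _ _).
have h3 : nc (\sum_(j <- A) d j - \sum_(j <- A) \sum_(i <- M) f i j) <= e / 3.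
  apply: (@hsum_near _ (fun i => \sum_(j <- A) f i j)).
    exact: hsum_sum.
  exists M => M' sM; rewrite (sum_fset_split _ sM) [X in _ - X]exchange_big /=.
  rewrite addrC addKr; apply: le_trans (nc_sum _ _ _) _.
  apply: (@le_trans _ _ (\sum_(i <- (M' `\` M)%fset) nc (b i)%:C)).
    apply: ler_sum => i _; rewrite ncR ger0_norm//.
    by apply: le_trans (nc_sum _ _ _) (fb i A).
  apply: hM1; apply/fdisjointP => i iM; rewrite !inE negb_and negbK.
  by rewrite iM.
set x := \sum_(j <- A) d j in h3 *; set y := \sum_(j <- A) _ in h1 h3.
set z := \sum_(i <- M) _ in h1 h2.
have -> : x - S = (x - y) + ((y - z) + (z - S)) by ring.
have -> : e = e / 3 + (e / 3 + e / 3) by field.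
by rewrite (le_trans (ncD _ _))// lerD// (le_trans (ncD _ _))// lerD.
Qed.

End Hsum.

(** * Power series on polydiscs *)

Section PowerSeries.
Variable R : realType.
Local Notation C := R[i].
Local Notation midx N := {ffun 'I_N -> nat}.

(** The value of the monomial at the corner (t, ..., t) of the polydisc, see [monomial_const]. *)
Definition wt N (t : R) (a : midx N) : R := t ^+ (\sum_j a j).
Definition incr N (i : 'I_N) (a : midx N) : midx N := [ffun j => (a j + (j == i))%N].
Definition decr N (i : 'I_N) (a : midx N) : midx N := [ffun j => (a j - (j == i))%N].

Lemma wt_ge0 N t (a : midx N) : 0 <= t -> 0 <= wt t a.
Proof. by move=> t0; rewrite exprn_ge0. Qed.

Lemma wt_gt0 N t (a : midx N) : 0 < t -> 0 < wt t a.
Proof. by move=> t0; rewrite exprn_gt0. Qed.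

Lemma incrK N (i : 'I_N) : cancel (incr i) (decr i).
Proof. by move=> a; apply/ffunP => j; rewrite !ffunE addnK. Qed.

Lemma decrK N (i : 'I_N) (a : midx N) : (0 < a i)%N -> incr i (decr i a) = a.
Proof.
by move=> ai; apply/ffunP => j; rewrite !ffunE; case: eqP => [->|_]; rewrite ?subn0 ?addn0 ?subn1 ?addn1 ?prednK.
Qed.

Lemma sum_incr N (i : 'I_N) (a : midx N) : (\sum_j incr i a j = (\sum_j a j).+1)%N.
Proof.
under eq_bigr do rewrite ffunE.
rewrite big_split /= -addn1; congr addn.
by rewrite (bigD1 i)//= eqxx big1 ?addn0// => j /negPf ->.
Qed.

Lemma wt_incr N (i : 'I_N) t a : wt t (incr i a) = t * wt t a.
Proof. by rewrite /wt sum_incr exprS. Qed.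

Lemma monomial_incr N (i : 'I_N) a (u : 'rV[C]_N) :
  monomial (incr i a) u = u 0 i * monomial a u.
Proof.
rewrite /monomial (bigD1 i)//= [in RHS](bigD1 i)//= mulrA ffunE eqxx addn1 exprS.
by congr (_ * _); apply: eq_bigr => j /negPf ji; rewrite ffunE ji addn0.
Qed.

Lemma nc_monomial N (a : midx N) (u : 'rV[C]_N) t :
  nv u <= t -> nc (monomial a u) <= wt t a.
Proof.
move=> ut; rewrite /monomial ncprod /wt -prodrXr.
apply: ler_prod => i _; rewrite ncX exprn_ge0 ?nc_ge0//=.
by rewrite lerXn2r ?nnegrE ?nc_ge0//; [exact: le_trans (nv_ge0 u) ut|exact: le_trans (nv_comp u i) ut].
Qed.

Lemma monomial_at0 N (a : midx N) :
  monomial a (0 : 'rV[C]_N) = (a == [ffun=> 0%N])%:R.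
Proof.
case: eqP => [->|/eqP a0].
  by rewrite /monomial big1// => i _; rewrite ffunE expr0.
have [i ai] : exists i, a i != 0%N.
  apply: contrapT => h; move/eqP: a0; apply; apply/ffunP => i; rewrite ffunE.
  by apply/eqP; apply: contrapT => h2; apply: h; exists i; apply/negP.
by rewrite /monomial (bigD1 i)//= mxE expr0n (negPf ai) mul0r.
Qed.

Definition psum N (c : midx N -> C) (t B : R) :=
  forall A : {fset midx N}, \sum_(a <- A) nc (c a) * wt t a <= B.

(** The closed ball of radius [B] in the Banach algebra of power series on the closed polydisc of
    radius [t]; nothing is said of [P] outside the polydisc. Carrying a bound instead of the norm
    itself turns closure properties into plain estimates. *)
Definition An N (t B : R) (P : 'rV[C]_N -> C) := 0 < t /\
  exists2 c : midx N -> C, psum c t B &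
  forall u, nv u <= t -> hsum (fun a => c a * monomial a u) (P u).

Lemma psum_abd N (c : midx N -> C) t B u :
  psum c t B -> nv u <= t -> abd B (fun a => c a * monomial a u).
Proof.
move=> cB ut A; apply: le_trans (cB A); apply: ler_sum => a _.
by rewrite ncM ler_wpM2l ?nc_ge0// nc_monomial.
Qed.

Lemma An_gt0 N t B (P : 'rV[C]_N -> C) : An t B P -> 0 < t. Proof. by case. Qed.

Lemma An_ge0 N t B (P : 'rV[C]_N -> C) : An t B P -> 0 <= B.
Proof. by move=> [_ [c /(_ fset0)]]; rewrite big_seq_fset0. Qed.

Lemma An_bound N t B (P : 'rV[C]_N -> C) u : An t B P -> nv u <= t -> nc (P u) <= B.
Proof. by move=> [_ [c cB h]] ut; apply: hsum_le (psum_abd cB ut) (h _ ut). Qed.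

Lemma eq_An N t B (P Q : 'rV[C]_N -> C) :
  (forall u, nv u <= t -> P u = Q u) -> An t B P -> An t B Q.
Proof.
move=> PQ [t0 [c cB h]]; split=> //; exists c => // u ut.
by rewrite -PQ//; apply: h.
Qed.

Lemma An_le N t B B' (P : 'rV[C]_N -> C) : B <= B' -> An t B P -> An t B' P.
Proof.
move=> BB' [t0 [c cB h]]; split=> //; exists c => // A.
exact: le_trans (cB A) BB'.
Qed.

Lemma An_shrink N t t' B (P : 'rV[C]_N -> C) :
  0 < t' -> t' <= t -> An t B P -> An t' B P.
Proof.
move=> t0 tt [_ [c cB h]]; split => //; exists c => [A|u ut].
  apply: le_trans (cB A); apply: ler_sum => a _; rewrite ler_wpM2l ?nc_ge0//.
  by rewrite /wt lerXn2r// nnegrE ltW// (lt_le_trans t0).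
by apply: h; exact: le_trans tt.
Qed.

(* Rotating each coefficient onto the positive axis turns a sum of moduli into
   the modulus of a sum, to which the bounds on the summands apply. *)
Lemma nc_phase (d : C) : exists2 w : C, nc w <= 1 & w * d = (nc d)%:C.
Proof.
have [->|d0] := eqVneq d 0; first by exists 0; rewrite ?nc0// mul0r.
exists ((nc d)%:C / d); last by rewrite divfK.
by rewrite ncM ncV ncR ger0_norm ?nc_ge0// divff// nc_eq0.
Qed.

(** Completeness of the algebra, with the norm of the sum at most the sum of the norms. Products and
    compositions are obtained from it. *)
Lemma An_sum N (I : choiceType) (b : I -> R) t B (P : I -> 'rV[C]_N -> C) Q :
  0 < t -> (forall i, An t (b i) (P i)) ->
  (forall A : {fset I}, \sum_(i <- A) b i <= B) ->
  (forall u, nv u <= t -> hsum (fun i => P i u) (Q u)) -> An t B Q.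
Proof.
move=> t0 hP bB hQ; split => //.
have b0 i : 0 <= b i := An_ge0 (hP i).
have hc i : exists c, psum c t (b i) /\
  forall u, nv u <= t -> hsum (fun a => c a * monomial a u) (P i u).
  by have [_ [c c1 c2]] := hP i; exists c.
have {hc}[c hc] := choice hc.
have ci i a : nc (c i a) * wt t a <= b i.
  by have := (hc i).1 [fset a]%fset; rewrite big_seq_fset1.
have hd a : exists d, hsum (fun i => c i a) d.
  apply: (@abd_hsum _ _ (B / wt t a)) => A.
  rewrite ler_pdivlMr ?wt_gt0// mulr_suml.
  by apply: le_trans (bB A); apply: ler_sum.
have {hd}[d hd] := choice hd.
exists d => [A|u ut].
  (* The phase [w] depends on the column only, so the finite combination over [A] is still a
     convergent sum over [i], with terms of modulus at most [b i]. *)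
  have hw a : exists w, nc w <= 1 /\ w * d a = (nc (d a))%:C.
    by have [w w1 w2] := nc_phase (d a); exists w.
  have {hw}[w hw] := choice hw.
  have hs : hsum (fun i => \sum_(a <- A) (w a * (wt t a)%:C) * c i a)
            (\sum_(a <- A) (w a * (wt t a)%:C) * d a).
    by apply: hsum_sum => a; apply: hsumZ.
  have /hsum_le/(_ hs) : abd B (fun i => \sum_(a <- A) (w a * (wt t a)%:C) * c i a).
    move=> A'; apply: le_trans (bB A'); apply: ler_sum => i _.
    apply: le_trans (nc_sum _ _ _) _; apply: le_trans ((hc i).1 A).
    apply: ler_sum => a _; rewrite !ncM ncR ger0_norm ?(wt_ge0 _ (ltW t0))//.
    rewrite [leLHS]mulrC ler_wpM2l ?nc_ge0// ler_piMl ?(wt_ge0 _ (ltW t0))//.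
    exact: (hw a).1.
  suff -> : \sum_(a <- A) w a * (wt t a)%:C * d a = (\sum_(a <- A) nc (d a) * wt t a)%:C.
    by move=> h; apply: le_trans h; rewrite ncR ler_norm.
  rewrite rmorph_sum; apply: eq_bigr => a _.
  by rewrite mulrAC (hw a).2 rmorphM.
have [i|i|a|S h1 h2] := @hsum_exchange _ _ _ (fun i a => c i a * monomial a u) b B
  (fun i => P i u) (fun a => d a * monomial a u) _ bB.
- exact: psum_abd (hc i).1 ut.
- exact: (hc i).2.
- by under eq_fun do rewrite mulrC; rewrite mulrC; exact: hsumZ.
by rewrite (hsum_uniq (hQ _ ut) h1).
Qed.

Lemma An_scale N t B c (P : 'rV[C]_N -> C) : An t B P -> An t (nc c * B) (fun u => c * P u).
Proof.
move=> [t0 [d dB h]]; split => //; exists (fun a => c * d a) => [A|u ut].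
  under eq_bigr do rewrite ncM -mulrA.
  by rewrite -mulr_sumr ler_wpM2l ?nc_ge0// dB.
by apply: eq_hsum (hsumZ c (h _ ut)) => a; rewrite mulrA.
Qed.

Lemma An_add N t B B' (P Q : 'rV[C]_N -> C) :
  An t B P -> An t B' Q -> An t (B + B') (fun u => P u + Q u).
Proof.
move=> [t0 [c cB h]] [_ [d dB h']]; split => //; exists (fun a => c a + d a) => [A|u ut].
  apply: le_trans (lerD (cB A) (dB A)); rewrite -big_split /=.
  by apply: ler_sum => a _; rewrite -mulrDl ler_wpM2r ?(wt_ge0 _ (ltW t0))// ncD.
by apply: eq_hsum (hsumD (h _ ut) (h' _ ut)) => a; rewrite mulrDl.
Qed.

Lemma An_cst N t c : 0 < t -> An t (nc c) (fun _ : 'rV[C]_N => c).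
Proof.
move=> t0; split => //.
pose z : midx N := [ffun=> 0%N].
have wz : wt t z = 1 by rewrite /wt big1 ?expr0// => i _; rewrite ffunE.
have mz u : monomial z u = 1 :> C by rewrite /monomial big1// => i _; rewrite ffunE expr0.
exists (fun a => if a == z then c else 0) => [A|u ut].
  have [zA|zA] := boolP (z \in A).
    rewrite (big_fsetD1 z)//= eqxx wz mulr1 big_seq big1 ?addr0//.
    by move=> a; rewrite !inE => /andP[/negPf -> _]; rewrite nc0 mul0r.
  rewrite big_seq big1 ?nc_ge0// => a aA.
  by case: eqP aA => [->|_]; rewrite ?(negPf zA)// nc0 mul0r.
apply: eq_hsum (hsum1 z c) => a; case: eqP => [->|_]; rewrite ?mul0r// mz mulr1.
by [].
Qed.

Lemma An_shift N t B i (P : 'rV[C]_N -> C) :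
  An t B P -> An t (t * B) (fun u => u 0 i * P u).
Proof.
move=> [t0 [c cB h]]; split => //.
pose c' (a : midx N) := if (0 < a i)%N then c (decr i a) else 0.
have ci a : c' (incr i a) = c a.
  by rewrite /c' incrK ffunE eqxx addn1.
have cb : abd (t * B) (fun a => c' a * (wt t a)%:C).
  apply: (@abd_reindexV _ _ _ (incr i) (decr i)).
  - exact: incrK.
  - by move=> a; rewrite /c'; case: ifP => [ai _|_]; rewrite ?mul0r ?eqxx// decrK.
  move=> A /=; under eq_bigr do rewrite ci wt_incr ncM ncR ger0_norm ?mulr_ge0 ?(ltW t0) ?(wt_ge0 _ (ltW t0))// mulrCA.
  by rewrite -mulr_sumr ler_wpM2l// ltW.
exists c' => [A|u ut].
  apply: le_trans (cb A); apply: ler_sum => a _.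
  by rewrite ncM ncR ger0_norm ?(wt_ge0 _ (ltW t0)).
apply: (@hsum_reindex _ _ _ (incr i) (decr i)).
- exact: incrK.
- by move=> a; rewrite /c'; case: ifP => [ai _|_]; rewrite ?mul0r ?eqxx// decrK.
by apply: eq_hsum (hsumZ (u 0 i) (h _ ut)) => a /=; rewrite ci monomial_incr mulrCA.
Qed.

Lemma An_coord N t i : 0 < t -> An t t (fun u : 'rV[C]_N => u 0 i).
Proof.
move=> t0; have := An_shift i (An_cst N 1 t0); rewrite nc1 mulr1.
by apply: eq_An => u _; rewrite mulr1.
Qed.

Lemma An_coordX N t B i n (P : 'rV[C]_N -> C) :
  An t B P -> An t (t ^+ n * B) (fun u => u 0 i ^+ n * P u).
Proof.
move=> hP; elim: n => [|n IH].
  by rewrite mul1r; apply: eq_An hP => u _; rewrite mul1r.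
by rewrite exprS -mulrA; apply: eq_An (An_shift i IH) => u _; rewrite exprS mulrA.
Qed.

Lemma An_monomial N t B a (P : 'rV[C]_N -> C) :
  An t B P -> An t (wt t a * B) (fun u => monomial a u * P u).
Proof.
move=> hP; rewrite /monomial /wt -prodrXr.
elim: (index_enum _) => [|i s IH].
  by rewrite big_nil mul1r; apply: eq_An hP => u _; rewrite big_nil mul1r.
rewrite big_cons -mulrA; apply: eq_An (An_coordX i (a i) IH) => u _.
by rewrite big_cons mulrA.
Qed.

(** In place of a Cauchy product, [P * Q] is summed as [c a] times [monomial a * Q]; a monomial
    multiplies the norm by at most its weight. *)
Lemma An_mul N t B B' (P Q : 'rV[C]_N -> C) :
  An t B P -> An t B' Q -> An t (B * B') (fun u => P u * Q u).
Proof.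
move=> [t0 [c cB h]] hQ.
apply: (@An_sum _ _ (fun a => nc (c a) * (wt t a * B')) _ _
  (fun a u => c a * (monomial a u * Q u))) => // [a|A|u ut].
- by apply: An_scale; apply: An_monomial.
- under eq_bigr do rewrite mulrA; rewrite -mulr_suml ler_wpM2r//.
  exact: An_ge0 hQ.
rewrite mulrC; apply: eq_hsum (hsumZ (Q u) (h _ ut)) => a.
by rewrite mulrC mulrA.
Qed.

Lemma An_exp N t B (P : 'rV[C]_N -> C) n : An t B P -> An t (B ^+ n) (fun u => P u ^+ n).
Proof.
move=> hP; elim: n => [|n IH].
  rewrite expr0 -(nc1 R); under eq_fun do rewrite expr0.
  by apply: An_cst; exact: An_gt0 hP.
by rewrite exprS; under eq_fun do rewrite exprS; apply: An_mul.
Qed.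

(** The composite is the sum of [c a] times products of powers of the [G j], of norm at most
    [wt s a]. Hence the condition on radii: the norm of each inner series is at most the radius of
    the outer one. *)
Lemma An_comp N M t s B (P : 'rV[C]_N -> C) (G : 'I_N -> 'rV[C]_M -> C) :
  0 < t -> An s B P -> (forall j, An t s (G j)) ->
  An t B (fun u => P (\row_j G j u)).
Proof.
move=> t0 [s0 [c cB h]] hG.
apply: (@An_sum _ _ (fun a => nc (c a) * wt s a) _ _
  (fun a u => c a * \prod_j G j u ^+ a j)) => // [a|u ut].
  apply: An_scale; rewrite /wt -prodrXr.
  elim: (index_enum _) => [|i r IH].
    rewrite big_nil -(nc1 R); apply: eq_An (An_cst M 1 t0) => u _.
    by rewrite big_nil.
  rewrite big_cons; apply: eq_An (An_mul (An_exp (a i) (hG i)) IH) => u _.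
  by rewrite big_cons.
have us : nv (\row_j G j u) <= s.
  by apply: nv_le => [|j]; [exact: ltW|rewrite mxE; apply: An_bound (hG j) ut].
apply: eq_hsum (h _ us) => a; congr (_ * _); apply: eq_bigr => j _.
by rewrite mxE.
Qed.

(** Multiplying the radius by [q <= 1] multiplies every weight of positive degree by at most [q].
    Without constant term the norm is thus as small as wished, which provides continuity and the
    small inner series that [An_comp] asks for. *)
Lemma An_small N t B (P : 'rV[C]_N -> C) s : An t B P -> P 0 = 0 -> 0 < s ->
  exists t', [/\ 0 < t', t' <= t & An t' s P].
Proof.
move=> hP P0 s0; have B0 := An_ge0 hP; move: hP => [t0 [c cB h]].
pose z : midx N := [ffun=> 0%N].
have cz : c z = 0.
  have := h 0; rewrite nv0 ltW// P0 => /(_ isT) h0.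
  apply: hsum_uniq h0; apply: eq_hsum (hsum1 z (c z)) => a.
  by rewrite monomial_at0; case: eqP => [->|_]; rewrite ?mulr1 ?mulr0.
(* The denominator [B + 1] stays positive when [B = 0]. *)
pose q := Num.min 1 (s / (B + 1)).
have B1 : 0 < B + 1 by rewrite ltr_wpDl.
have q0 : 0 < q by rewrite lt_min ltr01 divr_gt0.
have q1 : q <= 1 by rewrite ge_min lexx.
have qs : q * B <= s.
  apply: (@le_trans _ _ (s / (B + 1) * (B + 1))); last by rewrite divfK// gt_eqF.
  by rewrite ler_pM ?(ltW q0)// ?ge_min ?lexx ?orbT// lerDl.
have qt : q * t <= t by rewrite ger_pMl.
exists (q * t); split => //; first by rewrite mulr_gt0.
split; first by rewrite mulr_gt0.
exists c => [A|u ut]; last by apply: h; exact: le_trans qt.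
apply: (@le_trans _ _ (q * \sum_(a <- A) nc (c a) * wt t a)); last first.
  by apply: le_trans qs; rewrite ler_wpM2l// ltW.
rewrite mulr_sumr; apply: ler_sum => a _.
have [->|az] := eqVneq a z; first by rewrite cz nc0 !mul0r mulr0.
rewrite [leRHS]mulrCA ler_wpM2l ?nc_ge0// /wt exprMn ler_wpM2r ?exprn_ge0 ?(ltW t0)//.
have : (0 < \sum_j a j)%N.
  rewrite lt0n; apply: contra az => /eqP h0; apply/eqP/ffunP => j.
  rewrite ffunE; apply/eqP; rewrite -leqn0 -h0.
  by rewrite (bigD1 j)//= leq_addr.
case: (\sum_j a j)%N => // n _; rewrite exprS ler_piMr ?(ltW q0)//.
by rewrite exprn_ile1// ltW.
Qed.

Definition zero_at N (i : 'I_N) (u : 'rV[C]_N) : 'rV[C]_N :=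
  \row_j (if j == i then 0 else u 0 j).

Lemma nv_zero_at N (i : 'I_N) u : nv (zero_at i u) <= nv u.
Proof.
apply: nv_le => [|j]; first exact: nv_ge0.
by rewrite mxE; case: eqP => _; rewrite ?nc0 ?nv_ge0// nv_comp.
Qed.

Lemma monomial_zero_at N (i : 'I_N) a u :
  monomial a (zero_at i u) = if (0 < a i)%N then 0 else monomial a u.
Proof.
rewrite /monomial (bigD1 i)//= mxE eqxx expr0n; case: posnP => [ai|ai] /=.
  rewrite mul1r [RHS](bigD1 i)//= ai expr0 mul1r; apply: eq_bigr => j /negPf ji.
  by rewrite mxE ji.
by case: (a i) ai => // n _; rewrite mul0r.
Qed.

(** Division by a coordinate: subtracting [P (zero_at i u)] leaves the terms containing [u 0 i], and
    removing one such factor costs [1 / t] in the norm. *)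
Lemma An_split N t B i (P : 'rV[C]_N -> C) : An t B P ->
  exists2 g, An t (B / t) g &
  forall u, nv u <= t -> P u = P (zero_at i u) + u 0 i * g u.
Proof.
move=> [t0 [c cB h]].
have cb : psum (fun a => c (incr i a)) t (B / t).
  have ab : abd B (fun a => c a * (wt t a)%:C).
    move=> A; apply: le_trans (cB A); apply: ler_sum => a _.
    by rewrite ncM ncR ger0_norm// wt_ge0// ltW.
  move=> A; rewrite ler_pdivlMr// mulr_suml.
  apply: le_trans (abd_reindex (can_inj (@incrK _ i)) ab A).
  apply: ler_sum => a _ /=; rewrite ncM ncR wt_incr ger0_norm ?mulr_ge0 ?(ltW t0) ?(wt_ge0 _ (ltW t0))//.
  by rewrite -mulrA ler_wpM2l ?nc_ge0// mulrC.
have hg u : exists g, nv u <= t -> hsum (fun a => c (incr i a) * monomial a u) g.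
  have [ut|ut] := boolP (nv u <= t); last by exists 0.
  by have [s hs] := abd_hsum (psum_abd cb ut); exists s.
have {hg}[g hg] := choice hg.
exists g; first by split => //; exists (fun a => c (incr i a)).
move=> u ut; rewrite -[LHS](subrK (P (zero_at i u))) addrC; congr (_ + _).
have uz := le_trans (nv_zero_at i u) ut.
have h1 := hsumB (h _ ut) (h _ uz).
apply: hsum_uniq h1 _; apply: (@hsum_reindex _ _ _ (incr i) (decr i)).
- exact: incrK.
- move=> a; rewrite monomial_zero_at; case: posnP => [_|ai _]; last by rewrite decrK.
  by rewrite subrr eqxx.
apply: eq_hsum (hsumZ (u 0 i) (hg _ ut)) => a /=.
by rewrite monomial_zero_at ffunE eqxx addn1 /= mulr0 subr0 monomial_incr mulrCA.
Qed.

Lemma An_conj N t B (P : 'rV[C]_N -> C) :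
  An t B P -> An t B (fun u => conjc (P (map_mx conjc u))).
Proof.
move=> [t0 [c cB h]]; split => //; exists (fun a => conjc (c a)) => [A|u ut].
  by under eq_bigr do rewrite ncJ; exact: cB.
have ut' : nv (map_mx conjc u) <= t.
  apply: nv_le => [|i]; first exact: ltW.
  by rewrite mxE ncJ; exact: le_trans (nv_comp u i) ut.
apply: eq_hsum (hsum_conj (h _ ut')) => a.
rewrite rmorphM; congr (_ * _); rewrite /monomial rmorph_prod; apply: eq_bigr => j _.
by rewrite rmorphXn /= mxE conjcK.
Qed.

End PowerSeries.

(** * Differentiation of power series *)

Section AnDeriv.
Variable R : realType.
Local Notation C := R[i].

(* [P (u + s v)] is a power series in the N + 1 variables [(u, s)]; splitting
   off a factor [s] twice leaves the derivative and a bounded remainder. *)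
Lemma An_deriv N t B (P : 'rV[C]_N -> C) (v : 'rV[C]_N) : An t B P ->
  exists t' K g, [/\ 0 < t', An t' K g &
    forall u s, nv u <= t' -> nc s <= t' ->
      nc (P (u + s *: v) - P u - s * g u) <= K * nc s ^+ 2].
Proof.
move=> hP; have t0 := An_gt0 hP; have B0 := An_ge0 hP.
have V1 : 0 < 1 + nv v by rewrite ltr_wpDr// nv_ge0.
(* Chosen so that [t1 + t1 * nv v = t]: for [u] and [s] of size at most [t1] the point [u + s *: v]
   stays in the polydisc of radius [t]. *)
pose t1 := t / (1 + nv v).
have t1_gt0 : 0 < t1 by rewrite divr_gt0.
pose i0 : 'I_(N + 1) := rshift N ord0.
pose G (j : 'I_N) (w : 'rV[C]_(N + 1)) := w 0 (lshift 1 j) + w 0 i0 * v 0 j.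
have hG j : An t1 t (G j).
  have h1 := An_coord (lshift 1 j) t1_gt0.
  have h2 := An_mul (An_coord i0 t1_gt0) (An_cst (N + 1) (v 0 j) t1_gt0).
  apply: An_le (An_add h1 h2).
  rewrite -[X in X + _]mulr1 -mulrDr /t1 -mulrA ger_pMr// mulrC.
  by rewrite ler_pdivrMr// mul1r lerD2l nv_comp.
have b0 : 0 <= B / t1 by rewrite divr_ge0// ltW.
have hQ := An_comp t1_gt0 hP hG.
have [g1 hg1 e1] := An_split i0 hQ.
have [g2 hg2 e2] := An_split i0 hg1.
(* The coordinates of the embedding [u |-> (u, 0)]; the restriction of the first quotient [g1] to
   [s = 0] is the derivative along [v]. *)
pose H (j : 'I_(N + 1)) (u : 'rV[C]_N) : C :=
  match fintype.split j with inl j' => u 0 j' | inr _ => 0 end.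
have HE u : \row_j H j u = row_mx u 0.
  by apply/rowP => j; rewrite mxE /H mxE; case: splitP => // k _; rewrite mxE.
have hH j : An t1 t1 (H j).
  rewrite /H; case: (fintype.split j) => k; first exact: An_coord.
  by apply: An_le (An_cst N 0 t1_gt0); rewrite nc0 ltW.
have hg := An_comp t1_gt0 hg1 hH.
(* One constant serves twice: [B / t1] bounds the norm of the derivative, [B / t1 / t1] the
   remainder [g2]. *)
exists t1, (B / t1 / t1 + B / t1), (fun u => g1 (\row_j H j u)); split => //.
  by apply: An_le hg; rewrite lerDr divr_ge0// ltW.
move=> u s ut st.
pose w : 'rV[C]_(N + 1) := row_mx u s%:M.
have w0 : w 0 i0 = s by rewrite /w /i0 row_mxEr mxE eqxx.
have wt1 : nv w <= t1.
  apply: nv_le => [|j]; first exact: ltW.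
  rewrite mxE; case: splitP => k _; first exact: le_trans (nv_comp u k) ut.
  by rewrite mxE ord1 eqxx.
have zw : zero_at i0 w = row_mx u 0.
  apply/rowP => j; rewrite !mxE; case: splitP => k jk.
    case: eqP => // ji.
    by have := ltn_ord k; rewrite -jk ji /= addn0 ltnn.
  by case: eqP => [_|[]]; [rewrite mxE|apply: val_inj; rewrite /= jk ord1].
have E1 : P (u + s *: v) = P (\row_j G j w).
  by congr P; apply/rowP => j; rewrite !mxE /G w0 /w row_mxEl.
have E2 : P u = P (\row_j G j (zero_at i0 w)).
  congr P; apply/rowP => j; rewrite !mxE /G zw row_mxEl.
  by rewrite row_mxEr mxE mul0r addr0.
have := e1 w wt1; rewrite -E1 -E2 => ->; rewrite w0 (addrC (P u)) addrK.
rewrite HE -zw -mulrBr (e2 w wt1) w0 (addrC (g1 _)) addrK mulrA -expr2 ncM ncX mulrC.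
rewrite ler_wpM2r ?exprn_ge0 ?nc_ge0//.
apply: (le_trans (An_bound hg2 wt1)).
by rewrite lerDl.
Qed.

End AnDeriv.

(** * Comparison with the convergence used in the statement *)

Section HasPowerSum.
Variable R : realType.
Local Notation C := R[i].
Local Notation midx N := {ffun 'I_N -> nat}.

Lemma summable_abd (I : choiceType) (f : I -> C) :
  summable [set: I] (fun a => (complex.Re `|f a|)%:E) <-> exists B, abd B f.
Proof.
have e1 a : (`|(complex.Re `|f a|)%:E| = (nc (f a))%:E)%E.
  by rewrite abse_EFin normE /= ger0_norm// nc_ge0.
split=> [|[B fB]].
  rewrite /summable; under eq_esum do rewrite e1.
  set S := esum _ _ => Soo.
  have S0 : (0 <= S)%E by apply: esum_ge0 => a _; rewrite lee_fin nc_ge0.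
  have Sf : S \is a fin_num by rewrite ge0_fin_numE.
  exists (fine S) => A; rewrite -lee_fin fineK//.
  apply: esum_ge; exists [set` A]; first by split => //; exact: finite_fset.
  by rewrite -fsbig_seq ?fset_uniq// sumEFin.
rewrite /summable; under eq_esum do rewrite e1.
apply: (@le_lt_trans _ _ B%:E); last exact: ltry.
apply: ge_ereal_sup => x [X [Xf _] <-].
by rewrite fsbig_finite//= sumEFin lee_fin.
Qed.

Definition box_idx N m (b : {ffun 'I_N -> 'I_m}) : midx N := [ffun i => nat_of_ord (b i)].

Definition box N m : {fset midx N} :=
  [fset box_idx b | b in {: {ffun 'I_N -> 'I_m}}]%fset.

Lemma box_sum N m (F : midx N -> C) :
  \sum_(b : {ffun 'I_N -> 'I_m}) F [ffun i => nat_of_ord (b i)] = \sum_(a <- box N m) F a.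
Proof.
rewrite -(big_map (@box_idx N m) predT F).
apply: perm_big; apply: uniq_perm; [|exact: fset_uniq|].
  rewrite map_inj_uniq ?index_enum_uniq// => b b' /ffunP e; apply/ffunP => i.
  by apply: val_inj; have := e i; rewrite !ffunE.
move=> a; apply/mapP/imfsetP; rewrite /=.
  by move=> [b _ ->]; exists b.
by move=> [b _ ->]; exists b; rewrite ?mem_index_enum.
Qed.

(** The boxes are cofinal among finite sets of multi-indices, so an unordered sum is also a limit
    along them. *)
Lemma box_sup N (A : {fset midx N}) :
  exists m0, forall m, (m0 <= m)%N -> (A `<=` box N m)%fset.
Proof.
exists (\max_(a <- A) \max_i (a i).+1)%N => m hm.
apply/fsubsetP => a aA.
have ai i : (a i < m)%N.
  apply: leq_trans hm; apply: (bigmaxn_sup_seq a) => //.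
  exact: (@leq_bigmax _ (fun i => (a i).+1) i).
apply/imfsetP; exists ([ffun i => Ordinal (ai i)] : {ffun 'I_N -> 'I_m}) => //=.
by apply/ffunP => i; rewrite !ffunE.
Qed.

(** Absolute summability makes the unordered sum exist; as it is also the limit over boxes, the two
    values agree. *)
Lemma has_power_sumP N (c : midx N -> C) u s :
  has_power_sum c u s <->
  (exists B, abd B (fun a => c a * monomial a u)) /\ hsum (fun a => c a * monomial a u) s.
Proof.
rewrite /has_power_sum summable_abd.
have box_cvg t : hsum (fun a => c a * monomial a u) t ->
  forall e : R, 0 < e -> exists m0, forall m, (m0 <= m)%N ->
   nc (\sum_(b : {ffun 'I_N -> 'I_m}) c [ffun i => nat_of_ord (b i)] *
      monomial [ffun i => nat_of_ord (b i)] u - t) < e.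
  move=> h e e0; have e2 : 0 < e / 2 by rewrite divr_gt0.
  have [A0 hA] := h _ e2; have [m0 hm] := box_sup A0.
  exists m0 => m /hm /hA.
  rewrite -(box_sum m (fun a => c a * monomial a u)) => h1.
  by apply: le_lt_trans h1 _; rewrite ltr_pdivrMr// ltr_pMr// ltr1n.
split=> -[[B cB] h]; split; try by exists B.
  have [t ht] := abd_hsum cB.
  suff -> : s = t by [].
  apply/eqP; rewrite -subr_eq0; apply/eqP/nc_le0; apply/ler_addgt0Pr => e e0.
  have e2 : 0 < e / 2 by rewrite divr_gt0.
  have [m1 h1] := box_cvg _ ht _ e2.
  have /cvgCP/(_ _ e2)[m2 h2] := h.
  pose x := \sum_(b : {ffun 'I_N -> 'I_(maxn m1 m2)})
    c [ffun i => nat_of_ord (b i)] * monomial [ffun i => nat_of_ord (b i)] u.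
  have h3 : nc (x - t) < e / 2 := h1 _ (leq_maxl m1 m2).
  have h4 : nc (x - s) < e / 2 := h2 _ (leq_maxr m1 m2).
  rewrite add0r (_ : s - t = (x - t) - (x - s)); last by ring.
  by rewrite (le_trans (ncB _ _))// (splitr e) lerD// ltW.
by apply/cvgCP; exact: box_cvg.
Qed.

End HasPowerSum.

(** * Analytic and holomorphic germs *)

Section Germs.
Variable R : realType.
Local Notation C := R[i].
Local Notation midx N := {ffun 'I_N -> nat}.

Lemma psum_An N (c : midx N -> C) t B : 0 < t -> psum c t B ->
  exists2 P, An t B P &
    forall u, nv u <= t -> hsum (fun a => c a * monomial a u) (P u).
Proof.
move=> t0 cB.
have hP u : exists s, nv u <= t -> hsum (fun a => c a * monomial a u) s.
  have [ut|ut] := boolP (nv u <= t); last by exists 0.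
  by have [s hs] := abd_hsum (psum_abd cB ut); exists s.
have {hP}[P hP] := choice hP.
by exists P => //; split => //; exists c.
Qed.

Lemma monomial_const N (a : midx N) (t : R) :
  monomial a (const_mx t%:C) = (wt t a)%:C.
Proof.
rewrite /monomial /wt -prodrXr rmorph_prod; apply: eq_bigr => i _.
by rewrite mxE rmorphXn.
Qed.

(** [phi] is the identity in the holomorphic case and [real_coords] in the real-analytic one. Its
    second property yields a point near [p] at which all variables equal [t]; absolute convergence
    there bounds the weighted l1-norm of [c]. The factor 2 leaves room for the point with all
    coordinates [t +i* t]. *)
Lemma germ_An r N (phi : 'rV[C]_r -> 'rV[C]_N) (f : 'rV[C]_r -> C) (p : 'rV[C]_r) :
  (forall w, nv (phi w) <= nv w) ->
  (forall t : R, 0 < t -> exists w, phi w = const_mx t%:C /\ nv w <= 2 * t) ->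
  (exists c : midx N -> C, \forall z \near p, has_power_sum c (phi (z - p)) (f z)) <->
  (exists t B P, An t B P /\ forall z, nv (z - p) <= t -> f z = P (phi (z - p))).
Proof.
move=> phi1 phi2; split.
  move=> [c /nearP[d [d0 hd]]].
  pose t := d / 4; have t0 : 0 < t by rewrite divr_gt0.
  have [w [wE wt2]] := phi2 _ t0.
  have td : 2 * t < d by rewrite /t; lra.
  have td' : t < d by rewrite /t; lra.
  have := hd (w + p); rewrite addrK => /(_ (le_lt_trans wt2 td)).
  rewrite wE => /has_power_sumP[[B cB] _].
  have cB' : psum c t B.
    move=> A; apply: le_trans (cB A); apply: ler_sum => a _.
    by rewrite monomial_const ncM ncR ger0_norm// wt_ge0// ltW.
  have [P hP hP2] := psum_An t0 cB'.
  exists t, B, P; split => // z zt.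
  have /has_power_sumP[_ h] := hd z (le_lt_trans zt td').
  by apply: hsum_uniq h _; apply: hP2; apply: le_trans (phi1 _) zt.
move=> [t [B [P [[t0 [c cB h]] fP]]]]; exists c; apply/nearP; exists t; split => // z /ltW zt.
have pt := le_trans (phi1 _) zt.
apply/has_power_sumP; split; first by exists B; apply: psum_abd cB pt.
by rewrite fP//; apply: h.
Qed.

Lemma rcE r (z : 'rV[C]_r) j : real_coords z 0 j =
  match fintype.split j with inl k => (complex.Re (z 0 k))%:C | inr k => (complex.Im (z 0 k))%:C end.
Proof. by rewrite mxE; case: fintype.split => k; rewrite mxE. Qed.

Lemma nv_rc r (z : 'rV[C]_r) : nv (real_coords z) <= nv z.
Proof.
apply: nv_le => [|j]; first exact: nv_ge0.
rewrite rcE; case: fintype.split => k; rewrite ncR.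
- exact: le_trans (nc_Re _) (nv_comp _ _).
- exact: le_trans (nc_Im _) (nv_comp _ _).
Qed.

Lemma ReD (x y : C) : complex.Re (x + y) = complex.Re x + complex.Re y.
Proof. by case: x => a b; case: y. Qed.

Lemma ImD (x y : C) : complex.Im (x + y) = complex.Im x + complex.Im y.
Proof. by case: x => a b; case: y. Qed.

Lemma ReZ (t : R) (x : C) : complex.Re (t%:C * x) = t * complex.Re x.
Proof. by case: x => a b /=; rewrite mul0r subr0. Qed.

Lemma ImZ (t : R) (x : C) : complex.Im (t%:C * x) = t * complex.Im x.
Proof. by case: x => a b /=; rewrite mul0r addr0. Qed.

Lemma rcD r (z w : 'rV[C]_r) : real_coords (z + w) = real_coords z + real_coords w.
Proof.
apply/rowP => j; rewrite [RHS]mxE !rcE.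
by case: fintype.split => k; rewrite mxE ?ReD ?ImD rmorphD.
Qed.

Lemma rcZ r (t : R) (z : 'rV[C]_r) : real_coords (t%:C *: z) = t%:C *: real_coords z.
Proof.
apply/rowP => j; rewrite [RHS]mxE !rcE.
by case: fintype.split => k; rewrite mxE ?ReZ ?ImZ rmorphM.
Qed.

Lemma rc0 r : real_coords (0 : 'rV[C]_r) = 0.
Proof. by rewrite -(scale0r 0) -(rmorph0 (real_complex R)) rcZ rmorph0 !scale0r. Qed.

(** [ra] and [hol] are the forms in which analyticity is used: a radius, a bound, and one series
    around [p]. [raP] and [holP] identify them with the predicates of the statement. *)
Definition ra (r : nat) (f : 'rV[C]_r -> C) p := exists t B P,
  An t B P /\ forall z, nv (z - p) <= t -> f z = P (real_coords (z - p)).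

Definition hol (r : nat) (f : 'rV[C]_r -> C) p := exists t B P,
  An t B P /\ forall z, nv (z - p) <= t -> f z = P (z - p).

Lemma raP r (f : 'rV[C]_r -> C) p : real_analytic_at f p <-> ra f p.
Proof.
apply: germ_An => [w|t t0]; first exact: nv_rc.
exists (const_mx (t +i* t)); split.
  by apply/rowP => j; rewrite rcE; case: fintype.split => k; rewrite !mxE.
apply: nv_le => [|j]; first by rewrite mulr_ge0// ltW.
rewrite mxE; apply: le_trans (nc_le_ReIm _) _ => /=.
by rewrite ger0_norm ?(ltW t0)// mulrDl mul1r.
Qed.

Lemma holP r (f : 'rV[C]_r -> C) p : holomorphic_at f p <-> hol f p.
Proof.
apply: (germ_An (phi := id)) => [w|t t0]; first by [].
exists (const_mx t%:C); split => //.
apply: nv_le => [|j]; first by rewrite mulr_ge0// ltW.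
by rewrite mxE ncR ger0_norm ?(ltW t0)// mulrDl mul1r lerDl ltW.
Qed.

(** Relational, because [cdiff] has a value even where the limit does not exist. The parameter [t]
    is real, and multiplying out by [|t|] includes [t = 0]. *)
Definition has_dd r (f : 'rV[C]_r -> C) (z v : 'rV[C]_r) (d : C) :=
  forall e : R, 0 < e -> exists2 dl : R, 0 < dl & forall t : R, `|t| < dl ->
    nc (f (z + t%:C *: v) - f z - t%:C * d) <= e * `|t|.

Lemma ra_shrink r (f : 'rV[C]_r -> C) p s : 0 < s -> ra f p ->
  exists t B P, [/\ t <= s, An t B P & forall z, nv (z - p) <= t -> f z = P (real_coords (z - p))].
Proof.
move=> s0 [t [B [P [hP fP]]]].
have t0 := An_gt0 hP.
exists (Num.min t s), B, P; split.
- by rewrite ge_min lexx orbT.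
- by apply: An_shrink hP; rewrite ?ge_min ?lexx// lt_min t0.
- by move=> z zt; apply: fP; apply: le_trans zt _; rewrite ge_min lexx.
Qed.

Lemma eq_ra r (f g : 'rV[C]_r -> C) p (d : R) : 0 < d ->
  (forall z, nv (z - p) < d -> f z = g z) -> ra f p -> ra g p.
Proof.
move=> d0 fg; have d2 : 0 < d / 2 by rewrite divr_gt0.
move=> /(ra_shrink d2)[t [B [P [td hP fP]]]].
exists t, B, P; split => // z zt; rewrite -fg ?fP//.
by apply: le_lt_trans zt _; apply: le_lt_trans td _; lra.
Qed.

Lemma raD r (f g : 'rV[C]_r -> C) p : ra f p -> ra g p -> ra (fun z => f z + g z) p.
Proof.
move=> hf hg; have [t [B [P [hP fP]]]] := hf.
have [t' [B' [P' [tt hP' fP']]]] := ra_shrink (An_gt0 hP) hg.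
exists t', (B + B'), (fun u => P u + P' u); split.
  by apply: An_add => //; apply: An_shrink hP => //; exact: An_gt0 hP'.
by move=> z zt; rewrite fP ?fP'//; exact: le_trans zt tt.
Qed.

Lemma raM r (f g : 'rV[C]_r -> C) p : ra f p -> ra g p -> ra (fun z => f z * g z) p.
Proof.
move=> hf hg; have [t [B [P [hP fP]]]] := hf.
have [t' [B' [P' [tt hP' fP']]]] := ra_shrink (An_gt0 hP) hg.
exists t', (B * B'), (fun u => P u * P' u); split.
  by apply: An_mul => //; apply: An_shrink hP => //; exact: An_gt0 hP'.
by move=> z zt; rewrite fP ?fP'//; exact: le_trans zt tt.
Qed.

Lemma ra_cst r c (p : 'rV[C]_r) : ra (fun=> c) p.
Proof. by exists 1, (nc c), (fun=> c); split => //; apply: An_cst. Qed.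

Lemma ra_sum r (I : Type) (s : seq I) (F : I -> 'rV[C]_r -> C) p :
  (forall i, ra (F i) p) -> ra (fun z => \sum_(i <- s) F i z) p.
Proof.
move=> h; elim: s => [|i s IH].
  by under eq_fun do rewrite big_nil; exact: ra_cst.
by under eq_fun do rewrite big_cons; exact: raD.
Qed.

Lemma rc_conj r (z : 'rV[C]_r) : map_mx conjc (real_coords z) = real_coords z.
Proof.
apply/rowP => j; rewrite mxE rcE.
by case: fintype.split => k; rewrite conjc_real.
Qed.

Lemma ra_conj r (f : 'rV[C]_r -> C) p : ra f p -> ra (fun z => conjc (f z)) p.
Proof.
move=> [t [B [P [hP fP]]]]; exists t, B, (fun u => conjc (P (map_mx conjc u))).
split; first exact: An_conj.
by move=> z zt; rewrite rc_conj fP.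
Qed.

Lemma ra_Re r (f : 'rV[C]_r -> C) p : ra f p -> ra (fun z => (complex.Re (f z))%:C) p.
Proof.
move=> h; have := raM (raD h (ra_conj h)) (ra_cst 2^-1 p); apply: eq_ra (ltr01) _ => z _.
by rewrite ReJ_add.
Qed.

Lemma ra_Im r (f : 'rV[C]_r -> C) p : ra f p -> ra (fun z => (complex.Im (f z))%:C) p.
Proof.
move=> h; have := ra_Re (raM (ra_cst (- 'i) p) h); apply: eq_ra (ltr01) _ => z _.
by case: (f z) => a b /=; rewrite mulN1r opprK oppr0 mul0r add0r.
Qed.

Lemma ra_cont r (f : 'rV[C]_r -> C) p : ra f p -> {for p, continuous f}.
Proof.
move=> hf; apply/contP => e e0.
have [t [B [P [hP fP]]]] := raD hf (ra_cst (- f p) p).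
have P0 : P 0 = 0.
  have := fP p; rewrite subrr nv0 rc0 subrr ltW ?(An_gt0 hP)//.
  by move=> /(_ isT).
have e2 : 0 < e / 2 by rewrite divr_gt0.
have [t' [t'0 t't hP']] := An_small hP P0 e2.
exists t'; split => // z /ltW zt; rewrite fP; last exact: le_trans zt t't.
apply: le_lt_trans (An_bound hP' _) _; last by lra.
exact: le_trans (nv_rc _) zt.
Qed.

(** Finitely many radii are replaced by their minimum, so each [Q j] has to be inherited by smaller
    radii. The value 1 in the minimum keeps it meaningful for [n = 0]. *)
Lemma fin_min n (Q : 'I_n -> R -> Prop) :
  (forall j, exists2 t, 0 < t & forall t', 0 < t' -> t' <= t -> Q j t') ->
  exists2 t, 0 < t & forall j, Q j t.
Proof.
move=> h0.
have /choice[t0 h] : forall j, exists t, 0 < t /\ forall t', 0 < t' -> t' <= t -> Q j t'.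
  by move=> j; have [t ? ?] := h0 j; exists t.
pose t := \big[Num.min/1]_j t0 j.
have tpos : 0 < t.
  by rewrite /t; elim/big_ind: _ => // [x y x0 y0|j _]; [rewrite lt_min x0|case: (h j)].
exists t => // j; have [_ hj] := h j; apply: hj => //.
exact: bigmin_le.
Qed.

Lemma ra_comp r m (f : 'rV[C]_m -> C) (F : 'rV[C]_r -> 'rV[C]_m) p :
  ra f (F p) -> (forall j, ra (fun z => F z 0 j) p) -> ra (f \o F) p.
Proof.
move=> [t [B [P [hP fP]]]] hF.
have t0 := An_gt0 hP.
have hK j : ra (fun z => real_coords (F z - F p) 0 j) p.
  under eq_fun do rewrite rcE.
  by case: (fintype.split j) => k; [apply: ra_Re|apply: ra_Im];
   have := raD (hF k) (ra_cst (- (F p 0 k)) p); apply: eq_ra ltr01 _ => z _; rewrite !mxE.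
have hQ j : exists Q : 'rV[C]_(r + r) -> C, exists2 tj, 0 < tj & forall t', 0 < t' -> t' <= tj ->
    An t' (t / 2) Q /\ forall z, nv (z - p) <= t' -> real_coords (F z - F p) 0 j = Q (real_coords (z - p)).
  have [s [B' [Q [hQ QE]]]] := hK j.
  have Q0 : Q 0 = 0.
    have := QE p; rewrite !subrr nv0 ltW ?(An_gt0 hQ)// !rc0 mxE.
    by move=> /(_ isT).
  (* Real and imaginary parts are kept below [t / 2] each, since the modulus of a complex
     coordinate, at most their sum, must not exceed [t]. *)
  have t2 : 0 < t / 2 by rewrite divr_gt0.
  have [s' [s'0 s's hQ']] := An_small hQ Q0 t2.
  exists Q, s' => // t' t'0 t's; split; first exact: An_shrink hQ'.
  by move=> z zt; apply: QE; apply: le_trans zt _; apply: le_trans t's _.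
have [Q {}hQ] := choice hQ.
have [s s0 hs] := fin_min hQ.
exists s, B, (fun u => P (\row_j Q j u)); split.
  apply: An_comp hP _ => // j; apply: An_le (hs j).1; lra.
move=> z zs.
have E : real_coords (F z - F p) = \row_j Q j (real_coords (z - p)).
  by apply/rowP => j; rewrite mxE (hs j).2.
rewrite /= fP ?E//; apply: nv_le => [|j]; first exact: ltW.
have us : nv (real_coords (z - p)) <= s := le_trans (nv_rc _) zs.
apply: le_trans (nc_le_ReIm _) _.
have h1 := An_bound (hs (lshift m j)).1 us.
have h2 := An_bound (hs (rshift m j)).1 us.
move: h1 h2; rewrite -!(hs _).2// /real_coords row_mxEl row_mxEr [X in nc X]mxE ncR => h1.
by rewrite [X in nc X]mxE ncR; lra.
Qed.

(** Substitute [x_j + i y_j] for [z_j]; with both parts at most [t / 2] the modulus is at most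
    [t]. *)
Lemma hol_ra r (f : 'rV[C]_r -> C) p : hol f p -> ra f p.
Proof.
move=> [t [B [P [hP fP]]]]; have t0 := An_gt0 hP.
have t4 : 0 < t / 2 by rewrite divr_gt0.
pose G (j : 'I_r) (u : 'rV[C]_(r + r)) := u 0 (lshift r j) + 'i * u 0 (rshift r j).
have hG j : An (t / 2) t (G j).
  have := An_add (An_coord (lshift r j) t4) (An_scale 'i (An_coord (rshift r j) t4)).
  by apply: An_le; rewrite nci; lra.
exists (t / 2), B, (fun u => P (\row_j G j u)); split; first exact: An_comp hP hG.
move=> z zt; rewrite fP; last by apply: le_trans zt _; lra.
congr P; apply/rowP => j; rewrite [RHS]mxE /G /real_coords row_mxEl row_mxEr [X in _ = X + _]mxE.
by rewrite [in X in _ = _ + X]mxE -complexE.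
Qed.

Lemma An_dd r t K (P g : 'rV[C]_r -> C) u v :
   0 < t -> 0 <= K -> (forall s, nc s <= t ->
     nc (P (u + s *: v) - P u - s * g u) <= K * nc s ^+ 2) ->
   has_dd P u v (g u).
Proof.
move=> t0 K0 h e e0; have K1 : 0 < K + 1 by rewrite ltr_wpDl.
exists (Num.min t (e / (K + 1))); first by rewrite lt_min t0 divr_gt0.
move=> s; rewrite lt_min => /andP[/ltW st se].
have := h s%:C; rewrite ncR => /(_ st) h1; apply: le_trans h1 _.
rewrite expr2 mulrA ler_wpM2r//.
apply: (@le_trans _ _ ((K + 1) * `|s|)); first by rewrite ler_wpM2r// lerDl.
by rewrite mulrC -ler_pdivlMr// ltW.
Qed.

Lemma ra_deriv r (f : 'rV[C]_r -> C) p v : ra f p ->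
  exists2 g, ra g p & exists2 d, 0 < d & forall z, nv (z - p) < d -> has_dd f z v (g z).
Proof.
move=> [t [B [P [hP fP]]]].
have [t' [K [g [t'0 hg h]]]] := An_deriv (real_coords v) hP.
have t0 := An_gt0 hP.
have K0 := An_ge0 hg.
exists (fun z => g (real_coords (z - p))); first by exists t', K, g.
exists (Num.min t' (t / 2)); first by rewrite lt_min t'0 divr_gt0.
move=> z; rewrite lt_min => /andP[zt' zt2].
have ut : nv (real_coords (z - p)) <= t' by apply: le_trans (nv_rc _) (ltW zt').
move=> e e0; have [d d0 hd] := An_dd t'0 K0 (h _ ^~ ut) e0.
have V1 : 0 < nv v + 1 by rewrite ltr_wpDl// nv_ge0.
(* The second bound keeps [z + s v] in the ball where [f] equals its series. *)
exists (Num.min d (t / 2 / (nv v + 1))); first by rewrite lt_min d0 !divr_gt0.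
move=> s; rewrite lt_min => /andP[sd st].
have zs : nv (z + s%:C *: v - p) <= t.
  rewrite addrAC; apply: le_trans (nvD _ _) _.
  rewrite nvZ ncR [leRHS](splitr t) lerD ?(ltW zt2)//.
  apply: (@le_trans _ _ (`|s| * (nv v + 1))); first by rewrite ler_wpM2l// lerDl.
  by rewrite -ler_pdivlMr// ltW.
rewrite (fP _ zs) (fP z); last by apply: (le_trans (ltW zt2)); lra.
by rewrite (addrAC z) rcD rcZ; apply: hd.
Qed.

(** The factor [c] is complex: increments of a holomorphic series are estimated for complex
    parameters, and [s * c] is one. This linearity contains the Cauchy-Riemann equations. *)
Lemma hol_deriv r (f : 'rV[C]_r -> C) p v : hol f p ->
  exists2 g, hol g p & exists2 d, 0 < d & forall z, nv (z - p) < d ->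
    forall c, has_dd f z (c *: v) (c * g z).
Proof.
move=> [t [B [P [hP fP]]]].
have [t' [K [g [t'0 hg h]]]] := An_deriv v hP.
have t0 := An_gt0 hP.
have K0 := An_ge0 hg.
exists (fun z => g (z - p)); first by exists t', K, g.
exists (Num.min t' (t / 2)); first by rewrite lt_min t'0 divr_gt0.
move=> z; rewrite lt_min => /andP[zt' zt2] c.
have C1 : 0 < nc c + 1 by rewrite ltr_wpDl// nc_ge0.
have hcs s : nc s <= t' / (nc c + 1) ->
   nc (P ((z - p) + s *: (c *: v)) - P (z - p) - s * (c * g (z - p))) <= (K * nc c ^+ 2) * nc s ^+ 2.
  move=> st; rewrite scalerA (mulrA s).
  have -> : K * nc c ^+ 2 * nc s ^+ 2 = K * nc (s * c) ^+ 2 by rewrite ncM; ring.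
  apply: h; first exact: ltW.
  rewrite ncM; apply: (@le_trans _ _ (nc s * (nc c + 1))); first by rewrite ler_wpM2l ?nc_ge0// lerDl.
  by rewrite -ler_pdivlMr.
have Kc : 0 <= K * nc c ^+ 2 by rewrite mulr_ge0// exprn_ge0// nc_ge0.
move=> e e0.
have [d d0 hd] := An_dd (g := fun u => c * g u) (divr_gt0 t'0 C1) Kc hcs e0.
have V1 : 0 < nv (c *: v) + 1 by rewrite ltr_wpDl// nv_ge0.
exists (Num.min d (t / 2 / (nv (c *: v) + 1))); first by rewrite lt_min d0 !divr_gt0.
move=> s; rewrite lt_min => /andP[sd st].
have zs : nv (z + s%:C *: (c *: v) - p) <= t.
  rewrite addrAC; apply: le_trans (nvD _ _) _.
  rewrite nvZ ncR [leRHS](splitr t) lerD ?(ltW zt2)//.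
  apply: (@le_trans _ _ (`|s| * (nv (c *: v) + 1))); first by rewrite ler_wpM2l// lerDl.
  by rewrite -ler_pdivlMr// ltW.
rewrite (fP _ zs) (fP z); last by apply: (le_trans (ltW zt2)); lra.
by rewrite (addrAC z); apply: hd.
Qed.

End Germs.

(** * Directional derivatives *)

Section RealDeriv.
Variable R : realType.

Lemma is_derive_eps (g : R -> R) (x d : R) :
  (forall e : R, 0 < e -> exists2 dl, 0 < dl & forall h, `|h| < dl ->
     `|g (x + h) - g x - h * d| <= e * `|h|) <-> is_derive x 1 g d.
Proof.
split=> [H|H].
  have lim : (fun h : R => h^-1 *: (g (h *: (1 : R) + x) - g x)) @ 0^' --> d.
    apply/cvgrPdist_le => e e0; have [dl dl0 hd] := H _ e0.
    near=> h.
    have h0 : h != 0 by near: h; exact: nbhs_dnbhs_neq.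
    have hl : `|h| < dl by near: h; exact: dnbhs0_lt.
    have := hd _ hl; rewrite -ler_pdivrMr ?normr_gt0// -normfV -normrM => h1.
    apply: le_trans h1; rewrite le_eqVlt distrC; apply/orP; left; apply/eqP.
    congr (`| _ |); rewrite /GRing.scale /= mulr1 (addrC h).
    by field.
  by split; [apply/cvg_ex; exists d|apply: cvg_lim].
move=> e e0.
have lim : (fun h : R => h^-1 *: (g (h *: (1 : R) + x) - g x)) @ 0^' --> d.
  by have := @ex_derive _ _ _ _ _ _ _ H; rewrite -[X in _ --> X](@derive_val _ _ _ _ _ _ _ H).
move/cvgrPdist_le : lim => /(_ _ e0); rewrite near_withinE => /nbhs_normP[dl /= dl0 hd].
exists dl => // h hl.
have [->|h0] := eqVneq h 0; first by rewrite addr0 subrr mul0r subr0 normr0 mulr0.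
have := hd h; rewrite /= sub0r normrN => /(_ hl h0).
rewrite -ler_pdivrMr ?normr_gt0// -normfV -normrM => h1.
apply: le_trans h1; rewrite le_eqVlt [in X in _ || X]distrC; apply/orP; left; apply/eqP.
rewrite distrC; congr (`| _ |); rewrite /GRing.scale /= mulr1 (addrC h).
by field.
Unshelve. all: by end_near.
Qed.

Lemma mean_value_ineq (g dg : R -> R) (s eta : R) :
  (forall t : R, `|t| <= `|s| -> is_derive t 1 g (dg t)) ->
  (forall t : R, `|t| <= `|s| -> `|dg t| <= eta) ->
  `|g s - g 0| <= eta * `|s|.
Proof.
move=> H He.
have main (a b : R) : a < b -> (forall t, t \in `[a, b] -> `|t| <= `|s|) ->
   `|g b - g a| <= eta * `|b - a|.
  move=> ab Hab.
  have [|| c cab ->] := @MVT R g dg a b ab.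
  - by move=> t /subset_itv_oo_cc tab; apply: H; apply: Hab.
  - apply: derivable_within_continuous => t tab.
    by have := H t (Hab _ tab) => Ht; exact: ex_derive.
  rewrite normrM ler_wpM2r// He// Hab//; exact: subset_itv_oo_cc.
have [s0|s0|->] := ltgtP s 0; last by rewrite subrr !normr0 mulr0.
  have := main s 0 s0; rewrite distrC sub0r normrN; apply => t.
  rewrite in_itv /= => /andP[st t0].
  by rewrite (ler0_norm t0) (ltr0_norm s0) lerN2.
have := main 0 s s0; rewrite subr0; apply => t.
rewrite in_itv /= => /andP[st t0].
by rewrite (ger0_norm st) (gtr0_norm s0).
Qed.

End RealDeriv.

(** * Strict differentiability, chain rule and mixed derivatives *)

Section Calculus.
Variable R : realType.
Local Notation C := R[i].

Lemma ReB (x y : C) : complex.Re (x - y) = complex.Re x - complex.Re y.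
Proof. by case: x => a b; case: y. Qed.

Lemma ImB (x y : C) : complex.Im (x - y) = complex.Im x - complex.Im y.
Proof. by case: x => a b; case: y. Qed.

Lemma line_shift r (y u : 'rV[C]_r) (t h : R) :
  y + (t + h)%:C *: u = (y + t%:C *: u) + h%:C *: u.
Proof. by rewrite rmorphD scalerDl addrA. Qed.

Lemma dd_is_derive r (f : 'rV[C]_r -> C) y u (t : R) d :
  has_dd f (y + t%:C *: u) u d ->
  is_derive t 1 (fun s : R => complex.Re (f (y + s%:C *: u))) (complex.Re d) /\
  is_derive t 1 (fun s : R => complex.Im (f (y + s%:C *: u))) (complex.Im d).
Proof.
move=> H; split; apply/is_derive_eps => e e0; have [dl dl0 hd] := H _ e0;
  exists dl => // h /hd h1; rewrite line_shift; apply: le_trans h1.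
- by rewrite -ReZ -!ReB; exact: nc_Re.
- by rewrite -ImZ -!ImB; exact: nc_Im.
Qed.

Lemma ddP r (f : 'rV[C]_r -> C) z v d :
  has_dd f z v d <-> cderivable f z v /\ cdiff f z v = d.
Proof.
split=> [H|[[h1 h2] <-] e e0].
  have : has_dd f (z + (0 : R)%:C *: v) v d by rewrite rmorph0 scale0r addr0.
  move=> /dd_is_derive[h1 h2]; split.
    by split; [exact: (@ex_derive _ _ _ _ _ _ _ h1)|exact: (@ex_derive _ _ _ _ _ _ _ h2)].
  rewrite /cdiff /rdiff !derive1E.
  have -> := @derive_val _ _ _ _ _ _ _ h1.
  have -> := @derive_val _ _ _ _ _ _ _ h2.
  by case: d {H h1 h2}.
have e2 : 0 < e / 2 by rewrite divr_gt0.
have /derivableP/is_derive_eps/(_ _ e2)[d1 d10 k1] := h1.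
have /derivableP/is_derive_eps/(_ _ e2)[d2 d20 k2] := h2.
exists (Num.min d1 d2); first by rewrite lt_min d10.
move=> t; rewrite lt_min => /andP[/k1 t1 /k2 t2].
apply: le_trans (nc_le_ReIm _) _; rewrite !ReB !ImB ReZ ImZ /cdiff /rdiff !derive1E.
rewrite (_ : e * `|t| = e / 2 * `|t| + e / 2 * `|t|); last by field.
by move: t1 t2; rewrite /line /= add0r rmorph0 scale0r addr0; exact: lerD.
Qed.

Lemma dd_cdiff r (f : 'rV[C]_r -> C) z v d : has_dd f z v d -> cdiff f z v = d.
Proof. by case/ddP. Qed.

Lemma eq_dd r (f g : 'rV[C]_r -> C) z v d (dl : R) : 0 < dl ->
  (forall w, nv (w - z) < dl -> f w = g w) -> has_dd f z v d -> has_dd g z v d.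
Proof.
move=> dl0 fg H e e0; have [d1 d10 h] := H _ e0.
have V1 : 0 < nv v + 1 by rewrite ltr_wpDl// nv_ge0.
exists (Num.min d1 (dl / (nv v + 1))); first by rewrite lt_min d10 divr_gt0.
move=> t; rewrite lt_min => /andP[/h t1 t2].
rewrite -!fg ?subrr ?nv0// addrAC subrr add0r nvZ ncR.
apply: le_lt_trans (_ : `|t| * nv v <= `|t| * (nv v + 1)) _.
  by rewrite ler_wpM2l// lerDl.
by rewrite -ltr_pdivlMr.
Qed.

(** The mean value theorem concerns real-valued functions; real and imaginary parts are treated
    separately, whence the factor 2. *)
Lemma mvi r (f : 'rV[C]_r -> C) y u (s : R) (d : R -> C) c eta :
  (forall t : R, `|t| <= `|s| -> has_dd f (y + t%:C *: u) u (d t)) ->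
  (forall t : R, `|t| <= `|s| -> nc (d t - c) <= eta) ->
  nc (f (y + s%:C *: u) - f y - s%:C * c) <= 2 * eta * `|s|.
Proof.
move=> H He.
apply: le_trans (nc_le_ReIm _) _; rewrite !ReB !ImB ReZ ImZ.
rewrite (_ : 2 * eta * `|s| = eta * `|s| + eta * `|s|); last by ring.
have e0 : f y = f (y + (0 : R)%:C *: u) by rewrite rmorph0 scale0r addr0.
have lin (a x : R) : is_derive x 1 (fun t : R => t * a) a.
  apply/is_derive_eps => e e0'; exists 1 => // h _.
  by rewrite (_ : (x + h) * a - x * a - h * a = 0) ?normr0 ?mulr_ge0 ?(ltW e0')//; ring.
apply: lerD.
  pose g (t : R) := complex.Re (f (y + t%:C *: u)) - t * complex.Re c.
  have g0 : g 0 = complex.Re (f y) by rewrite /g mul0r subr0 [f y]e0.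
  have -> : complex.Re (f (y + s%:C *: u)) - complex.Re (f y) - s * complex.Re c = g s - g 0.
    by rewrite g0 /g addrAC.
  apply: (@mean_value_ineq R g (fun t => complex.Re (d t) - complex.Re c)) => t ts.
    exact: (is_deriveB (dd_is_derive (H t ts)).1 (lin _ _)).
  by rewrite -ReB; exact: le_trans (nc_Re _) (He _ ts).
pose g (t : R) := complex.Im (f (y + t%:C *: u)) - t * complex.Im c.
have g0 : g 0 = complex.Im (f y) by rewrite /g mul0r subr0 [f y]e0.
have -> : complex.Im (f (y + s%:C *: u)) - complex.Im (f y) - s * complex.Im c = g s - g 0.
  by rewrite g0 /g addrAC.
apply: (@mean_value_ineq R g (fun t => complex.Im (d t) - complex.Im c)) => t ts.
  exact: (is_deriveB (dd_is_derive (H t ts)).2 (lin _ _)).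
by rewrite -ImB; exact: le_trans (nc_Im _) (He _ ts).
Qed.

Definition C1_at r (f : 'rV[C]_r -> C) z :=
  (exists2 dl : R, 0 < dl & forall w, nv (w - z) < dl -> forall v, has_dd f w v (cdiff f w v)) /\
  forall v, {for z, continuous (cdiff f ^~ v)}.

(** The increment is travelled one direction at a time. The base point [y] is quantified after [dl],
    so that the induction hypothesis applies from the displaced point. *)
Lemma C1_list r (f : 'rV[C]_r -> C) z (J : Type) (b : J -> 'rV[C]_r) (L : seq J) :
  C1_at f z -> forall e : R, 0 < e -> exists2 dl, 0 < dl &
  forall y (s : J -> R), nv (y - z) < dl -> (forall j, `|s j| < dl) ->
    nc (f (y + \sum_(j <- L) (s j)%:C *: b j) - f y - \sum_(j <- L) (s j)%:C * cdiff f z (b j))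
    <= e * \sum_(j <- L) `|s j|.
Proof.
move=> [[d0 d00 hd] hc] e e0; elim: L => [|j L [d1 d10 IH]].
  by exists 1 => // y s _ _; rewrite !big_nil addr0 subrr subr0 nc0 mulr0.
have e2 : 0 < e / 2 by rewrite divr_gt0.
have /contP/(_ _ e2)[d2 [d20 h2]] := hc (b j).
pose m := Num.min d0 (Num.min d1 d2); have m0 : 0 < m by rewrite !lt_min d00 d10.
have B1 : 0 < nv (b j) + 1 by rewrite ltr_wpDl// nv_ge0.
(* Half of [m] for the distance from [y] to [z], half for the step along [b j]. *)
exists (Num.min (m / 2) (m / 2 / (nv (b j) + 1))).
  by rewrite lt_min !divr_gt0.
move=> y s; rewrite lt_min => /andP[ym _] sm.
have hm (t : R) : `|t| <= `|s j| -> nv (y + t%:C *: b j - z) < m.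
  move=> ts; rewrite addrAC; apply: le_lt_trans (nvD _ _) _.
  rewrite (splitr m) ltr_leD// nvZ ncR.
  apply: (@le_trans _ _ (`|s j| * (nv (b j) + 1))).
    by rewrite ler_pM ?nv_ge0// lerDl.
  by rewrite -ler_pdivlMr// ltW//; have := sm j; rewrite lt_min => /andP[].
have mE : [/\ m <= d0, m <= d1 & m <= d2] by rewrite /m !ge_min !lexx !orbT.
case: mE => md0 md1 md2.
rewrite !big_cons addrA.
set y' := y + _; set S := \sum_(_ <- L) _; set T := \sum_(_ <- L) _; set U := \sum_(_ <- L) _.
have h3 := IH y' s (lt_le_trans (hm _ (lexx _)) md1).
have h4 : nc (f y' - f y - (s j)%:C * cdiff f z (b j)) <= 2 * (e / 2) * `|s j|.
  apply: (@mvi _ _ _ _ _ (fun t => cdiff f (y + t%:C *: b j) (b j))) => t ts.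
    by apply: hd; apply: lt_le_trans (hm _ ts) md0.
  by rewrite ltW// h2//; apply: lt_le_trans (hm _ ts) md2.
rewrite (_ : _ - _ - _ = (f (y' + S) - f y' - T) + (f y' - f y - (s j)%:C * cdiff f z (b j))); last by ring.
apply: le_trans (ncD _ _) _; rewrite addrC mulrDr lerD//.
  by apply: le_trans h4 _; rewrite (_ : 2 * (e / 2) = e)//; field.
apply: h3 => i; apply: lt_le_trans (sm i) _; rewrite ge_min; apply/orP; left.
by apply: le_trans md1; rewrite ler_pdivrMr// ler_peMr ?(ltW m0)// ler1n.
Qed.

(** The real differential of [f] at [z] applied to [v], in Wirtinger form; see [C1_cdiff]. *)
Definition wirt r (f : 'rV[C]_r -> C) (z v : 'rV[C]_r) : C :=
  \sum_j (dz j f z * v 0 j + dzbar j f z * conjc (v 0 j)).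

Lemma wirtB r (f : 'rV[C]_r -> C) z v w : wirt f z (v - w) = wirt f z v - wirt f z w.
Proof.
rewrite /wirt -sumrB; apply: eq_bigr => j _; rewrite !mxE conjcB; ring.
Qed.

Lemma wirtZ r (f : 'rV[C]_r -> C) z (t : R) v : wirt f z (t%:C *: v) = t%:C * wirt f z v.
Proof.
rewrite /wirt mulr_sumr; apply: eq_bigr => j _; rewrite !mxE conjcM conjc_real; ring.
Qed.

Lemma wirt_bound r (f : 'rV[C]_r -> C) z : exists2 K, 0 <= K & forall v, nc (wirt f z v) <= K * nv v.
Proof.
exists (\sum_j (nc (dz j f z) + nc (dzbar j f z))).
  by apply: sumr_ge0 => j _; rewrite addr_ge0 ?nc_ge0.
move=> v; apply: le_trans (nc_sum _ _ _) _; rewrite mulr_suml; apply: ler_sum => j _.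
apply: le_trans (ncD _ _) _; rewrite !ncM ncJ mulrDl.
by apply: lerD; apply: ler_wpM2l; rewrite ?mulr_ge0 ?nc_ge0 //; exact: nv_comp.
Qed.

(** Together with [coef], real coordinates on C^r: the basis consists of the vectors e_j and i e_j,
    told apart by the boolean. *)
Definition dirs r (j : 'I_r * bool) : 'rV[C]_r :=
  if j.2 then 'i *: delta_mx 0 j.1 else delta_mx 0 j.1.
Definition coef r (v : 'rV[C]_r) (j : 'I_r * bool) : R :=
  if j.2 then complex.Im (v 0 j.1) else complex.Re (v 0 j.1).

Lemma sum_dirs (V : zmodType) r (F : 'I_r * bool -> V) :
  \sum_j F j = \sum_i (F (i, false) + F (i, true)).
Proof.
transitivity (\sum_i \sum_b F (i, b)).
  by rewrite pair_bigA; apply: eq_bigr => -[].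
by apply: eq_bigr => i _; rewrite big_bool addrC.
Qed.

Lemma dirs_coef r (v : 'rV[C]_r) : \sum_j (coef v j)%:C *: dirs j = v.
Proof.
rewrite sum_dirs [RHS]row_sum_delta; apply: eq_bigr => i _.
rewrite /coef /dirs /= scalerA -scalerDl; congr (_ *: _).
by rewrite mulrC -complexE.
Qed.

Lemma wirtE r (f : 'rV[C]_r -> C) z v :
  wirt f z v = \sum_j (coef v j)%:C * cdiff f z (dirs j).
Proof.
rewrite sum_dirs; apply: eq_bigr => i _; rewrite /dz /dzbar /coef /dirs /=.
set a := cdiff _ _ _; set b := cdiff _ _ _.
have -> : conjc (v 0 i) = (complex.Re (v 0 i))%:C - 'i * (complex.Im (v 0 i))%:C.
  by rewrite {1}(complexE (v 0 i)) conjcD conjcM !conjc_real conjc_i mulNr.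
rewrite {1}(complexE (v 0 i)).
set x := (complex.Re _)%:C; set y := (complex.Im _)%:C.
have -> : 2^-1 * (a - 'i * b) * (x + 'i * y) + 2^-1 * (a + 'i * b) * (x - 'i * y)
   = (2^-1 * 2) * (x * a) - 'i ^+ 2 * (2^-1 * 2) * (y * b) by ring.
by rewrite sqr_i mulVf ?pnatr_eq0// !mulN1r opprK !mul1r.
Qed.

Lemma coef_le r (v : 'rV[C]_r) j : `|coef v j| <= nv v.
Proof.
rewrite /coef; case: ifP => _.
  exact: le_trans (nc_Im _) (nv_comp _ _).
exact: le_trans (nc_Re _) (nv_comp _ _).
Qed.

(** The base point varies along with the increment; the Newton step and the symmetry of second
    derivatives use this uniformity. *)
Lemma strict_diff r (f : 'rV[C]_r -> C) z : C1_at f z ->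
  forall e : R, 0 < e -> exists2 dl, 0 < dl & forall y h, nv (y - z) < dl -> nv h < dl ->
    nc (f (y + h) - f y - wirt f z h) <= e * nv h.
Proof.
move=> f1 e e0; pose n := #|{: 'I_r * bool}|%:R + 1 : R.
have n0 : 0 < n by rewrite ltr_wpDl.
have [dl dl0 H] := @C1_list _ f z _ (@dirs r) (index_enum _) f1 _ (divr_gt0 e0 n0).
exists dl => // y h yd hd.
have := H y (coef h) yd (fun j => le_lt_trans (coef_le h j) hd).
rewrite dirs_coef -wirtE => h1; apply: le_trans h1 _.
rewrite mulrAC ler_pdivrMr// -mulrA ler_wpM2l ?(ltW e0)//.
apply: (@le_trans _ _ (\sum_(j : 'I_r * bool) nv h)).
  by apply: ler_sum => j _; exact: coef_le.
by rewrite sumr_const -mulr_natr ler_wpM2l ?nv_ge0// lerDl.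
Qed.

Lemma C1_dd r (f : 'rV[C]_r -> C) z v : C1_at f z -> has_dd f z v (wirt f z v).
Proof.
move=> f1 e e0; have V1 : 0 < nv v + 1 by rewrite ltr_wpDl// nv_ge0.
have [dl dl0 H] := strict_diff f1 (divr_gt0 e0 V1).
exists (dl / (nv v + 1)); first by rewrite divr_gt0.
move=> t ht; rewrite -wirtZ.
have tv : `|t| * nv v <= `|t| * (nv v + 1) by rewrite ler_wpM2l// lerDl.
apply: le_trans (H _ _ _ _) _; rewrite ?subrr ?nv0// ?nvZ ?ncR.
  by apply: le_lt_trans tv _; rewrite -ltr_pdivlMr.
by rewrite mulrAC ler_pdivrMr// -mulrA ler_wpM2l// ltW.
Qed.

Lemma C1_cdiff r (f : 'rV[C]_r -> C) z v : C1_at f z -> cdiff f z v = wirt f z v.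
Proof. by move=> /(C1_dd v)/dd_cdiff. Qed.

(** Only the derivative of [F] along the single direction [v] enters; strict differentiability of
    [f] absorbs the error made on [F]. *)
Lemma has_dd_comp r m (f : 'rV[C]_m -> C) (F : 'rV[C]_r -> 'rV[C]_m) z v (w : 'rV[C]_m) :
  C1_at f (F z) -> (forall j, has_dd (fun y => F y 0 j) z v (w 0 j)) ->
  has_dd (f \o F) z v (wirt f (F z) w).
Proof.
move=> f1 hF e e0.
have [K K0 hK] := wirt_bound f (F z).
have W0 := nv_ge0 w; have W1 : 0 < nv w + 1 by rewrite ltr_wpDl.
have e1 : 0 < e / 2 / (nv w + 1) by rewrite !divr_gt0.
have [dl dl0 H] := strict_diff f1 e1.
have K1 : 0 < K + 1 by rewrite ltr_wpDl.
(* The bound 1 keeps the error of [F] below [|t|], so increments stay where [f] is controlled; the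
   other bound makes the differential of that error at most [e / 2 * |t|]. *)
have e2 : 0 < Num.min 1 (e / 2 / (K + 1)) by rewrite lt_min ltr01 !divr_gt0.
have [s s0 hs] : exists2 s, 0 < s & forall j (t : R), `|t| < s ->
    nc (F (z + t%:C *: v) 0 j - F z 0 j - t%:C * w 0 j) <= Num.min 1 (e / 2 / (K + 1)) * `|t|.
  apply: fin_min => j; have [s s0 hs] := hF j _ e2.
  by exists s => // s' s'0 s's t ts; apply: hs; apply: lt_le_trans ts s's.
exists (Num.min s (dl / (nv w + 1))); first by rewrite lt_min s0 divr_gt0.
move=> t; rewrite lt_min => /andP[ts td].
pose h := F (z + t%:C *: v) - F z.
have h1 : nv (h - t%:C *: w) <= Num.min 1 (e / 2 / (K + 1)) * `|t|.
  apply: nv_le => [|j]; first by rewrite mulr_ge0// ltW.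
  by rewrite !mxE; exact: hs.
have h1a : nv (h - t%:C *: w) <= `|t|.
  by apply: le_trans h1 _; rewrite ler_piMl// ge_min lexx.
have h1b : nv (h - t%:C *: w) <= e / 2 / (K + 1) * `|t|.
  by apply: le_trans h1 _; rewrite ler_wpM2r// ge_min lexx orbT.
have h2 : nv h <= `|t| * (nv w + 1).
  rewrite -[h](subrK (t%:C *: w)); apply: le_trans (nvD _ _) _.
  by rewrite nvZ ncR; lra.
have hE : F (z + t%:C *: v) = F z + h by rewrite /h [RHS]addrC subrK.
have := H (F z) h; rewrite subrr nv0 => /(_ dl0) h3.
have {}h3 : nc (f (F z + h) - f (F z) - wirt f (F z) h) <= e / 2 * `|t|.
  apply: le_trans (h3 _) _; first by apply: le_lt_trans h2 _; rewrite -ltr_pdivlMr.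
  apply: (@le_trans _ _ (e / 2 / (nv w + 1) * (`|t| * (nv w + 1)))).
    by rewrite ler_wpM2l// ltW.
  by rewrite (mulrC `|t|) mulrA divfK// gt_eqF.
rewrite /= hE -wirtZ.
rewrite (_ : f (F z + h) - f (F z) - wirt f (F z) (t%:C *: w) = (f (F z + h) - f (F z) - wirt f (F z) h) + wirt f (F z) (h - t%:C *: w)); last first.
  by rewrite (wirtB f (F z) h); ring.
apply: le_trans (ncD _ _) _.
rewrite (_ : e * `|t| = e / 2 * `|t| + e / 2 * `|t|); last by field.
apply: lerD => //; apply: le_trans (hK _) _.
apply: (@le_trans _ _ ((K + 1) * (e / 2 / (K + 1) * `|t|))).
  by apply: ler_pM => //; rewrite ?nv_ge0// lerDl.
by rewrite mulrA mulrC [X in _ * X]mulrC divfK ?gt_eqF// mulrC.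
Qed.

(** The second difference of [f] over the parallelogram spanned by [s u] and [s v] is symmetric in
    [u] and [v]; after division by [s ^ 2] it tends to either mixed derivative. *)
Lemma schwarz r (f : 'rV[C]_r -> C) z u v :
  (exists2 dl : R, 0 < dl & forall w, nv (w - z) < dl -> forall v, has_dd f w v (cdiff f w v)) ->
  C1_at (cdiff f ^~ u) z -> C1_at (cdiff f ^~ v) z ->
  cdiff (cdiff f ^~ u) z v = cdiff (cdiff f ^~ v) z u.
Proof.
move=> [d0 d00 hd] hu hv.
have key u' v' : C1_at (cdiff f ^~ u') z -> forall e : R, 0 < e ->
  exists2 dl : R, 0 < dl & forall s : R, `|s| < dl ->
   nc (f (z + s%:C *: u' + s%:C *: v') - f (z + s%:C *: u') - (f (z + s%:C *: v') - f z)
      - s%:C * (s%:C * wirt (cdiff f ^~ u') z v')) <= 2 * (e * nv v') * `|s| * `|s|.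
  move=> h1 e e0; have [d1 d10 H] := strict_diff h1 e0.
  have V0 : 0 < nv u' + nv v' + 1 by rewrite ltr_wpDl// addr_ge0 ?nv_ge0.
  pose m := Num.min d0 d1; have m0 : 0 < m by rewrite lt_min d00.
  exists (m / (nv u' + nv v' + 1)); first by rewrite divr_gt0.
  move=> s; rewrite ltr_pdivlMr// => sm.
  have su : `|s| * nv u' < m.
    apply: le_lt_trans sm; rewrite ler_wpM2l//; have := nv_ge0 v'; lra.
  have sv : `|s| * nv v' < m.
    apply: le_lt_trans sm; rewrite ler_wpM2l//; have := nv_ge0 u'; lra.
  have md0 : m <= d0 by rewrite ge_min lexx.
  have md1 : m <= d1 by rewrite ge_min lexx orbT.
  have hz (t : R) : `|t| <= `|s| -> nv (z + t%:C *: u' - z) < m.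
    move=> ts; rewrite addrAC subrr add0r nvZ ncR; apply: le_lt_trans su.
    by rewrite ler_wpM2r// nv_ge0.
  have hz2 (t : R) : `|t| <= `|s| -> nv (z + t%:C *: u' + s%:C *: v' - z) < m.
    move=> ts; rewrite addrAC [z + _]addrC addrK; apply: le_lt_trans (nvD _ _) _.
    rewrite !nvZ !ncR; apply: le_lt_trans sm.
    apply: (@le_trans _ _ (`|s| * nv u' + `|s| * nv v')).
      by rewrite lerD2r ler_wpM2r// nv_ge0.
    by rewrite -mulrDr ler_wpM2l// lerDl.
  (* Applied to the difference of [f] in the direction [v'], along [u']: its derivative is an
     increment of [cdiff f ^~ u'], which strict differentiability estimates. *)
  have := @mvi _ (fun y => f (y + s%:C *: v') - f y) z u' s
    (fun t => cdiff f (z + t%:C *: u' + s%:C *: v') u' - cdiff f (z + t%:C *: u') u')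
    (s%:C * wirt (cdiff f ^~ u') z v') (e * nv v' * `|s|).
  rewrite !mulrA; apply => t ts.
    move=> e' e'0; have e2 : 0 < e' / 2 by rewrite divr_gt0.
    have [a1 a10 k1] := hd _ (lt_le_trans (hz _ ts) md0) u' _ e2.
    have [a2 a20 k2] := hd _ (lt_le_trans (hz2 _ ts) md0) u' _ e2.
    exists (Num.min a1 a2); first by rewrite lt_min a10.
    move=> x; rewrite lt_min => /andP[/k1 x1 /k2 x2].
    rewrite [_ + x%:C *: u' + _]addrAC.
    set A := f (_ + _ + x%:C *: u') in x2 *; set A' := f (_ + s%:C *: v') in x2 *.
    set B := f (_ + x%:C *: u') in x1 *; set B' := f (z + t%:C *: u') in x1 *.
    rewrite mulrBr (_ : _ - _ - _ = (A - A' - x%:C * cdiff f (z + t%:C *: u' + s%:C *: v') u')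
       - (B - B' - x%:C * cdiff f (z + t%:C *: u') u')); last by ring.
    apply: le_trans (ncB _ _) _.
    rewrite (_ : e' * `|x| = e' / 2 * `|x| + e' / 2 * `|x|); last by field.
    exact: (lerD x2 x1).
  rewrite -wirtZ; apply: le_trans (H _ _ _ _) _.
  - exact: lt_le_trans (hz _ ts) md1.
  - by rewrite nvZ ncR; exact: lt_le_trans sv md1.
  by rewrite nvZ ncR mulrAC mulrA.
rewrite !C1_cdiff//.
apply/eqP; rewrite -subr_eq0; apply/eqP/nc_le0/ler_addgt0Pr => e e0; rewrite add0r.
have V0 : 0 < 2 * (nv u + nv v + 1) by rewrite mulr_gt0// ltr_wpDl// addr_ge0 ?nv_ge0.
have e1 := divr_gt0 e0 V0.
have [d1 d10 H1] := key u v hu _ e1.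
have [d2 d20 H2] := key v u hv _ e1.
pose s := Num.min d1 d2 / 2.
have s0 : 0 < s by rewrite divr_gt0// lt_min d10.
have sd1 : `|s| < d1.
  rewrite gtr0_norm//; apply: (@lt_le_trans _ _ (Num.min d1 d2)); rewrite ?ge_min ?lexx//.
  by rewrite /s ltr_pdivrMr// ltr_pMr ?ltr1n// lt_min d10.
have sd2 : `|s| < d2.
  rewrite gtr0_norm//; apply: (@lt_le_trans _ _ (Num.min d1 d2)); rewrite ?ge_min ?lexx ?orbT//.
  by rewrite /s ltr_pdivrMr// ltr_pMr ?ltr1n// lt_min d10.
have := lerD (H1 _ sd1) (H2 _ sd2); rewrite (gtr0_norm s0).
rewrite [z + s%:C *: v + _]addrAC.
set a := wirt _ _ _; set b := wirt _ _ _.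
set A := f _; set B := f _; set B' := f _; set D := f _ => h.
have h2 : nc (s%:C * (s%:C * (a - b))) <= 2 * (e / (2 * (nv u + nv v + 1)) * nv v) * s * s +
    2 * (e / (2 * (nv u + nv v + 1)) * nv u) * s * s.
  apply: le_trans h; rewrite -ncN.
  rewrite (_ : - _ = (A - B - (B' - D) - s%:C * (s%:C * a)) - (A - B' - (B - D) - s%:C * (s%:C * b))); last by ring.
  exact: ncB.
move: h2; rewrite !ncM ncR (gtr0_norm s0).
have -> : 2 * (e / (2 * (nv u + nv v + 1)) * nv v) * s * s +
   2 * (e / (2 * (nv u + nv v + 1)) * nv u) * s * s
   = s * (s * (e * ((nv u + nv v) / (nv u + nv v + 1)))).
  by field; rewrite gt_eqF//; move: V0; rewrite pmulr_rgt0.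
rewrite !ler_pM2l// => h2; apply: le_trans h2 _.
have V1 : 0 < nv u + nv v + 1 by move: V0; rewrite pmulr_rgt0.
by rewrite ger_pMr// ler_pdivrMr// mul1r lerDl.
Qed.

End Calculus.

(** * Smooth functions *)

Section DirectionalRules.
Variables (R : realType) (r : nat).
Local Notation C := R[i].
Implicit Types (f g : 'rV[C]_r -> C) (z v : 'rV[C]_r).

Lemma ddD f g z v a b : has_dd f z v a -> has_dd g z v b ->
  has_dd (fun w => f w + g w) z v (a + b).
Proof.
move=> hf hg e e0; have e2 : 0 < e / 2 by rewrite divr_gt0.
have [d1 d10 k1] := hf _ e2; have [d2 d20 k2] := hg _ e2.
exists (Num.min d1 d2); first by rewrite lt_min d10.
move=> t; rewrite lt_min => /andP[/k1 t1 /k2 t2].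
rewrite (_ : _ - _ - _ = (f (z + t%:C *: v) - f z - t%:C * a) + (g (z + t%:C *: v) - g z - t%:C * b)); last by ring.
apply: le_trans (ncD _ _) _.
rewrite (_ : e * `|t| = e / 2 * `|t| + e / 2 * `|t|); last by field.
exact: lerD.
Qed.

Lemma dd_cst c z v : has_dd (fun=> c) z v 0.
Proof.
move=> e e0; exists 1 => // t _.
by rewrite subrr mulr0 subr0 nc0 mulr_ge0// ltW.
Qed.

Lemma dd_conj f z v a : has_dd f z v a -> has_dd (fun w => conjc (f w)) z v (conjc a).
Proof.
move=> hf e e0; have [d d0 h] := hf _ e0; exists d => // t /h.
by rewrite -ncJ !conjcB conjcM conjc_real.
Qed.

Lemma dd_lip f z v a : has_dd f z v a -> exists2 d : R, 0 < d &
  forall t : R, `|t| < d -> nc (f (z + t%:C *: v) - f z) <= (nc a + 1) * `|t|.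
Proof.
move=> /(_ _ ltr01)[d d0 h]; exists d => // t /h h1.
rewrite -[X in nc X](subrK (t%:C * a)); apply: le_trans (ncD _ _) _.
by rewrite ncM ncR; move: h1; lra.
Qed.

Lemma ddM f g z v a b : has_dd f z v a -> has_dd g z v b ->
  has_dd (fun w => f w * g w) z v (a * g z + f z * b).
Proof.
move=> hf hg e e0.
pose K := nc (f z) + nc (g z) + (nc a + 1) * (nc b + 1) + 1.
have A0 := nc_ge0 a; have B0 := nc_ge0 b; have F0 := nc_ge0 (f z); have G0 := nc_ge0 (g z).
have AB : 0 <= (nc a + 1) * (nc b + 1) by rewrite mulr_ge0// addr_ge0.
have K0 : 0 < K by rewrite /K; lra.
have eK : 0 < e / K by rewrite divr_gt0.
have [d1 d10 k1] := hf _ eK; have [d2 d20 k2] := hg _ eK.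
have [d3 d30 k3] := dd_lip hf; have [d4 d40 k4] := dd_lip hg.
exists (Num.min (Num.min d1 d2) (Num.min (Num.min d3 d4) (e / K))); first by rewrite !lt_min d10 d20 d30 d40.
move=> t; rewrite !lt_min => /andP[/andP[/k1 t1 /k2 t2] /andP[/andP[/k3 t3 /k4 t4] te]].
rewrite (_ : _ - _ - _ = (f (z + t%:C *: v) - f z - t%:C * a) * g z +
  f z * (g (z + t%:C *: v) - g z - t%:C * b) +
  (f (z + t%:C *: v) - f z) * (g (z + t%:C *: v) - g z)); last by ring.
apply: le_trans (ncD _ _) _; rewrite [X in _ + X]ncM.
have h3 : nc (f (z + t%:C *: v) - f z) * nc (g (z + t%:C *: v) - g z) <=
   (nc a + 1) * (nc b + 1) * (e / K * `|t|).
  apply: (@le_trans _ _ (((nc a + 1) * `|t|) * ((nc b + 1) * `|t|))).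
    by apply: ler_pM => //; exact: nc_ge0.
  rewrite (_ : _ * _ * _ = (nc a + 1) * (nc b + 1) * (`|t| * `|t|)); last by ring.
  by rewrite ler_wpM2l// ler_wpM2r// ltW.
have h1 : nc ((f (z + t%:C *: v) - f z - t%:C * a) * g z) <= nc (g z) * (e / K * `|t|).
  by rewrite ncM mulrC ler_wpM2l.
have h2 : nc (f z * (g (z + t%:C *: v) - g z - t%:C * b)) <= nc (f z) * (e / K * `|t|).
  by rewrite ncM ler_wpM2l.
have h12 := le_trans (ncD _ _) (lerD h1 h2).
apply: le_trans (lerD h12 h3) _.
rewrite -!mulrDl.
have -> : e * `|t| = K * (e / K * `|t|) by rewrite mulrA (mulrC K) divfK// gt_eqF.
by apply: ler_wpM2r; [rewrite mulr_ge0// ltW|rewrite /K; lra].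
Qed.

Lemma ddV f z v a : f z != 0 -> has_dd f z v a ->
  has_dd (fun w => (f w)^-1) z v (- a / f z ^+ 2).
Proof.
move=> fz hf e e0.
have n0 : 0 < nc (f z) by rewrite lt_def nc_ge0 nc_eq0 fz.
have A0 := nc_ge0 a.
(* [c ^+ 2 * (c / 2)] bounds from below the modulus of the denominator [f z ^+ 2 * y], as the new
   value [y] will have modulus at least [c / 2]. *)
pose c := nc (f z); pose K := (c + nc a * (nc a + 1)) / (c ^+ 2 * (c / 2)).
have D0 : 0 < c ^+ 2 * (c / 2) by rewrite mulr_gt0 ?exprn_gt0// divr_gt0.
have AA : 0 <= nc a * (nc a + 1) by rewrite mulr_ge0// addr_ge0.
have K0 : 0 < K by rewrite divr_gt0// ltr_pwDl.
have eK : 0 < e / K by rewrite divr_gt0.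
have [d1 d10 k1] := hf _ eK.
have [d2 d20 k2] := dd_lip hf.
have A1 : 0 < nc a + 1 by rewrite ltr_wpDl.
exists (Num.min (Num.min d1 d2) (Num.min (e / K) (c / 2 / (nc a + 1)))).
  by rewrite !lt_min d10 d20 eK !divr_gt0.
move=> t; rewrite !lt_min => /andP[/andP[/k1 t1 /k2 t2] /andP[te tc]].
set y := f (z + _) in t1 t2 *.
have yc : c / 2 <= nc y.
  have : nc (y - f z) <= c / 2.
    by apply: le_trans t2 _; rewrite mulrC -ler_pdivlMr// ltW.
  have : c <= nc y + nc (y - f z).
    by rewrite /c -{1}(subKr y (f z)) ncB.
  by lra.
have y0 : y != 0.
  by rewrite -nc_eq0 gt_eqF// (lt_le_trans _ yc)// divr_gt0.
rewrite (_ : _ - _ - _ = (- (y - f z - t%:C * a) * f z + (t%:C * a) * (y - f z)) / (f z ^+ 2 * y)); last first.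
  by field; rewrite ?fz ?y0.
rewrite ncM ncV ncM ncX ler_pdivrMr; last first.
  by rewrite mulr_gt0 ?exprn_gt0// (lt_le_trans _ yc)// divr_gt0.
apply: (@le_trans _ _ (e * `|t| * (c ^+ 2 * (c / 2)))); last first.
  by rewrite ler_wpM2l ?mulr_ge0 ?(ltW e0)// ler_wpM2l// exprn_ge0// ltW.
have -> : e * `|t| * (c ^+ 2 * (c / 2)) = (e / K * `|t|) * (c + nc a * (nc a + 1)).
  rewrite /K; field; rewrite gt_eqF //= ?gt_eqF// ltr_pwDl//.
apply: le_trans (ncD _ _) _; rewrite [leRHS]mulrDr lerD//.
  by rewrite ncM ncN ler_wpM2r// ltW.
rewrite !ncM ncR.
apply: (@le_trans _ _ (`|t| * nc a * ((nc a + 1) * (e / K)))).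
  rewrite ler_wpM2l ?mulr_ge0//; apply: le_trans t2 _.
  by rewrite ler_wpM2l ?(ltW A1)// ltW.
by rewrite le_eqVlt; apply/orP; left; apply/eqP; ring.
Qed.

Lemma cont_conj f z : {for z, continuous f} -> {for z, continuous (fun w => conjc (f w))}.
Proof.
move=> /contP h; apply/contP => e /h[d [d0 hd]]; exists d; split => // w /hd.
by rewrite -conjcB ncJ.
Qed.

Lemma cont_vec m (F : 'rV[C]_r -> 'rV[C]_m) z :
  (forall j, {for z, continuous (fun w => F w 0 j)}) ->
  forall e : R, 0 < e -> exists d : R, 0 < d /\ forall w, nv (w - z) < d -> nv (F w - F z) < e.
Proof.
move=> h e e0; have e2 : 0 < e / 2 by rewrite divr_gt0.
have [d d0 hd] : exists2 d, 0 < d & forall j w, nv (w - z) < d -> nc (F w 0 j - F z 0 j) < e / 2.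
  apply: fin_min => j; have /contP/(_ _ e2)[d [d0 hd]] := h j.
  by exists d => // d' _ d'd w wd; apply: hd; apply: lt_le_trans wd d'd.
exists d; split => // w wd; apply: (@le_lt_trans _ _ (e / 2)); last by lra.
by apply: nv_le => [|j]; [exact: ltW|rewrite !mxE ltW// hd].
Qed.

Lemma cont_comp m (f : 'rV[C]_m -> C) (F : 'rV[C]_r -> 'rV[C]_m) z :
  (forall j, {for z, continuous (fun w => F w 0 j)}) ->
  {for F z, continuous f} -> {for z, continuous (f \o F)}.
Proof.
move=> /cont_vec hF /contP hf; apply/contP => e /hf[d [d0 hd]].
have [d' [d'0 hd']] := hF _ d0; exists d'; split => // w /hd' /hd.
by [].
Qed.

Lemma ra_cdiff f z v : ra f z -> ra (cdiff f ^~ v) z.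
Proof.
move=> /(ra_deriv v)[g hg [d d0 hd]]; apply: eq_ra d0 _ hg => w /hd /dd_cdiff.
by [].
Qed.

Lemma ra_dd f z v : ra f z -> has_dd f z v (cdiff f z v).
Proof.
move=> /(ra_deriv v)[g hg [d d0 hd]].
have := hd z; rewrite subrr nv0 => /(_ d0) h.
by have := h; rewrite -(dd_cdiff h).
Qed.

End DirectionalRules.

(** * Closure properties of smooth functions *)

Section Smooth.
Variable R : realType.
Local Notation C := R[i].

Section OneSpace.
Variables (r : nat) (W : set 'rV[C]_r).
Hypothesis Wo : open W.
Implicit Types f g : 'rV[C]_r -> C.

Lemma eq_dd_on f g z v d : W z -> (forall w, W w -> f w = g w) ->
  has_dd f z v d -> has_dd g z v d.
Proof.
move=> Wz fg; have /openP/(_ _ Wz)[dl [dl0 hd]] := Wo.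
by apply: (@eq_dd _ _ _ _ _ _ _ dl) => // w /hd; exact: fg.
Qed.

Lemma eq_cont_on f g z : W z -> (forall w, W w -> f w = g w) ->
  {for z, continuous f} -> {for z, continuous g}.
Proof.
move=> Wz fg; have /openP/(_ _ Wz)[dl [dl0 hd]] := Wo.
move=> /contP h; apply/contP => e /h[d [d0 k]].
exists (Num.min d dl); split; first by rewrite lt_min d0.
by move=> w; rewrite lt_min => /andP[/k wd /hd ww]; rewrite -!fg.
Qed.

(** Smoothness speaks of all words of directional derivatives. This coinduction reduces it to a
    class of continuous functions in which one derivative can be taken, up to equality on [W]. *)
Lemma smooth_coind (P : ('rV[C]_r -> C) -> Prop) :
  (forall f, P f -> forall z, W z -> {for z, continuous f}) ->
  (forall f, P f -> forall v, exists2 g, P g & forall z, W z -> has_dd f z v (g z)) ->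
  forall f, P f -> smooth_on W f.
Proof.
move=> Pc Pd f Pf s g.
have [h Ph gh] : exists2 h, P h & forall z, W z -> h z = g z.
  rewrite /g; elim: s {g} => [|v s [h Ph hE]] /=; first by exists f.
  have [k Pk kE] := Pd _ Ph v; exists k => // z Wz.
  by have /dd_cdiff -> := eq_dd_on Wz hE (kE _ Wz).
move=> z Wz; split; first exact: eq_cont_on Wz gh (Pc _ Ph _ Wz).
move=> v; have [k Pk kE] := Pd _ Ph v.
by have /ddP[] := eq_dd_on Wz gh (kE _ Wz).
Qed.

Lemma smooth_cont f z : smooth_on W f -> W z -> {for z, continuous f}.
Proof. by move=> /(_ [::]) h /h[]. Qed.

Lemma smooth_dd f z v : smooth_on W f -> W z -> has_dd f z v (cdiff f z v).
Proof. by move=> /(_ [::]) h /h[_ /(_ v) k]; apply/ddP. Qed.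

Lemma smooth_cdiff f v : smooth_on W f -> smooth_on W (cdiff f ^~ v).
Proof.
move=> h s; have := h (rcons s v).
by rewrite -cats1 foldr_cat.
Qed.

Lemma smooth_C1 f z : smooth_on W f -> W z -> C1_at f z.
Proof.
move=> h Wz; split; last by move=> v; apply: smooth_cont Wz; exact: smooth_cdiff.
have /openP/(_ _ Wz)[dl [dl0 hd]] := Wo.
by exists dl => // w /hd Ww v; exact: smooth_dd.
Qed.

End OneSpace.

(* Closed under differentiation by construction, hence contained in the smooth
   functions. *)
Inductive SmC (r : nat) (W : set 'rV[C]_r) : ('rV[C]_r -> C) -> Prop :=
| SmBase f : smooth_on W f -> SmC W f
| SmRa f : (forall z, W z -> ra f z) -> SmC W f
| SmAdd f g : SmC W f -> SmC W g -> SmC W (fun z => f z + g z)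
| SmMul f g : SmC W f -> SmC W g -> SmC W (fun z => f z * g z)
| SmInv f : (forall z, W z -> f z != 0) -> SmC W f -> SmC W (fun z => (f z)^-1)
| SmConj f : SmC W f -> SmC W (fun z => conjc (f z))
| SmComp m (W' : set 'rV[C]_m) (f : 'rV[C]_m -> C) (F : 'rV[C]_r -> 'rV[C]_m) :
    open W' -> smooth_on W' f -> (forall z, W z -> W' (F z)) ->
    (forall z j, W z -> ra (fun w => F w 0 j) z) -> SmC W (f \o F).

Lemma SmSum (r : nat) (W : set 'rV[C]_r) (I : Type) (s : seq I) (F : I -> 'rV[C]_r -> C) :
  (forall i, SmC W (F i)) -> SmC W (fun z => \sum_(i <- s) F i z).
Proof.
move=> h; elim: s => [|i s IH].
  by under eq_fun do rewrite big_nil; apply: SmRa => z _; exact: ra_cst.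
by under eq_fun do rewrite big_cons; exact: SmAdd.
Qed.

Lemma SmC_smooth (r : nat) (W : set 'rV[C]_r) f : open W -> SmC W f -> smooth_on W f.
Proof.
move=> Wo; apply: (smooth_coind Wo) => {}f.
  elim=> {f} [f h|f h|f g _ h1 _ h2|f g _ h1 _ h2|f f0 _ h1|f _ h1|m W' f F W'o fs FW Fra] z Wz.
  - exact: smooth_cont h Wz.
  - exact: ra_cont (h _ Wz).
  - exact: (cvgD (h1 _ Wz) (h2 _ Wz)).
  - exact: (cvgM (h1 _ Wz) (h2 _ Wz)).
  - exact: (cvgV (f0 _ Wz) (h1 _ Wz)).
  - exact/cont_conj/h1.
  - apply: cont_comp => [j|]; first exact: ra_cont (Fra _ _ Wz).
    exact: smooth_cont fs (FW _ Wz).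
elim=> {f} [f h|f h|f g sf h1 sg h2|f g sf h1 sg h2|f f0 sf h1|f sf h1|m W' f F W'o fs FW Fra] v.
- exists (cdiff f ^~ v); first by apply: SmBase; exact: smooth_cdiff.
  by move=> z Wz; exact: smooth_dd Wz.
- exists (cdiff f ^~ v); first by apply: SmRa => z Wz; apply: ra_cdiff; exact: h.
  by move=> z Wz; apply: ra_dd; exact: h.
- have [f' sf' k1] := h1 v; have [g' sg' k2] := h2 v.
  exists (fun z => f' z + g' z); first exact: SmAdd.
  by move=> z Wz; apply: ddD; [exact: k1|exact: k2].
- have [f' sf' k1] := h1 v; have [g' sg' k2] := h2 v.
  exists (fun z => f' z * g z + f z * g' z); first by apply: SmAdd; apply: SmMul.
  by move=> z Wz; apply: ddM; [exact: k1|exact: k2].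
- have [f' sf' k1] := h1 v.
  exists (fun z => (-1 * f' z) * ((f z)^-1 * (f z)^-1)).
    apply: SmMul; first by apply: SmMul => //; apply: SmRa => z _; exact: ra_cst.
    by apply: SmMul; apply: SmInv.
  move=> z Wz; have := ddV (f0 _ Wz) (k1 _ Wz).
  by rewrite mulN1r expr2 invfM.
- have [f' sf' k1] := h1 v.
  exists (fun z => conjc (f' z)); first exact: SmConj.
  by move=> z Wz; apply: dd_conj; exact: k1.
(* Expanding over the real basis [dirs] keeps the derivative of a composite in the class: the
   coefficients are real or imaginary parts of derivatives of the analytic [F], the other factors
   composites of the same kind. *)
pose w z : 'rV[C]_m := \row_j cdiff (fun y => F y 0 j) z v.
exists (fun z => \sum_j (coef (w z) j)%:C * (cdiff f ^~ (@dirs R m j) \o F) z).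
  apply: SmSum => j; apply: SmMul.
    apply: SmRa => z Wz; rewrite /coef; case: j.2.
      by under eq_fun do rewrite mxE; apply: ra_Im; apply: ra_cdiff; exact: Fra.
    by under eq_fun do rewrite mxE; apply: ra_Re; apply: ra_cdiff; exact: Fra.
  by apply: SmComp W'o _ FW Fra; exact: smooth_cdiff.
move=> z Wz; rewrite /= -wirtE; apply: has_dd_comp.
  by apply: smooth_C1 W'o _ _ fs (FW _ Wz).
by move=> j; rewrite mxE; apply: ra_dd; exact: Fra.
Qed.

Section Closure.
Variables (r : nat) (W : set 'rV[C]_r).
Hypothesis Wo : open W.
Implicit Types f g : 'rV[C]_r -> C.

Lemma smooth_ra f : (forall z, W z -> ra f z) -> smooth_on W f.
Proof. by move=> h; apply: SmC_smooth => //; exact: SmRa. Qed.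

Lemma smooth_cst c : smooth_on W (fun=> c).
Proof. by apply: smooth_ra => z _; exact: ra_cst. Qed.

Lemma smoothD f g : smooth_on W f -> smooth_on W g -> smooth_on W (fun z => f z + g z).
Proof. by move=> hf hg; apply: SmC_smooth => //; apply: SmAdd; exact: SmBase. Qed.

Lemma smoothM f g : smooth_on W f -> smooth_on W g -> smooth_on W (fun z => f z * g z).
Proof. by move=> hf hg; apply: SmC_smooth => //; apply: SmMul; exact: SmBase. Qed.

Lemma smoothV f : (forall z, W z -> f z != 0) -> smooth_on W f -> smooth_on W (fun z => (f z)^-1).
Proof. by move=> f0 hf; apply: SmC_smooth => //; apply: SmInv => //; exact: SmBase. Qed.

Lemma smooth_conj f : smooth_on W f -> smooth_on W (fun z => conjc (f z)).
Proof. by move=> hf; apply: SmC_smooth => //; apply: SmConj; exact: SmBase. Qed.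

Lemma smooth_comp m (W' : set 'rV[C]_m) (f : 'rV[C]_m -> C) (F : 'rV[C]_r -> 'rV[C]_m) :
    open W' -> smooth_on W' f -> (forall z, W z -> W' (F z)) ->
    (forall z j, W z -> ra (fun w => F w 0 j) z) -> smooth_on W (f \o F).
Proof. by move=> W'o fs FW Fra; apply: SmC_smooth => //; exact: (SmComp W'o). Qed.

Lemma smoothB f g : smooth_on W f -> smooth_on W g -> smooth_on W (fun z => f z - g z).
Proof.
move=> hf hg; have := smoothD hf (smoothM (smooth_cst (-1)) hg).
by congr smooth_on; apply/funext => z; rewrite mulN1r.
Qed.

Lemma smooth_sum (I : Type) (s : seq I) (F : I -> 'rV[C]_r -> C) :
  (forall i, smooth_on W (F i)) -> smooth_on W (fun z => \sum_(i <- s) F i z).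
Proof. by move=> h; apply: SmC_smooth => //; apply: SmSum => i; exact: SmBase. Qed.

Lemma smooth_prod (I : Type) (s : seq I) (F : I -> 'rV[C]_r -> C) :
  (forall i, smooth_on W (F i)) -> smooth_on W (fun z => \prod_(i <- s) F i z).
Proof.
move=> h; elim: s => [|i s IH].
  have -> : (fun z => \prod_(i <- [::]) F i z) = fun=> 1.
    by apply/funext => z; rewrite big_nil.
  exact: smooth_cst.
have -> : (fun z => \prod_(j <- i :: s) F j z) = fun z => F i z * \prod_(j <- s) F j z.
  by apply/funext => z; rewrite big_cons.
exact: (smoothM (h i) IH).
Qed.

Lemma smooth_dz j f : smooth_on W f -> smooth_on W (dz j f).
Proof.
move=> hf; apply: smoothM; first exact: smooth_cst.
by apply: smoothB; [|apply: smoothM; first exact: smooth_cst]; exact: smooth_cdiff.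
Qed.

Lemma smooth_dzbar j f : smooth_on W f -> smooth_on W (dzbar j f).
Proof.
move=> hf; apply: smoothM; first exact: smooth_cst.
by apply: smoothD; [|apply: smoothM; first exact: smooth_cst]; exact: smooth_cdiff.
Qed.

Lemma smooth_act01 (F : 'rV[C]_r -> 'rV[C]_r) f :
  (forall j, smooth_on W (fun z => F z 0 j)) -> smooth_on W f -> smooth_on W (act01 F f).
Proof.
by move=> hF hf; apply: smooth_sum => j; exact: (smoothM (hF j) (smooth_dzbar j hf)).
Qed.

Lemma eq_smooth f g : (forall z, W z -> f z = g z) -> smooth_on W f -> smooth_on W g.
Proof.
move=> fg hf; apply: (smooth_coind Wo (P := fun h => exists2 k, smooth_on W k & forall z, W z -> k z = h z)).
- by move=> h [k ks kh] z Wz; exact: (eq_cont_on Wo Wz kh (smooth_cont ks Wz)).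
- move=> h [k ks kh] v; exists (cdiff k ^~ v).
    by exists (cdiff k ^~ v); [exact: smooth_cdiff ks|].
  by move=> z Wz; exact: (eq_dd_on Wo Wz kh (smooth_dd _ ks Wz)).
by exists f.
Qed.

Lemma smooth_sub (W2 : set 'rV[C]_r) f : W2 `<=` W -> smooth_on W f -> smooth_on W2 f.
Proof. by move=> sub h s g z /sub; exact: h. Qed.

End Closure.
End Smooth.

(** * Functions vanishing on a zero set *)

Section Newton.
Variable R : realType.

(* A Newton step [y - Phi y] would decrease [|Phi y| + |y| / 4], so a minimiser
   of that function is a zero of [Phi]. *)
Lemma newton k (Phi : 'rV[R]_k -> 'rV[R]_k) (rho : R) : 0 <= rho ->
  (forall y y', `|y| <= rho -> `|y'| <= rho ->
     `|Phi y' - Phi y - (y' - y)| <= 2^-1 * `|y' - y|) ->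
  5 * `|Phi 0| <= rho -> exists2 y, Phi y = 0 & `|y| <= 4 * `|Phi 0|.
Proof.
move=> rho0 H hr.
pose A := [set y : 'rV[R]_k | `|y| <= rho].
have cA : compact A.
  apply: bounded_closed_compact.
    by exists rho; split; [exact: num_real|move=> M hM y /= hy; apply: le_trans hy (ltW hM)].
  rewrite (_ : A = (fun y : 'rV[R]_k => `|y|) @^-1` [set x | x <= rho])//.
  apply: preimage_closed; last exact: closed_le.
  by move=> y _; exact: norm_continuous.
pose F (y : 'rV[R]_k) := `|Phi y| + 4^-1 * `|y|.
have F_lip y y' : A y -> A y' -> `|F y - F y'| <= 2 * `|y' - y|.
  move=> Ay Ay'; have h := H _ _ Ay Ay'.
  have h1 : `|Phi y' - Phi y| <= 2^-1 * `|y' - y| + `|y' - y|.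
    rewrite -[X in `|X|](subrK (y' - y)); apply: le_trans (ler_normD _ _) _.
    by rewrite lerD2r.
  have h2 := ler_dist_dist (Phi y') (Phi y).
  have h3 := ler_dist_dist y' y.
  rewrite /F ler_norml; move: h1 h2 h3; rewrite !ler_norml; lra.
have cF : {within A, continuous F}.
  apply/subspace_continuousP => y Ay; apply/cvgrPdist_lt => e e0.
  have hb : \forall y' \near (y : 'rV[R]_k), `|y - y'| < e / 2.
    by apply/nbhs_normP; exists (e / 2) => //=; rewrite divr_gt0.
  rewrite near_withinE; apply: filterS hb => y' hy' Ay'.
  apply: le_lt_trans (F_lip _ _ Ay Ay') _.
  by rewrite mulrC -ltr_pdivlMr// distrC.
have A0 : A !=set0 by exists 0; rewrite /A /= normr0.
have [c Ac hc] := EVT_min_rV A0 cA cF.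
have Fc : F c <= `|Phi 0|.
  have := hc 0; rewrite inE /A /= normr0 => /(_ rho0).
  by rewrite {2}/F normr0 mulr0 addr0.
have c4 : `|c| <= 4 * `|Phi 0|.
  by move: Fc; rewrite /F; have := normr_ge0 (Phi c); lra.
have Pc : `|Phi c| <= `|Phi 0|.
  by move: Fc; rewrite /F; have := normr_ge0 c; lra.
exists c => //.
(* At the minimiser [|c| <= 4 * |Phi 0|] and [|Phi c| <= |Phi 0|]; the step stays in the ball
   because [5 * |Phi 0| <= rho]. *)
pose y' := c - Phi c.
have y'n : `|y'| <= `|c| + `|Phi c| by exact: ler_normB.
have Ay' : A y' by rewrite /A /=; lra.
have cr : `|c| <= rho by move: Ac; rewrite inE.
have E : y' - c = - Phi c by rewrite /y' addrAC subrr sub0r.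
have := H _ _ cr Ay'; rewrite E opprK subrK normrN => h.
(* Here [|Phi y'| <= |Phi c| / 2] and [|y'| <= |c| + |Phi c|], so [F y'] is at most
   [F c - |Phi c| / 4]. *)
have := hc y'; rewrite inE => /(_ Ay'); rewrite /F => h2.
by apply/eqP; rewrite -normr_le0; have := normr_ge0 (Phi c); lra.
Qed.

End Newton.

(** * Kernels, spans and complex gradients *)

Section Kernels.
Variable K : fieldType.

Lemma row_full_of_dim_ker n r k (A : 'M[K]_(r, k)) : r = (n + k)%N ->
  \dim (lker (linfun (mulmxr A) : 'Hom('rV[K]_r, 'rV[K]_k))) = n -> row_full A.
Proof.
move=> rE dk; set f : 'Hom('rV[K]_r, 'rV[K]_k) := linfun (mulmxr A) in dk.
have := limg_ker_dim f fullv; rewrite capfv dk dimvf /dim /= mul1n => h.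
have e : \dim (f @: fullv) = k by apply: (@addnI n); rewrite h.
have surj : (f @: fullv)%VS = fullv.
  by apply/eqP; rewrite eqEdim subvf e dimvf /dim /= mul1n.
have hB (s : 'I_k) : exists v : 'rV[K]_r, v *m A = delta_mx 0 s.
  have : delta_mx 0 s \in (f @: fullv)%VS by rewrite surj memvf.
  by move=> /memv_imgP[v _ ->]; exists v; rewrite lfunE.
have {hB}[b hb] := choice hB.
pose B : 'M[K]_(k, r) := \matrix_s b s.
apply/row_fullP; exists B; apply/row_matrixP => s.
by rewrite row_mul rowK hb row1.
Qed.

End Kernels.

Section Lspan.
Variables (R : realType) (r : nat).
Local Notation C := R[i].
Implicit Types (S T : set 'rV[C]_r) (V : {vspace 'rV[C]_r}).

Lemma mem_lspan S v : S v -> v \in lspan S.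
Proof. by case: (lspanP S) => h _; exact: h. Qed.

Lemma lspan_sub S V : (forall v, S v -> v \in V) -> (lspan S <= V)%VS.
Proof. by case: (lspanP S) => _; apply. Qed.

Lemma lspan_mono S T : S `<=` T -> (lspan S <= lspan T)%VS.
Proof. by move=> ST; apply: lspan_sub => v /ST; exact: mem_lspan. Qed.

Lemma lspanE S V : (forall v, S v <-> v \in V) -> lspan S = V.
Proof.
move=> h; apply/eqP; rewrite eqEsubv; apply/andP; split.
  by apply: lspan_sub => v /h.
by apply/subvP => v /h; exact: mem_lspan.
Qed.

Lemma lspan_img S (f : 'End('rV[C]_r)) :
  lspan [set f v | v in S] = (f @: lspan S)%VS.
Proof.
apply/eqP; rewrite eqEsubv; apply/andP; split.
  by apply: lspan_sub => _ [v Sv <-]; rewrite memv_img// mem_lspan.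
have /subvP h : (lspan S <= f @^-1: lspan [set f v | v in S])%VS.
  by apply: lspan_sub => v Sv; rewrite -memv_preim; apply: mem_lspan; exists v.
by apply/subvP => _ /memv_imgP[v /h vS ->]; rewrite memv_preim.
Qed.

End Lspan.

Section Gradient.
Variables (R : realType) (r k : nat).
Local Notation C := R[i].
Implicit Types (rho : 'I_k -> 'rV[C]_r -> R) (z v : 'rV[C]_r).

(** Column [s] is the complex gradient of [rho s]; tangent vectors are rows and multiply it from the
    left. *)
Definition grad rho z : 'M[C]_(r, k) := \matrix_(j, s) dz j (toC (rho s)) z.

Lemma rdiff_cst (c : R) z v : rdiff (fun=> c) z v = 0.
Proof. by rewrite /rdiff; exact: derive1_cst. Qed.

Lemma cdiff_toC (f : 'rV[C]_r -> R) z v : cdiff (toC f) z v = (rdiff f z v)%:C.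
Proof. by rewrite /cdiff /toC /= rdiff_cst. Qed.

Lemma dzbar_toC (f : 'rV[C]_r -> R) z j : dzbar j (toC f) z = conjc (dz j (toC f) z).
Proof.
have h2 : conjc (2^-1 : C) = 2^-1.
  have -> : (2^-1 : C) = (2^-1 : R)%:C by rewrite fmorphV rmorph_nat.
  exact: conjc_real.
rewrite /dz /dzbar !cdiff_toC; move: (rdiff f z _) (rdiff f z _) => a b.
by rewrite (conjcM 2^-1) h2 (conjcB b%:C) (conjcM 'i) !conjc_real conjc_i mulNr opprK.
Qed.

Lemma conj_sum2 (x : C) : x + conjc x = (2 * complex.Re x)%:C.
Proof. by rewrite addcJ rmorphM rmorph_nat. Qed.

Lemma rdiff_grad rho z v s : C1_at (toC (rho s)) z ->
  rdiff (rho s) z v = 2 * complex.Re ((v *m grad rho z) 0 s).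
Proof.
move=> h; apply: complexI; rewrite -cdiff_toC C1_cdiff// -conj_sum2 mxE rmorph_sum -big_split /=.
apply: eq_bigr => j _; rewrite conjcM mxE dzbar_toC; ring.
Qed.

Lemma T01E rho z : T01 rho z = lker (linfun (mulmxr (map_mx conjc (grad rho z)))).
Proof.
apply: lspanE => v; rewrite memv_ker lfunE /=; split=> [h|/eqP h s].
  apply/eqP/rowP => s; rewrite !mxE -[RHS](h s); apply: eq_bigr => j _.
  by rewrite !mxE dzbar_toC.
have := congr1 (fun M : 'rV[C]_k => M 0 s) h; rewrite !mxE => e; rewrite -[RHS]e.
by apply: eq_bigr => j _; rewrite !mxE dzbar_toC.
Qed.

Lemma Re_i_eq0 (x : C) : complex.Re x = 0 -> complex.Re ('i * x) = 0 -> x = 0.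
Proof.
case: x => a b /= ->; rewrite mul0r mul1r sub0r => /eqP; rewrite oppr_eq0 => /eqP ->.
by [].
Qed.

(** The real differential is twice the real part of a complex linear form; if that part vanishes
    both at a vector and at its multiple by ['i], so does the form. *)
Lemma complex_tangentE rho z : (forall s, C1_at (toC (rho s)) z) ->
  complex_tangent rho z = lker (linfun (mulmxr (grad rho z))).
Proof.
move=> h; apply: lspanE => v; rewrite memv_ker lfunE /=.
have hr w s : rdiff (rho s) z w = 2 * complex.Re ((w *m grad rho z) 0 s) by exact: rdiff_grad.
split=> [[tv [w tw wv]]|/eqP v0].
  apply/eqP/rowP => s; rewrite [RHS]mxE.
  have := tv s; have := tw s; rewrite !hr => /eqP; rewrite mulf_eq0 pnatr_eq0 /= => /eqP h1.
  move=> /eqP; rewrite mulf_eq0 pnatr_eq0 /= => /eqP.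
  by rewrite -wv -scalemxAl mxE => /(Re_i_eq0 h1) ->; rewrite mulr0.
have t0 w : w *m grad rho z = 0 -> tangent rho z w.
  by move=> w0 s; rewrite hr w0 mxE mulr0.
split; first exact: t0.
exists (- 'i *: v); first by apply: t0; rewrite -scalemxAl v0 scaler0.
by rewrite scalerA mulrN -expr2 sqr_i opprK scale1r.
Qed.

End Gradient.

(** * Secants and tangential derivatives *)

Section Tangent.
Variables (R : realType) (r k : nat).
Local Notation C := R[i].
Implicit Types (rho : 'I_k -> 'rV[C]_r -> R) (z v : 'rV[C]_r).

Lemma rv_comp n (y : 'rV[R]_n) i : `|y 0 i| <= `|y|.
Proof.
have e : `|y| = mx_norm y by [].
rewrite e mx_normE -[X in X <= _]nngE num_le.
exact: (le_bigmax _ (fun ij : 'I_1 * 'I_n => `|y ij.1 ij.2|%:nng) (0, i)).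
Qed.

Lemma rv_le n (y : 'rV[R]_n) (d : R) : 0 <= d -> (forall i, `|y 0 i| <= d) -> `|y| <= d.
Proof.
move=> d0 h; have [->|y0] := eqVneq y 0; first by rewrite normr0.
have : mx_norm y != 0 by apply: contra y0 => /eqP /mx_norm_eq0 ->.
move=> /mx_norm_neq0 [[i j] /=]; rewrite ord1 => e.
have e1 : `|y| = mx_norm y by [].
by rewrite e1 e h.
Qed.

Lemma strict_rdiff rho z : (forall s, C1_at (toC (rho s)) z) ->
  forall e : R, 0 < e -> exists2 dl, 0 < dl & forall s y h, nv (y - z) < dl -> nv h < dl ->
    `|rho s (y + h) - rho s y - rdiff (rho s) z h| <= e * nv h.
Proof.
move=> hC e e0; apply: fin_min => s.
have [dl dl0 H] := strict_diff (hC s) e0; exists dl => // d' _ d'd y h yd hd.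
have := H y h (lt_le_trans yd d'd) (lt_le_trans hd d'd).
rewrite -C1_cdiff// cdiff_toC /toC.
by rewrite -(rmorphB (real_complex R)) -(rmorphB (real_complex R)) ncR.
Qed.

(* A tangent vector is a limit of secants of the zero set; this replaces the
   implicit function theorem. *)
Lemma zero_set_secant rho z v : (forall s, C1_at (toC (rho s)) z) -> (forall s, rho s z = 0) ->
  row_full (grad rho z) -> v *m grad rho z = 0 ->
  forall e : R, 0 < e -> exists2 dl : R, 0 < dl & forall t : R, `|t| < dl ->
    exists2 w, nv w <= e * `|t| & forall s, rho s (z + t%:C *: v + w) = 0.
Proof.
have half_quarter (a b x : R) : 0 < x -> a < x / 2 -> b <= x / 4 -> a + b < x by lra.
have quarters (a b x : R) : 0 < x -> a <= x / 4 -> b <= x / 4 -> a + b < x by lra.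
move=> hC rz /row_fullP[B BE] v0 e e0.
(* A right inverse of the real differential, see [rN]; the factor 1/2 cancels the 2 of
   [rdiff_grad]. *)
pose Nn (y : 'rV[R]_k) : 'rV[C]_r := (2^-1)%:C *: (map_mx (real_complex R) y *m B).
have NB y y' : Nn y' - Nn y = Nn (y' - y).
  by rewrite /Nn -scalerBr -mulmxBl -map_mxB.
have N0 : Nn 0 = 0 by rewrite /Nn map_mx0 mul0mx scaler0.
pose K : R := \sum_s \sum_j nc (B s j).
have K0 : 0 <= K by apply: sumr_ge0 => s _; apply: sumr_ge0 => j _; exact: nc_ge0.
have NK y : nv (Nn y) <= K * `|y|.
  apply: nv_le => [|j]; first by rewrite mulr_ge0.
  rewrite !mxE ncM ncR ger0_norm ?invr_ge0//.
  apply: (@le_trans _ _ (1 * nc (\sum_s map_mx (real_complex R) y 0 s * B s j))).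
    by rewrite ler_wpM2r ?nc_ge0// invf_le1// ler1n.
  rewrite mul1r; apply: le_trans (nc_sum _ _ _) _; rewrite mulr_suml.
  apply: ler_sum => s _; rewrite ncM mxE ncR mulrC.
  apply: ler_pM; rewrite ?nc_ge0 ?rv_comp//.
  by rewrite (bigD1 j)//= lerDl sumr_ge0// => i _; exact: nc_ge0.
have rN s y : rdiff (rho s) z (Nn y) = y 0 s.
  rewrite rdiff_grad// /Nn -scalemxAl -mulmxA BE mulmx1 !mxE -rmorphM /=.
  by rewrite mulrA divff ?mul1r// pnatr_eq0.
have rv s : rdiff (rho s) z v = 0 by rewrite rdiff_grad// v0 mxE mulr0.
have K1 : 0 < K + 1 by rewrite ltr_wpDl.
have V1 : 0 < nv v + 1 by rewrite ltr_wpDl// nv_ge0.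
(* The correction will have size at most [K * (4 * (c0 * |t|))], hence [c0]. In [eta] the first
   bound makes [Phi] minus the identity a contraction of constant 1/2, the second makes [|Phi 0|] at
   most [c0 * |t|]. *)
pose c0 := e / (4 * (K + 1)).
have c00 : 0 < c0 by rewrite divr_gt0// mulr_gt0.
pose eta := Num.min (2^-1 / (K + 1)) (c0 / (nv v + 1)).
have eta0 : 0 < eta by rewrite lt_min; apply/andP; split; apply: divr_gt0.
have [d d0 H] := strict_rdiff hC eta0.
pose rad := d / 4 / (K + 1).
have rad0 : 0 < rad by rewrite !divr_gt0.
(* The first bound keeps [t v] below [d / 2], the second gives [5 * |Phi 0| <= rad], as [newton]
   requires. *)
exists (Num.min (d / 2 / (nv v + 1)) (rad / (5 * c0))).
  by rewrite lt_min !divr_gt0// mulr_gt0.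
move=> t; rewrite lt_min => /andP[td tr].
have tv : nv (t%:C *: v) < d / 2.
  rewrite nvZ ncR; move: td; rewrite ltr_pdivlMr//; apply: le_lt_trans.
  by rewrite ler_wpM2l// lerDl.
pose Phi (y : 'rV[R]_k) : 'rV[R]_k := \row_s rho s (z + t%:C *: v + Nn y).
have P0 : `|Phi 0| <= c0 * `|t|.
  apply: rv_le => [|s]; first by rewrite mulr_ge0// ltW.
  rewrite mxE N0 addr0; have := H s z (t%:C *: v); rewrite subrr nv0 => /(_ d0).
  rewrite rz subr0 rdiff_grad// -scalemxAl v0 scaler0 mxE mulr0 subr0 => h.
  apply: le_trans (h _) _; first by apply: lt_le_trans tv _; lra.
  rewrite nvZ ncR; apply: (@le_trans _ _ (c0 / (nv v + 1) * (`|t| * (nv v + 1)))).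
    apply: ler_pM; rewrite ?(ltW eta0) ?mulr_ge0 ?nv_ge0//.
      by rewrite /eta ge_min lexx orbT.
    by rewrite ler_wpM2l// lerDl.
  by rewrite (mulrC `|t|) mulrA divfK// gt_eqF.
have NKr y : `|y| <= rad -> nv (Nn y) <= d / 4.
  move=> yr; apply: le_trans (NK y) _.
  apply: (@le_trans _ _ ((K + 1) * rad)); first by apply: ler_pM; rewrite ?lerDl.
  by rewrite /rad mulrC divfK// gt_eqF.
have [||y Py yn] := @newton _ _ Phi rad (ltW rad0).
- move=> y y' yr yr'; apply: rv_le => [|s]; first by rewrite mulr_ge0.
  rewrite !mxE -(rN s).
  have -> : z + t%:C *: v + Nn y' = (z + t%:C *: v + Nn y) + Nn (y' - y).
    by rewrite -NB; move: (Nn y) (Nn y') => a b; rewrite [RHS]addrA [RHS]addrAC addrK.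
  have := H s (z + t%:C *: v + Nn y) (Nn (y' - y)); rewrite !rN !mxE => h.
  apply: le_trans (h _ _) _.
  + rewrite addrAC [z + _]addrC addrK; apply: le_lt_trans (nvD _ _) _.
    exact: half_quarter d0 tv (NKr _ yr).
  + rewrite -NB; apply: le_lt_trans (nvD _ _) _; rewrite nvN.
    exact: quarters d0 (NKr _ yr') (NKr _ yr).
  apply: (@le_trans _ _ (2^-1 / (K + 1) * ((K + 1) * `|y' - y|))).
    apply: ler_pM; rewrite ?(ltW eta0) ?nv_ge0//.
      by rewrite /eta ge_min lexx.
    by apply: le_trans (NK _) _; rewrite ler_wpM2r// lerDl.
  by rewrite mulrA divfK// gt_eqF.
- apply: (@le_trans _ _ (5 * (c0 * `|t|))); first by rewrite ler_wpM2l.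
  have p5 : 0 < 5 * c0 by apply: mulr_gt0.
  by move: (ltW tr); rewrite (ler_pdivlMr _ _ p5) mulrCA (mulrC `|t| c0).
exists (Nn y).
  apply: le_trans (NK y) _; apply: (@le_trans _ _ ((K + 1) * (4 * (c0 * `|t|)))).
    apply: ler_pM => //; first by rewrite lerDl.
    by apply: le_trans yn _; rewrite ler_wpM2l.
  rewrite /c0 le_eqVlt; apply/orP; left; apply/eqP; field.
  by rewrite gt_eqF.
by move=> s; have := congr1 (fun M : 'rV[R]_k => M 0 s) Py; rewrite !mxE.
Qed.

Lemma tangential_vanish (W M : set 'rV[C]_r) rho (f : 'rV[C]_r -> C) z v :
  open W -> W z -> (forall s, C1_at (toC (rho s)) z) ->
  (forall w, W w -> (M w <-> forall s, rho s w = 0)) -> M z ->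
  row_full (grad rho z) -> C1_at f z -> (forall w, W w -> M w -> f w = 0) ->
  v *m grad rho z = 0 -> cdiff f z v = 0.
Proof.
move=> /openP Wo Wz hC hM Mz rf fC f0 v0.
have [d [d0 hd]] := Wo _ Wz.
have rz s : rho s z = 0 by have /hM := Wz; move=> h; exact: (h.1 Mz s).
have [K K0 hK] := wirt_bound f z.
rewrite C1_cdiff//; apply: nc_le0; apply/ler_addgt0Pr => e e0; rewrite add0r.
have V0 := nv_ge0 v.
have K1 : 0 < K + 1 by rewrite ltr_wpDl.
have V1 : 0 < nv v + 1 by rewrite ltr_wpDl.
(* The bound 1 gives [nv w <= t] for the deviation [w] of the secant; the other makes the
   differential of [f] at [w] at most [e / 2 * t]. *)
have e1 : 0 < Num.min 1 (e / 2 / (K + 1)) by rewrite lt_min ltr01 !divr_gt0.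
have [d1 d10 h1] := zero_set_secant hC rz rf v0 e1.
have [d2 d20 h2] := strict_diff fC (divr_gt0 (divr_gt0 e0 (ltr0n R 2)) V1).
pose m := Num.min d d2; have m0 : 0 < m by rewrite lt_min d0.
pose t := Num.min d1 (m / (nv v + 1)) / 2.
have mm0 : 0 < Num.min d1 (m / (nv v + 1)) by rewrite lt_min d10 divr_gt0.
have t0 : 0 < t by rewrite divr_gt0.
have tm : t < Num.min d1 (m / (nv v + 1)) by rewrite /t; lra.
move: tm; rewrite lt_min => /andP[td1 tm].
have [|w wn wz] := h1 t; first by rewrite gtr0_norm.
rewrite gtr0_norm// in wn.
have w1 : nv w <= t by apply: le_trans wn _; rewrite ler_piMl ?ge_min ?lexx// ltW.
have w2 : nv w <= e / 2 / (K + 1) * t.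
  by apply: le_trans wn _; rewrite ler_wpM2r ?ge_min ?lexx ?orbT// ltW.
have hn : nv (t%:C *: v + w) <= t * (nv v + 1).
  by apply: le_trans (nvD _ _) _; rewrite nvZ ncR gtr0_norm//; lra.
have hm : nv (t%:C *: v + w) < m by apply: le_lt_trans hn _; rewrite -ltr_pdivlMr.
have Wx : W (z + (t%:C *: v + w)).
  by apply: hd; rewrite addrAC subrr add0r; apply: lt_le_trans hm _; rewrite ge_min lexx.
have fx : f (z + (t%:C *: v + w)) = 0.
  by apply: f0 => //; apply/hM => // s; rewrite addrA wz.
have := h2 z (t%:C *: v + w); rewrite subrr nv0 => /(_ d20) h3.
have {}h3 : nc (f (z + (t%:C *: v + w)) - f z - wirt f z (t%:C *: v + w)) <= e / 2 * t.
  apply: le_trans (h3 _) _; first by apply: lt_le_trans hm _; rewrite ge_min lexx orbT.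
  apply: (@le_trans _ _ (e / 2 / (nv v + 1) * (t * (nv v + 1)))).
    by rewrite ler_wpM2l// !divr_ge0// ltW.
  by rewrite (mulrC t) mulrA divfK// gt_eqF.
move: h3; rewrite fx f0// subrr sub0r ncN => h3.
have E : wirt f z (t%:C *: v) = wirt f z (t%:C *: v + w) - wirt f z w.
  by rewrite -wirtB addrK.
have h4 : nc (wirt f z w) <= e / 2 * t.
  apply: le_trans (hK _) _; apply: (@le_trans _ _ ((K + 1) * (e / 2 / (K + 1) * t))).
    by apply: ler_pM; rewrite ?nv_ge0// lerDl.
  by rewrite mulrA [(K + 1) * _]mulrC divfK// gt_eqF.
have : nc (wirt f z (t%:C *: v)) <= e * t.
  rewrite E; apply: le_trans (ncB _ _) _.
  by rewrite (_ : e * t = e / 2 * t + e / 2 * t); [exact: lerD|field].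
by rewrite wirtZ ncM ncR gtr0_norm// mulrC ler_pM2r.
Qed.

End Tangent.

(* Otherwise failing unifications unfold derivatives down to limits. *)
#[local] Opaque cdiff.

(** * Smooth matrices and coefficients in a basis *)

Section SmoothMatrices.
Variables (R : realType) (r : nat).
Local Notation C := R[i].
Definition smooth_mx (W : set 'rV[C]_r) m n (X : 'rV[C]_r -> 'M[C]_(m, n)) :=
  forall i j, smooth_on W (fun z => X z i j).

Variable W : set 'rV[C]_r.
Hypothesis Wo : open W.

Lemma smooth_mulmx m n p (X : 'rV[C]_r -> 'M[C]_(m, n)) (Y : 'rV[C]_r -> 'M[C]_(n, p)) :
  smooth_mx W X -> smooth_mx W Y -> smooth_mx W (fun z => X z *m Y z).
Proof.
move=> hX hY i j; apply: (eq_smooth Wo (f := fun z => \sum_l X z i l * Y z l j)).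
  by move=> z _; rewrite mxE.
by apply: smooth_sum => // l; exact: smoothM.
Qed.

Lemma smooth_det n (X : 'rV[C]_r -> 'M[C]_n) : smooth_mx W X -> smooth_on W (fun z => \det (X z)).
Proof.
move=> hX; apply: smooth_sum => // s; apply: smoothM => //; first exact: smooth_cst.
by apply: smooth_prod => // i; exact: hX.
Qed.

Lemma smooth_adj n (X : 'rV[C]_r -> 'M[C]_n) : smooth_mx W X -> smooth_mx W (fun z => \adj (X z)).
Proof.
move=> hX i j; apply: (eq_smooth Wo (f := fun z => (-1) ^+ (j + i) * \det (row' j (col' i (X z))))).
  by move=> z _; rewrite mxE.
apply: smoothM => //; first exact: smooth_cst.
apply: smooth_det => a b; apply: (eq_smooth Wo (f := fun z => X z (lift j a) (lift i b))) => //.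
by move=> z _; rewrite !mxE.
Qed.

Lemma smooth_ctr m n (X : 'rV[C]_r -> 'M[C]_(m, n)) :
  smooth_mx W X -> smooth_mx W (fun z => (map_mx conjc (X z))^T).
Proof.
move=> hX i j; apply: (eq_smooth Wo (f := fun z => conjc (X z j i))); last exact: smooth_conj.
by move=> z _; rewrite !mxE.
Qed.

End SmoothMatrices.

Section Coefficients.
Variables (R : realType) (r : nat).
Local Notation C := R[i].

Lemma row_norm_eq0 n (x : 'rV[C]_n) : x *m (map_mx conjc x)^T = 0 -> x = 0.
Proof.
move/(congr1 (fun M : 'M[C]_1 => M 0 0)); rewrite !mxE => h.
apply/rowP => j; rewrite [RHS]mxE; apply/eqP; rewrite -normr_eq0 -sqrf_eq0 sqr_normc.
move/eqP: h; rewrite psumr_eq0; last by move=> i _; rewrite !mxE; exact: mulcJ_ge0.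
by move=> /allP/(_ j); rewrite mem_index_enum => /(_ isT) /=; rewrite !mxE.
Qed.

(** If [v] annihilates the Gram matrix, then [v *m Y] has Hermitian norm 0. *)
Lemma gram_unit k n (Y : 'M[C]_(k, n)) : row_free Y -> Y *m (map_mx conjc Y)^T \in unitmx.
Proof.
move=> Yf; rewrite -row_free_unit; apply: inj_row_free => v v0.
have vY : v *m Y = 0.
  by apply: row_norm_eq0; rewrite map_mxM trmx_mul mulmxA -[v *m Y *m _]mulmxA v0 mul0mx.
by apply: (row_free_inj Yf); rewrite mul0mx.
Qed.

(* [W1] depends only on [Y]: with Y' the adjoint of Y, it is where [Y Y'] is
   invertible, and [A = X Y' (Y Y')^-1]. *)
Lemma smooth_coefficients (W : set 'rV[C]_r) q k n (Y : 'rV[C]_r -> 'M[C]_(k, n)) :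
  open W -> W q -> smooth_mx W Y -> row_free (Y q) ->
  exists W1 : set 'rV[C]_r, [/\ open W1, W1 q, W1 `<=` W &
   forall W2, open W2 -> W2 `<=` W1 -> forall m (X : 'rV[C]_r -> 'M[C]_(m, n)), smooth_mx W2 X ->
    exists2 A : 'rV[C]_r -> 'M[C]_(m, k), smooth_mx W2 A &
      forall z, W2 z -> (X z <= Y z)%MS -> X z = A z *m Y z].
Proof.
move=> Wo Wq hY Yq.
pose G z := Y z *m (map_mx conjc (Y z))^T.
have hG : smooth_mx W G by apply: smooth_mulmx => //; exact: smooth_ctr.
have hd := smooth_det Wo hG.
exists [set z | W z /\ \det (G z) != 0]; split.
- apply/openP => z [Wz dz0].
  have /openP/(_ _ Wz)[d1 [d10 h1]] := Wo.
  have n0 : 0 < nc (\det (G z)) by rewrite lt_def nc_ge0 nc_eq0 dz0.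
  have /contP/(_ _ n0)[d2 [d20 h2]] := smooth_cont hd Wz.
  exists (Num.min d1 d2); split; first by rewrite lt_min d10.
  move=> w; rewrite lt_min => /andP[/h1 Ww /h2 dw]; split; first exact: Ww.
  by apply: contraTneq dw => ->; rewrite sub0r ncN ltxx.
- by split => //; rewrite -unitfE -unitmxE gram_unit.
- by move=> z [].
move=> W2 W2o W21 m X hX.
have W2W : W2 `<=` W by move=> z /W21 [].
have hY2 : smooth_mx W2 Y by move=> i j; exact: smooth_sub W2W (hY i j).
have hG2 : smooth_mx W2 G by move=> i j; exact: smooth_sub W2W (hG i j).
have hd2 := smooth_sub W2W hd.
(* Coefficients of the orthogonal projection onto the row space of [Y]; the adjugate formula shows
   that they are smooth, also where [X] leaves that space. *)
exists (fun z => (X z *m (map_mx conjc (Y z))^T) *m ((\det (G z))^-1 *: \adj (G z))).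
  apply: (smooth_mulmx W2o (smooth_mulmx W2o hX (smooth_ctr W2o hY2))).
  move=> i j; apply: (eq_smooth W2o (f := fun z => (\det (G z))^-1 * (\adj (G z)) i j)).
    by move=> z _; rewrite [RHS]mxE.
  have hi : smooth_on W2 (fun z => (\det (G z))^-1).
    by apply: (smoothV W2o _ hd2) => z /W21 [].
  exact: (smoothM W2o hi (smooth_adj W2o hG2 i j)).
move=> z W2z /submxP[D XD].
have [_ dz0] := W21 _ W2z.
rewrite XD -[D *m Y z *m _]mulmxA -/(G z) -(mulmxA D) -scalemxAr mul_mx_adj.
by rewrite scale_scalar_mx mulVf// mulmx1.
Qed.

Lemma basis_of_rows n (V : {vspace 'rV[C]_r}) (L : 'I_n -> 'rV[C]_r) :
  basis_of V [tuple L i | i < n] ->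
  row_free (\matrix_i L i) /\ forall w, w \in V -> (w <= \matrix_i L i)%MS.
Proof.
move=> bL; have Lf := basis_free bL; split.
  apply: inj_row_free => v; rewrite mulmx_sum_row => h.
  apply/rowP => i; rewrite mxE.
  have /freeP := Lf => /(_ (fun i => v 0 i)); apply.
  rewrite -[RHS]h; apply: eq_bigr => j _.
  by rewrite (nth_map j) ?size_enum_ord// nth_ord_enum rowK.
move=> w wV.
have := coord_span (X := [tuple L i | i < n]) (v := w); rewrite (span_basis bL) => /(_ wV) ->.
apply: summx_sub => i _; apply: scalemx_sub.
rewrite (nth_map i) ?size_enum_ord// nth_ord_enum.
by have := row_sub i (\matrix_i L i); rewrite rowK.
Qed.

End Coefficients.

(** * Derivations of type (0,1) and their brackets *)

Section Act01.
Variables (R : realType) (r : nat).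
Local Notation C := R[i].
Variable W : set 'rV[C]_r.
Hypothesis Wo : open W.
Implicit Types (f g : 'rV[C]_r -> C) (F : 'rV[C]_r -> 'rV[C]_r).

Lemma dzbarE f z j a b : has_dd f z (delta_mx 0 j) a -> has_dd f z ('i *: delta_mx 0 j) b ->
  dzbar j f z = 2^-1 * (a + 'i * b).
Proof. by move=> /dd_cdiff ha /dd_cdiff hb; rewrite /dzbar ha hb. Qed.

Lemma dzbarD f g z j : smooth_on W f -> smooth_on W g -> W z ->
  dzbar j (fun z => f z + g z) z = dzbar j f z + dzbar j g z.
Proof.
move=> hf hg Wz.
rewrite (dzbarE (ddD (smooth_dd _ hf Wz) (smooth_dd _ hg Wz)) (ddD (smooth_dd _ hf Wz) (smooth_dd _ hg Wz))).
by rewrite /dzbar; move: (cdiff f z _) (cdiff f z _) (cdiff g z _) (cdiff g z _) => a b c d; ring.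
Qed.

Lemma dzbarM f g z j : smooth_on W f -> smooth_on W g -> W z ->
  dzbar j (fun z => f z * g z) z = dzbar j f z * g z + f z * dzbar j g z.
Proof.
move=> hf hg Wz.
rewrite (dzbarE (ddM (smooth_dd _ hf Wz) (smooth_dd _ hg Wz)) (ddM (smooth_dd _ hf Wz) (smooth_dd _ hg Wz))).
rewrite /dzbar; move: (cdiff f z _) (cdiff f z _) (cdiff g z _) (cdiff g z _) => a b c d.
by move: (f z) (g z) => x y; ring.
Qed.

Lemma dzbar_cst (c : C) (z : 'rV[C]_r) j : dzbar j (fun=> c) z = 0.
Proof. by rewrite (dzbarE (dd_cst c z _) (dd_cst c z _)) mulr0 addr0 mulr0. Qed.

Lemma eq_dzbar f g z j : smooth_on W f -> W z -> (forall w, W w -> f w = g w) ->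
  dzbar j f z = dzbar j g z.
Proof.
move=> hf Wz fg.
by rewrite (dzbarE (eq_dd_on Wo Wz fg (smooth_dd _ hf Wz)) (eq_dd_on Wo Wz fg (smooth_dd _ hf Wz))).
Qed.

Lemma act01D F f g z : smooth_on W f -> smooth_on W g -> W z ->
  act01 F (fun z => f z + g z) z = act01 F f z + act01 F g z.
Proof.
move=> hf hg Wz; rewrite /act01 -big_split; apply: eq_bigr => j _ /=.
by rewrite dzbarD// mulrDr.
Qed.

Lemma act01M F f g z : smooth_on W f -> smooth_on W g -> W z ->
  act01 F (fun z => f z * g z) z = act01 F f z * g z + f z * act01 F g z.
Proof.
move=> hf hg Wz; rewrite /act01 mulr_suml mulr_sumr -big_split; apply: eq_bigr => j _ /=.
by rewrite dzbarM//; move: (dzbar j f z) (dzbar j g z) (F z 0 j) (f z) (g z) => a b c x y; ring.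
Qed.

Lemma act01_cst F c z : act01 F (fun=> c) z = 0.
Proof. by rewrite /act01 big1// => j _; rewrite dzbar_cst mulr0. Qed.

Lemma eq_act01 F f g z : smooth_on W f -> W z -> (forall w, W w -> f w = g w) ->
  act01 F f z = act01 F g z.
Proof. by move=> hf Wz fg; apply: eq_bigr => j _; rewrite (eq_dzbar _ hf Wz fg). Qed.

Lemma act01B F f g z : smooth_on W f -> smooth_on W g -> W z ->
  act01 F (fun z => f z - g z) z = act01 F f z - act01 F g z.
Proof.
move=> hf hg Wz.
have e : (fun z => f z - g z) = (fun z => f z + -1 * g z) by apply/funext => w; rewrite mulN1r.
have hc : smooth_on W (fun=> -1 : C) by exact: smooth_cst.
rewrite e (act01D F hf (smoothM Wo hc hg) Wz) (act01M F hc hg Wz).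
by rewrite act01_cst mul0r add0r mulN1r.
Qed.

Lemma act01_sum F (I : Type) (s : seq I) (f : I -> 'rV[C]_r -> C) z :
  (forall i, smooth_on W (f i)) -> W z ->
  act01 F (fun z => \sum_(i <- s) f i z) z = \sum_(i <- s) act01 F (f i) z.
Proof.
move=> hf Wz; elim: s => [|i s IH].
  rewrite big_nil (_ : (fun z => _) = fun=> 0) ?act01_cst//.
  by apply/funext => w; rewrite big_nil.
have e : (fun z => \sum_(j <- i :: s) f j z) = (fun z => f i z + \sum_(j <- s) f j z).
  by apply/funext => w; rewrite big_cons.
by rewrite e (act01D F (hf i) (smooth_sum Wo s hf) Wz) IH big_cons.
Qed.

(** [dzbar i] and [dzbar j] are of the form [D] with [c = 2^-1] and [d = 'i]. *)
Lemma cdiff_comb_comm f z (u1 u2 v1 v2 : 'rV[C]_r) (c d : C) : smooth_on W f -> W z ->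
  let D a b g w := c * (cdiff g w a + d * cdiff g w b) in
  D u1 u2 (D v1 v2 f) z = D v1 v2 (D u1 u2 f) z.
Proof.
move=> hf Wz D.
have hc v : smooth_on W (cdiff f ^~ v) by exact: smooth_cdiff.
have sw u v : cdiff (cdiff f ^~ u) z v = cdiff (cdiff f ^~ v) z u.
  exact: (schwarz (smooth_C1 Wo hf Wz).1 (smooth_C1 Wo (hc u) Wz) (smooth_C1 Wo (hc v) Wz)).
have hi a b v : cdiff (D a b f) z v = c * (cdiff (cdiff f ^~ a) z v + d * cdiff (cdiff f ^~ b) z v).
  have h1 := smooth_dd v (hc a) Wz.
  have h2 := smooth_dd v (hc b) Wz.
  have := dd_cdiff (ddM (dd_cst c z v) (ddD h1 (ddM (dd_cst d z v) h2))).
  by rewrite !mul0r !add0r.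
have comb (x y x' y' : C) : x = x' -> y = y' -> c * (x + d * y) = c * (x' + d * y').
  by move=> -> ->.
apply: etrans (comb _ _ _ _ (hi v1 v2 u1) (hi v1 v2 u2)) _.
apply: etrans _ (esym (comb _ _ _ _ (hi u1 u2 v1) (hi u1 u2 v2))).
apply: etrans (comb _ _ _ _ (comb _ _ _ _ (sw v1 u1) (sw v2 u1)) (comb _ _ _ _ (sw v1 u2) (sw v2 u2))) _.
have comb4 (x y x' y' : C) : c * (c * (x + d * y) + d * (c * (x' + d * y'))) =
    c * (c * (x + d * x') + d * (c * (y + d * y'))) by ring.
exact: comb4.
Qed.

Lemma dzbar_comm f z i j : smooth_on W f -> W z ->
  dzbar i (dzbar j f) z = dzbar j (dzbar i f) z.
Proof. move=> hf Wz; exact: cdiff_comb_comm. Qed.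

(** The second-order terms are symmetric and cancel, so the bracket is again a field of type
    (0,1). *)
Lemma act01_commutator F (G : 'rV[C]_r -> 'rV[C]_r) f z : (forall j, smooth_on W (fun z => F z 0 j)) ->
  (forall j, smooth_on W (fun z => G z 0 j)) -> smooth_on W f -> W z ->
  act01 F (act01 G f) z - act01 G (act01 F f) z =
  \sum_j (act01 F (fun z => G z 0 j) z - act01 G (fun z => F z 0 j) z) * dzbar j f z.
Proof.
move=> hF hG hf Wz.
have key (F' G' : 'rV[C]_r -> 'rV[C]_r) : (forall j, smooth_on W (fun z => G' z 0 j)) ->
   act01 F' (act01 G' f) z = \sum_j act01 F' (fun z => G' z 0 j) z * dzbar j f z +
     \sum_j \sum_i F' z 0 i * G' z 0 j * dzbar i (dzbar j f) z.
  move=> hG'.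
  have hs j : smooth_on W (fun z => G' z 0 j * dzbar j f z).
    exact: smoothM Wo _ _ (hG' j) (smooth_dzbar Wo j hf).
  apply: etrans (act01_sum F' (index_enum _) hs Wz) _.
  rewrite -big_split; apply: eq_bigr => j _.
  apply: etrans (act01M F' (hG' j) (smooth_dzbar Wo j hf) Wz) _.
  congr (_ + _); apply: etrans (mulr_sumr _ _ _ _) _; apply: eq_bigr => i _.
  by rewrite mulrA (mulrC (G' z 0 j)).
rewrite (key F G hG) (key G F hF).
have -> : \sum_j \sum_i G z 0 i * F z 0 j * dzbar i (dzbar j f) z =
   \sum_j \sum_i F z 0 i * G z 0 j * dzbar i (dzbar j f) z.
  rewrite exchange_big; apply: eq_bigr => i _; apply: eq_bigr => j _.
  by rewrite (dzbar_comm i j hf Wz) [G z 0 i * _]mulrC.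
have cancel (a b x : C) : a + x - (b + x) = a - b by ring.
apply: etrans (cancel _ _ _) _; rewrite -sumrB; apply: eq_bigr => j _.
by rewrite mulrBl.
Qed.

End Act01.

(** * Independence of the choices *)

Section Words.
Variables (R : realType) (r n : nat).
Local Notation C := R[i].
Implicit Types (L : 'I_n -> 'rV[C]_r -> 'rV[C]_r) (f : 'rV[C]_r -> C).

Definition act_word L (w : seq 'I_n) f := foldr (fun i g => act01 (L i) g) f w.

(** Sorted words are the normal forms of iterated derivatives: [act_multi] is the action of this
    word. *)
Definition multi_word (a : {ffun 'I_n -> nat}) : seq 'I_n :=
  flatten [seq nseq (a i) i | i <- enum 'I_n].

Lemma act_multi_word L a f : act_multi L a f = act_word L (multi_word a) f.
Proof.
rewrite /act_multi /act_word /multi_word; elim: (enum _) => [//|i s IH] /=.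
by rewrite foldr_cat -IH; elim: (a i) => [//|m /= ->].
Qed.

Lemma size_multi_word a : size (multi_word a) = (\sum_i a i)%N.
Proof.
rewrite size_flatten /shape -map_comp sumnE big_map -big_enum /=.
by apply: eq_bigr => i _; rewrite size_nseq.
Qed.

Lemma perm_multi_word (w : seq 'I_n) :
  perm_eq w (multi_word [ffun i => count_mem i w]).
Proof.
apply/allP => x _ /=; rewrite count_flatten -map_comp sumnE big_map big_enum /=.
rewrite (bigD1 x)//= count_nseq /= eqxx mul1n ffunE big1 ?addn0// => i /negPf ix.
by rewrite count_nseq /= ix.
Qed.

End Words.

(** * Iterated derivatives modulo functions vanishing on M *)

Section Module.
Variables (R : realType) (r : nat).
Local Notation C := R[i].
Variables (W M : set 'rV[C]_r).
Hypothesis Wo : open W.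
Local Notation family := ('I_r -> 'rV[C]_r -> C).
Implicit Types (Gen : family -> Prop) (g h : family).

(** The module over smooth functions on [W] generated by [Gen], with families that agree on [M]
    identified by [Mod_eq]. For smooth generators the members remain smooth on all of [W], so fields
    can be applied to them. *)
Inductive Mod Gen : family -> Prop :=
| Mod_gen g : Gen g -> Mod Gen g
| Mod_0 : Mod Gen (fun _ _ => 0)
| Mod_add g h : Mod Gen g -> Mod Gen h -> Mod Gen (fun j z => g j z + h j z)
| Mod_scale (c : 'rV[C]_r -> C) g : smooth_on W c -> Mod Gen g -> Mod Gen (fun j z => c z * g j z)
| Mod_eq g h : (forall j, smooth_on W (h j)) -> (forall j z, W z -> M z -> g j z = h j z) ->
    Mod Gen g -> Mod Gen h.

Definition smooth_gen Gen := forall g, Gen g -> forall j, smooth_on W (g j).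

Lemma Mod_smooth Gen g : smooth_gen Gen -> Mod Gen g -> forall j, smooth_on W (g j).
Proof.
move=> Gs; elim=> {g} [g /Gs//||g h _ hg _ hh j|c g hc _ hg j|//].
- by move=> j; exact: smooth_cst.
- exact: (smoothD Wo (hg j) (hh j)).
- exact: (smoothM Wo hc (hg j)).
Qed.

Lemma Mod_trans Gen Gen' g : (forall h, Gen h -> Mod Gen' h) -> Mod Gen g -> Mod Gen' g.
Proof.
move=> GG; elim=> {g} [g /GG//||g h _ hg _ hh|c g hc _ hg|g h hh gh _ hg].
- exact: Mod_0.
- exact: Mod_add.
- exact: Mod_scale.
- exact: Mod_eq gh hg.
Qed.

(** At a point of [M] the coefficients become complex numbers: membership in a module turns into
    membership in a span. *)
Lemma Mod_eval Gen g q (V : {vspace 'rV[C]_r}) : W q -> M q -> Mod Gen g ->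
  (forall h, Gen h -> \row_j h j q \in V) -> \row_j g j q \in V.
Proof.
move=> Wq Mq Mg GV; elim: Mg => {g} [g /GV//||g h _ hg _ hh|c g hc _ hg|g h hh gh _ hg].
- by rewrite (_ : \row__ _ = 0) ?mem0v//; apply/rowP => j; rewrite !mxE.
- rewrite (_ : \row__ _ = \row_j g j q + \row_j h j q) ?memvD//.
  by apply/rowP => j; rewrite !mxE.
- rewrite (_ : \row__ _ = c q *: \row_j g j q) ?memvZ//.
  by apply/rowP => j; rewrite !mxE.
- rewrite (_ : \row_j h j q = \row_j g j q)//.
  by apply/rowP => j; rewrite !mxE gh.
Qed.

Lemma Mod_sum Gen (I : Type) (s : seq I) (F : I -> family) :
  (forall i, Mod Gen (F i)) -> Mod Gen (fun j z => \sum_(i <- s) F i j z).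
Proof.
move=> h; elim: s => [|i s IH].
  rewrite (_ : (fun j z => _) = fun _ _ => 0); first exact: Mod_0.
  by apply/funext => j; apply/funext => z; rewrite big_nil.
rewrite (_ : (fun j z => _) = fun j z => F i j z + \sum_(i <- s) F i j z).
  exact: Mod_add.
by apply/funext => j; apply/funext => z; rewrite big_cons.
Qed.

(** Preserving the functions that vanish on [M] is what makes the action of a field compatible with
    [Mod_eq]. *)
Definition tangential (F : 'rV[C]_r -> 'rV[C]_r) :=
  (forall j, smooth_on W (fun z => F z 0 j)) /\
  forall f, smooth_on W f -> (forall z, W z -> M z -> f z = 0) ->
    forall z, W z -> M z -> act01 F f z = 0.

Lemma Mod_act01 Gen Gen' F g : smooth_gen Gen -> tangential F ->
  (forall h, Gen h -> Mod Gen' h) ->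
  (forall h, Gen h -> Mod Gen' (fun j => act01 F (h j))) ->
  Mod Gen g -> Mod Gen' (fun j => act01 F (g j)).
Proof.
move=> Gs [Fs Ft] GG GF.
elim=> {g} [g /GF//||g h Mg hg Mh hh|c g hc Mg hg|g h hh gh Mg hg].
- rewrite (_ : (fun j => _) = fun _ _ => 0); first exact: Mod_0.
  by apply/funext => j; apply/funext => z; rewrite act01_cst.
- have gs := Mod_smooth Gs Mg; have hs := Mod_smooth Gs Mh.
  apply: (Mod_eq _ _ (Mod_add hg hh)) => [j|j z Wz _].
    exact: (smooth_act01 Wo Fs (smoothD Wo (gs j) (hs j))).
  by rewrite (act01D F (gs j) (hs j) Wz).
- have gs := Mod_smooth Gs Mg.
  have c's : smooth_on W (act01 F c) := smooth_act01 Wo Fs hc.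
  have h1 := Mod_add (Mod_scale c's (Mod_trans GG Mg)) (Mod_scale hc hg).
  apply: (Mod_eq _ _ h1) => [j|j z Wz _].
    exact: (smooth_act01 Wo Fs (smoothM Wo hc (gs j))).
  by rewrite (act01M F hc (gs j) Wz).
have gs := Mod_smooth Gs Mg.
apply: (Mod_eq _ _ hg) => [j|j z Wz Mz]; first exact: (smooth_act01 Wo Fs (hh j)).
apply/eqP; rewrite -subr_eq0 -(act01B Wo F (gs j) (hh j) Wz); apply/eqP.
apply: Ft => //; first exact: (smoothB Wo (gs j) (hh j)).
by move=> w Ww Mw; rewrite gh// subrr.
Qed.

Section Frame.
Variables (n k : nat) (L : 'I_n -> 'rV[C]_r -> 'rV[C]_r) (u : 'I_k -> family).
Hypothesis Lt : forall i, tangential (L i).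
Hypothesis us : forall s j, smooth_on W (u s j).
Hypothesis involutive : forall i j, exists c : 'I_n -> 'rV[C]_r -> C,
  (forall l, smooth_on W (c l)) /\
  forall f z, smooth_on W f -> W z -> M z ->
    act01 (L i) (act01 (L j) f) z - act01 (L j) (act01 (L i) f) z =
    \sum_l c l z * act01 (L l) f z.

Definition aw (w : seq 'I_n) (s : 'I_k) : family := fun j => act_word L w (u s j).
(** The inequality is strict: level 0 is empty and starts the induction, and a word of length [m] is
    rewritten modulo level [m]. Order at most [nu] in [L_generators] is level [nu.+1] here. *)
Definition GenW (nu : nat) : family -> Prop :=
  fun g => exists w s, (size w < nu)%N /\ g = aw w s.
Definition GenO (nu : nat) : family -> Prop :=
  fun g => exists (a : {ffun 'I_n -> nat}) s, (\sum_i a i < nu)%N /\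
    g = fun j => act_multi L a (u s j).

Lemma smooth_aw w s j : smooth_on W (aw w s j).
Proof.
rewrite /aw; elim: w => [|i w IH] /=; first exact: us.
exact: (smooth_act01 Wo (Lt i).1 IH).
Qed.

Lemma smooth_GenW nu : smooth_gen (GenW nu).
Proof. by move=> g [w [s [_ ->]]] j; exact: smooth_aw. Qed.

Lemma GenW_le nu nu' g : (nu <= nu')%N -> Mod (GenW nu) g -> Mod (GenW nu') g.
Proof.
move=> le; apply: Mod_trans => h [w [s [sw ->]]]; apply: Mod_gen; exists w, s.
by split=> //; exact: leq_trans sw le.
Qed.

Lemma ModW_act i nu g : Mod (GenW nu) g -> Mod (GenW nu.+1) (fun j => act01 (L i) (g j)).
Proof.
apply: Mod_act01 => [||h|h].
- exact: smooth_GenW.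
- exact: Lt.
- by move=> hh; apply: (@GenW_le nu) => //; exact: Mod_gen.
- by move=> [w [s [sw ->]]]; apply: Mod_gen; exists (i :: w), s.
Qed.

Lemma ModW_cons i nu g h : (forall j, smooth_on W (g j)) -> (forall j, smooth_on W (h j)) ->
  Mod (GenW nu) (fun j z => g j z - h j z) ->
  Mod (GenW nu.+1) (fun j z => act01 (L i) (g j) z - act01 (L i) (h j) z).
Proof.
move=> gs hs /(ModW_act i); apply: Mod_eq => [j|j z Wz Mz].
  exact: (smoothB Wo (smooth_act01 Wo (Lt i).1 (gs j)) (smooth_act01 Wo (Lt i).1 (hs j))).
by rewrite (act01B Wo (L i) (gs j) (hs j) Wz).
Qed.

Lemma ModW_diff_trans nu x y z : Mod (GenW nu) (fun j p => aw x.1 x.2 j p - aw y.1 y.2 j p) ->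
  Mod (GenW nu) (fun j p => aw y.1 y.2 j p - aw z.1 z.2 j p) ->
  Mod (GenW nu) (fun j p => aw x.1 x.2 j p - aw z.1 z.2 j p).
Proof.
move=> h1 h2; apply: Mod_eq (Mod_add h1 h2) => [j|j p _ _].
  exact: (smoothB Wo (smooth_aw _ _ _) (smooth_aw _ _ _)).
by rewrite addrA subrK.
Qed.

(** By involutivity the difference is a combination of words of length [size w + 1], one letter
    shorter than the two compared. *)
Lemma ModW_swap i j w s :
  Mod (GenW (size w).+2) (fun m z => aw [:: i, j & w] s m z - aw [:: j, i & w] s m z).
Proof.
have [c [cs hc]] := involutive i j.
apply: (Mod_eq (g := fun m z => \sum_l c l z * act01 (L l) (aw w s m) z)).
- by move=> m; exact: (smoothB Wo (smooth_aw _ _ _) (smooth_aw _ _ _)).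
- by move=> m z Wz Mz; rewrite -hc//; exact: smooth_aw.
apply: Mod_sum => l; apply: Mod_scale => //.
by apply: Mod_gen; exists (l :: w), s.
Qed.

Lemma ModW_move i l1 l2 s : Mod (GenW (size (l1 ++ l2)).+1)
  (fun m z => aw (i :: l1 ++ l2) s m z - aw (l1 ++ i :: l2) s m z).
Proof.
elim: l1 => [|x l1 IH].
  rewrite (_ : (fun m z => _) = fun _ _ => 0); first exact: Mod_0.
  by apply/funext => m; apply/funext => z; rewrite subrr.
apply: (@ModW_diff_trans _ ([:: i, x & l1 ++ l2], s) ([:: x, i & l1 ++ l2], s) (x :: l1 ++ i :: l2, s)).
  exact: ModW_swap.
by apply: (ModW_cons x _ _ IH) => j; exact: smooth_aw.
Qed.

(** The tail is permuted by induction, then the head is moved to its place; every transposition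
    costs only shorter words. *)
Lemma ModW_perm w w' s : perm_eq w w' ->
  Mod (GenW (size w)) (fun m z => aw w s m z - aw w' s m z).
Proof.
elim: w w' => [|i w IH] w' hw.
  have -> : w' = [::] by apply: perm_nilP; rewrite perm_sym.
  rewrite (_ : (fun m z => _) = fun _ _ => 0); first exact: Mod_0.
  by apply/funext => m; apply/funext => z; rewrite subrr.
have iw' : i \in w' by rewrite -(perm_mem hw) inE eqxx.
case/splitPr: iw' hw => l1 l2 hw.
have hw' : perm_eq w (l1 ++ l2).
  by rewrite -(perm_cons i); apply: perm_trans hw _; rewrite perm_catC /= perm_cons perm_catC.
have sE : size w = size (l1 ++ l2) := perm_size hw'.
apply: (@ModW_diff_trans _ (i :: w, s) (i :: l1 ++ l2, s) (l1 ++ i :: l2, s)).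
  by apply: (ModW_cons i _ _ (IH _ hw')) => j; exact: smooth_aw.
by rewrite /= sE; exact: ModW_move.
Qed.

(* Poincare-Birkhoff-Witt: sorting a word changes it by shorter words. *)
Lemma ModW_ModO nu g : Mod (GenW nu) g -> Mod (GenO nu) g.
Proof.
elim: nu g => [|nu IH] g; apply: Mod_trans => h [w [s [//]]]; rewrite ltnS => sw ->.
have hw := ModW_perm s (perm_multi_word w).
have OO h' : Mod (GenO nu) h' -> Mod (GenO nu.+1) h'.
  apply: Mod_trans => h2 [a [t [sa ->]]]; apply: Mod_gen; exists a, t.
  by split => //; apply: leq_trans sa _.
(* The error consists of words shorter than [w], hence lies at level [nu], where the induction
   applies. *)
have h1 := OO _ (IH _ (GenW_le sw hw)).
set a := [ffun i => count_mem i w] in h1.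
have h2 : Mod (GenO nu.+1) (aw (multi_word a) s).
  apply: Mod_gen; exists a, s; split.
    by rewrite -size_multi_word -(perm_size (perm_multi_word w)) ltnS.
  by apply/funext => j; rewrite act_multi_word.
apply: Mod_eq (Mod_add h1 h2) => [j|j z _ _]; first exact: smooth_aw.
by rewrite subrK.
Qed.

(** The expansion of [F] in the frame holds along [M] only. It is used after [g] has been
    differentiated and is never differentiated itself, so [Mod_eq] can absorb it. *)
Lemma ModO_act (F : 'rV[C]_r -> 'rV[C]_r) (c : 'I_n -> 'rV[C]_r -> C) nu g :
  tangential F -> (forall i, smooth_on W (c i)) ->
  (forall z, W z -> M z -> F z = \sum_i c i z *: L i z) ->
  Mod (GenW nu) g -> Mod (GenW nu.+1) (fun j => act01 F (g j)).
Proof.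
move=> Ft cs FE Mg.
have gs := Mod_smooth (@smooth_GenW nu) Mg.
have h1 : Mod (GenW nu.+1) (fun j z => \sum_i c i z * act01 (L i) (g j) z).
  by apply: Mod_sum => i; apply: Mod_scale => //; exact: ModW_act.
apply: (Mod_eq _ _ h1) => [j|j z Wz Mz]; first exact: (smooth_act01 Wo Ft.1 (gs j)).
rewrite /act01 FE//.
transitivity (\sum_m \sum_i c i z * (L i z 0 m * dzbar m (g j) z)).
  by rewrite exchange_big; apply: eq_bigr => i _; rewrite mulr_sumr.
apply: eq_bigr => m _; rewrite summxE mulr_suml; apply: eq_bigr => i _.
by rewrite mxE mulrA.
Qed.

End Frame.
End Module.

(** * Comparison of two frames *)

Section Frames.
Variables (R : realType) (r : nat).
Local Notation C := R[i].
Implicit Types (W M : set 'rV[C]_r).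

(** What the comparison uses of a choice: smoothness instead of analyticity, and independence of the
    complex gradients along [M]. It survives shrinking [W], see [CRframe_sub]. *)
Definition CRframe n k W M (rho : 'I_k -> 'rV[C]_r -> R)
    (L : 'I_n -> 'rV[C]_r -> 'rV[C]_r) :=
  [/\ open W, forall s, smooth_on W (toC (rho s)),
      forall z, W z -> (M z <-> forall s, rho s z = 0),
      forall i j, smooth_on W (fun z => L i z 0 j) &
      forall z, W z -> M z -> row_full (grad rho z) /\ basis_of (T01 rho z) [tuple L i z | i < n]].

Lemma map_conjK m n (A : 'M[C]_(m, n)) : map_mx conjc (map_mx conjc A) = A.
Proof. by apply/matrixP => i j; rewrite !mxE conjcK. Qed.

Lemma row_full_conj m n (A : 'M[C]_(m, n)) : row_full (map_mx conjc A) -> row_full A.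
Proof.
move=> /row_fullP[B BA]; apply/row_fullP; exists (map_mx conjc B).
have := congr1 (map_mx conjc) BA; rewrite map_mxM map_mx1 => <-; congr (_ *m _).
by rewrite map_conjK.
Qed.

Lemma defining_smooth k W M (rho : 'I_k -> 'rV[C]_r -> R) s :
  defining_system W M rho -> smooth_on W (toC (rho s)).
Proof. by move=> [Wo ra_rho _ _]; apply: (smooth_ra Wo) => z /(ra_rho s)/raP. Qed.

(** Genericity: a space of (0,1)-vectors of dimension [n = r - k] forces the complex gradients to be
    independent over C, which independence of the real differentials would not imply. *)
Lemma T01_row_full n k (rho : 'I_k -> 'rV[C]_r -> R) z :
  r = (n + k)%N -> \dim (T01 rho z) = n -> row_full (grad rho z).
Proof.
by move=> rE; rewrite T01E => /(row_full_of_dim_ker rE); exact: row_full_conj.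
Qed.

Lemma is_CRframe n k W M (rho : 'I_k -> 'rV[C]_r -> R) (L : 'I_n -> 'rV[C]_r -> 'rV[C]_r) :
  r = (n + k)%N -> defining_system W M rho -> CR_basis W M rho L -> CRframe W M rho L.
Proof.
move=> rE hrho [Ls Lb]; have [Wo _ _ hM] := hrho; split => //.
  by move=> s; exact: defining_smooth hrho.
move=> z Wz Mz; have bL := Lb _ Wz Mz; split => //.
apply: (T01_row_full (n := n) rE).
exact: size_basis bL.
Qed.

Lemma CRframe_sub n k W W' M (rho : 'I_k -> 'rV[C]_r -> R) (L : 'I_n -> 'rV[C]_r -> 'rV[C]_r) :
  open W' -> W' `<=` W -> CRframe W M rho L -> CRframe W' M rho L.
Proof.
move=> W'o sub [Wo hs hM Ls hb]; split => //.
- by move=> s; exact: smooth_sub sub (hs s).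
- by move=> z /sub; exact: hM.
- by move=> i j; exact: smooth_sub sub (Ls i j).
- by move=> z /sub; exact: hb.
Qed.

(** With [x] and [y] the holomorphic and antiholomorphic halves of the differential at [v], the two
    derivatives are [x + y] and ['i * x - 'i * y]; both vanish only if [y = 0]. *)
Lemma wirt_split (f : 'rV[C]_r -> C) z v : C1_at f z -> cdiff f z v = 0 -> cdiff f z ('i *: v) = 0 ->
  \sum_j dzbar j f z * conjc (v 0 j) = 0.
Proof.
move=> fC; rewrite !C1_cdiff// /wirt.
have -> : \sum_j (dz j f z * ('i *: v) 0 j + dzbar j f z * conjc (('i *: v) 0 j)) =
   'i * \sum_j dz j f z * v 0 j - 'i * \sum_j dzbar j f z * conjc (v 0 j).
  rewrite !mulr_sumr -sumrB; apply: eq_bigr => j _; rewrite !mxE conjcM conjc_i.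
  by move: (dz j f z) (dzbar j f z) (v 0 j) (conjc _) => a b c d; ring.
rewrite big_split /=; set x := \sum_j _ * v 0 j; set y := \sum_j _ * conjc _.
move: x y => x y h1 h2.
have : 2 * y = 0.
  have -> : 2 * y = (x + y) + 'i * ('i * x - 'i * y) + (- 'i ^+ 2 - 1) * (x - y) by ring.
  by rewrite h1 h2 sqr_i opprK subrr mul0r mulr0 !addr0.
by move=> /eqP; rewrite mulf_eq0 pnatr_eq0 /= => /eqP.
Qed.

Lemma conj_ker k (A : 'M[C]_(r, k)) (v : 'rV[C]_r) :
  v *m map_mx conjc A = 0 -> map_mx conjc v *m A = 0.
Proof.
move=> /(congr1 (map_mx conjc)); rewrite map_mxM map_mx0 => <-; congr (_ *m _).
by rewrite map_conjK.
Qed.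

Lemma memT01 k (rho : 'I_k -> 'rV[C]_r -> R) z v :
  (v \in T01 rho z) = (v *m map_mx conjc (grad rho z) == 0).
Proof. by rewrite T01E memv_ker lfunE. Qed.

Lemma T01P k (rho : 'I_k -> 'rV[C]_r -> R) z v :
  v \in T01 rho z <-> v *m map_mx conjc (grad rho z) = 0.
Proof. by rewrite memT01; split=> /eqP. Qed.

(** The conjugate of [w] and its multiple by ['i] both lie in the kernel of the gradient, where
    [tangential_vanish] applies; [wirt_split] extracts the antiholomorphic half. *)
Lemma T01_vanish k W M (rho : 'I_k -> 'rV[C]_r -> R) f z w : open W -> W z -> M z ->
  (forall s, smooth_on W (toC (rho s))) ->
  (forall z, W z -> (M z <-> forall s, rho s z = 0)) ->
  row_full (grad rho z) -> smooth_on W f -> (forall z, W z -> M z -> f z = 0) ->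
  w \in T01 rho z -> \sum_j w 0 j * dzbar j f z = 0.
Proof.
move=> Wo Wz Mz hs hM rf fs f0; rewrite memT01 => /eqP /conj_ker h.
have hC s : C1_at (toC (rho s)) z := smooth_C1 Wo (hs s) Wz.
have fC := smooth_C1 Wo fs Wz.
have h1 := tangential_vanish Wo Wz hC hM Mz rf fC f0 h.
have h2 : cdiff f z ('i *: map_mx conjc w) = 0.
  apply: (tangential_vanish Wo Wz hC hM Mz rf fC f0).
  by rewrite -scalemxAl h scaler0.
rewrite -[RHS](wirt_split fC h1 h2); apply: eq_bigr => j _.
by rewrite mxE conjcK mulrC.
Qed.

Lemma frame_T01 n k W M (rho : 'I_k -> 'rV[C]_r -> R) (L : 'I_n -> 'rV[C]_r -> 'rV[C]_r) i z :
  CRframe W M rho L -> W z -> M z -> L i z \in T01 rho z.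
Proof.
move=> [_ _ _ _ hb] Wz Mz; have [_ bL] := hb _ Wz Mz.
apply: (basis_mem bL); apply/tnthP; exists i; by rewrite tnth_mktuple.
Qed.

Lemma frame_tangential n k W M (rho : 'I_k -> 'rV[C]_r -> R) (L : 'I_n -> 'rV[C]_r -> 'rV[C]_r) i :
  CRframe W M rho L -> tangential W M (L i).
Proof.
move=> hF; have [Wo hs hM Ls hb] := hF; split => // f fs f0 z Wz Mz.
exact: (T01_vanish Wo Wz Mz hs hM (hb _ Wz Mz).1 fs f0 (frame_T01 i hF Wz Mz)).
Qed.

(** The functions [rho'] vanish on [M], hence so do their derivatives along complex tangent vectors;
    using both [v] and ['i *: v] kills the whole complex form and not only its real part. *)
Lemma ker_grad_sub k k' W M (rho : 'I_k -> 'rV[C]_r -> R) (rho' : 'I_k' -> 'rV[C]_r -> R) z (v : 'rV[C]_r) :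
  open W -> W z -> M z -> (forall s, smooth_on W (toC (rho s))) ->
  (forall z, W z -> (M z <-> forall s, rho s z = 0)) -> row_full (grad rho z) ->
  (forall s, smooth_on W (toC (rho' s))) ->
  (forall z, W z -> M z -> forall s, rho' s z = 0) ->
  v *m grad rho z = 0 -> v *m grad rho' z = 0.
Proof.
move=> Wo Wz Mz hs hM rf hs' hM' h.
have hC s : C1_at (toC (rho s)) z := smooth_C1 Wo (hs s) Wz.
have hC' s : C1_at (toC (rho' s)) z := smooth_C1 Wo (hs' s) Wz.
have h0 s z' : W z' -> M z' -> toC (rho' s) z' = 0 by move=> Wz' Mz'; rewrite /toC hM'.
have re (w : 'rV[C]_r) s : w *m grad rho z = 0 -> complex.Re ((w *m grad rho' z) 0 s) = 0.
  move=> w0; have := tangential_vanish Wo Wz hC hM Mz rf (hC' s) (h0 s) w0.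
  rewrite cdiff_toC rdiff_grad// => /complexI /eqP.
  by rewrite mulf_eq0 pnatr_eq0 /= => /eqP.
apply/rowP => s; rewrite [RHS]mxE; apply: Re_i_eq0; first exact: re.
have := re ('i *: v) s; rewrite -!scalemxAl [X in complex.Re X]mxE; apply.
by rewrite h scaler0.
Qed.

(** The transposed cokernel matrix of [A^T] has its rows in the kernel of [A], hence in that of
    [B]. *)
Lemma ker_submx k k' (A : 'M[C]_(r, k)) (B : 'M[C]_(r, k')) :
  (forall v : 'rV[C]_r, v *m A = 0 -> v *m B = 0) -> (B^T <= A^T)%MS.
Proof.
move=> h; rewrite submxE; apply/eqP; apply: trmx_inj; rewrite trmx_mul trmxK trmx0.
apply/row_matrixP => i; rewrite row_mul row0; apply: h.
have e : (cokermx A^T)^T *m A = 0.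
  by rewrite -[X in _ *m X]trmxK -trmx_mul mulmx_coker trmx0.
by rewrite -row_mul e row0.
Qed.

(** Along [M] the fields annihilate [rho s]; being tangential, they also annihilate the functions
    [act01 (L j) (toC (rho s))], which vanish there. The bracket is therefore a tangent
    (0,1)-vector, with smooth coefficients in the frame. *)
Lemma frame_involutive n k W M (rho : 'I_k -> 'rV[C]_r -> R) (L : 'I_n -> 'rV[C]_r -> 'rV[C]_r) :
  CRframe W M rho L ->
  (forall m (X : 'rV[C]_r -> 'M[C]_(m, r)), smooth_mx W X ->
    exists2 A : 'rV[C]_r -> 'M[C]_(m, n), smooth_mx W A &
      forall z, W z -> (X z <= \matrix_i L i z)%MS -> X z = A z *m \matrix_i L i z) ->
  forall i j, exists c : 'I_n -> 'rV[C]_r -> C,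
  (forall l, smooth_on W (c l)) /\
  forall f z, smooth_on W f -> W z -> M z ->
    act01 (L i) (act01 (L j) f) z - act01 (L j) (act01 (L i) f) z =
    \sum_l c l z * act01 (L l) f z.
Proof.
move=> hF hA i j; have [Wo hs hM Ls hb] := hF.
pose B z : 'rV[C]_r :=
  \row_m (act01 (L i) (fun z => L j z 0 m) z - act01 (L j) (fun z => L i z 0 m) z).
have hB : smooth_mx W B.
  move=> a m; apply: (eq_smooth Wo (f := fun z => act01 (L i) (fun z => L j z 0 m) z - act01 (L j) (fun z => L i z 0 m) z)).
    by move=> z _; rewrite mxE.
  exact: (smoothB Wo (smooth_act01 Wo (Ls i) (Ls j m)) (smooth_act01 Wo (Ls j) (Ls i m))).
have comm f z : smooth_on W f -> W z ->
    act01 (L i) (act01 (L j) f) z - act01 (L j) (act01 (L i) f) z = \sum_m B z 0 m * dzbar m f z.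
  move=> fs Wz; apply: etrans (act01_commutator Wo (Ls i) (Ls j) fs Wz) _.
  by apply: eq_bigr => m _; rewrite mxE.
have [A As AE] := hA _ _ hB.
exists (fun l z => A z 0 l); split; first by move=> l; exact: As.
move=> f z fs Wz Mz; rewrite (comm _ _ fs Wz).
have BT : B z \in T01 rho z.
  rewrite memT01; apply/eqP/rowP => s; rewrite [RHS]mxE mxE.
  have t0 w : W w -> M w -> toC (rho s) w = 0.
    by move=> Ww Mw; rewrite /toC ((hM _ Ww).1 Mw).
  have v0 l := (frame_tangential l hF).2 _ (hs s) t0.
  have h1 := (frame_tangential i hF).2 _ (smooth_act01 Wo (Ls j) (hs s)) (v0 j) z Wz Mz.
  have h2 := (frame_tangential j hF).2 _ (smooth_act01 Wo (Ls i) (hs s)) (v0 i) z Wz Mz.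
  have := comm _ _ (hs s) Wz; rewrite h1 h2 subrr => e; rewrite [RHS]e.
  by apply: eq_bigr => m _; rewrite [X in _ * X = _]mxE [X in conjc X]mxE -dzbar_toC.
have [_ bL] := hb _ Wz Mz.
have /(AE _ Wz) BE : (B z <= \matrix_i L i z)%MS by apply: (basis_of_rows bL).2.
transitivity (\sum_m \sum_l A z 0 l * (L l z 0 m * dzbar m f z)).
  apply: eq_bigr => m _; rewrite {1}BE mxE mulr_suml; apply: eq_bigr => l _.
  by rewrite [X in _ * X * _]mxE mulrA.
by rewrite exchange_big; apply: eq_bigr => l _; rewrite /act01 mulr_sumr.
Qed.

Lemma frame_Lspace_le n k W W' M (rho rho' : 'I_k -> 'rV[C]_r -> R)
    (L L' : 'I_n -> 'rV[C]_r -> 'rV[C]_r) nu q :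
  CRframe W M rho L -> CRframe W' M rho' L' -> W q -> W' q -> M q ->
  (lspan (L_generators rho' L' nu q) <= lspan (L_generators rho L nu q))%VS.
Proof.
move=> hF hF' Wq W'q Mq.
pose W0 := W `&` W'.
have W0o : open W0 by apply: openI; [case: hF|case: hF'].
have W0q : W0 q by split.
have hF0 := CRframe_sub W0o (@subIsetl _ W W') hF.
have [_ rhos _ Ls hb] := hF0.
have [rf bL] := hb _ W0q Mq.
have hg : smooth_mx W0 (fun z => (grad rho z)^T).
  move=> s j; apply: (eq_smooth W0o (f := dz j (toC (rho s)))); last exact: smooth_dz.
  by move=> z _; rewrite !mxE.
have rg : row_free (grad rho q)^T by rewrite /row_free mxrank_tr.
(* The neighbourhoods are fixed before any [X] is given, so gradients, fields and brackets can all
   be expanded on the same [V]. *)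
have [W1 [W1o W1q W10 hW1]] := smooth_coefficients W0o W0q hg rg.
have hL : smooth_mx W0 (fun z => \matrix_i L i z).
  by move=> i j; apply: (eq_smooth W0o (f := fun z => L i z 0 j)) => // z _; rewrite !mxE.
have [W2 [W2o W2q W20 hW2]] := smooth_coefficients W0o W0q hL (basis_of_rows bL).1.
pose V := W1 `&` W2.
have Vo : open V by exact: openI.
have Vq : V q by split.
have VW1 : V `<=` W1 by exact: subIsetl.
have VW2 : V `<=` W2 by exact: subIsetr.
have VW : V `<=` W by move=> z /VW1 /W10 [].
have VW' : V `<=` W' by move=> z /VW1 /W10 [].
have {hF0 hF} hF := CRframe_sub Vo VW hF.
have {hF'} hF' := CRframe_sub Vo VW' hF'.
have {}hW1 := hW1 _ Vo VW1.
have {}hW2 := hW2 _ Vo VW2.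
have {W1o W2o W1q W2q W10 W20 hg hL VW1 VW2 VW VW' W0o W0q rhos Ls hb rf bL rg} _ := I.
have [_ rhos hM Ls hb] := hF.
have [_ rhos' hM' Ls' hb'] := hF'.
have gs' : smooth_mx V (fun z => (grad rho' z)^T).
  move=> s j; apply: (eq_smooth Vo (f := dz j (toC (rho' s)))); last exact: smooth_dz.
  by move=> z _; rewrite !mxE.
have Lm' : smooth_mx V (fun z => \matrix_i L' i z).
  by move=> i j; apply: (eq_smooth Vo (f := fun z => L' i z 0 j)) => // z _; rewrite !mxE.
have [A As AE] := hW1 _ _ gs'.
have [a aS aE] := hW2 _ _ Lm'.
have gradE z : V z -> M z -> (grad rho' z)^T = A z *m (grad rho z)^T.
  move=> Vz Mz; apply: (AE _ Vz); apply: ker_submx => v.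
  apply: (ker_grad_sub Vo Vz Mz rhos hM (hb _ Vz Mz).1 rhos') => z' Vz' Mz'.
  exact: (hM' _ Vz').1.
have L'E z : V z -> M z -> forall i, L' i z = \sum_j a z i j *: L j z.
  move=> Vz Mz i.
  have sub : (\matrix_i L' i z <= \matrix_i L i z)%MS.
    apply/row_subP => i'; rewrite rowK; apply: (basis_of_rows (hb _ Vz Mz).2).2.
    have /T01P /conj_ker h := frame_T01 i' hF' Vz Mz; apply/T01P.
    have h2 : map_mx conjc (L' i' z) *m grad rho z = 0.
      apply: (ker_grad_sub Vo Vz Mz rhos' hM' (hb' _ Vz Mz).1 rhos) h => z' Vz' Mz'.
      exact: (hM _ Vz').1.
    move/(congr1 (map_mx conjc)): h2; rewrite map_mxM map_mx0 => <-; congr (_ *m _).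
    by rewrite map_conjK.
  have := congr1 (row i) (aE _ Vz sub); rewrite rowK row_mul mulmx_sum_row => ->.
  by apply: eq_bigr => j _; rewrite rowK mxE.
pose u (s : 'I_k) (j : 'I_r) := dz j (toC (rho s)).
pose u' (s : 'I_k) (j : 'I_r) := dz j (toC (rho' s)).
have us s j : smooth_on V (u s j) by exact: smooth_dz.
have us' s j : smooth_on V (u' s j) by exact: smooth_dz.
have Lt i : tangential V M (L i) := frame_tangential i hF.
have Lt' i : tangential V M (L' i) := frame_tangential i hF'.
have inv := frame_involutive hF hW2.
(* The empty word is the change of gradients by [A]; each further letter is a combination of the
   [L i] along [M] and raises the level by one. *)
have words w s : Mod V M (GenW L u (size w).+1) (fun j => act_word L' w (u' s j)).
  elim: w => [|i w IH] /=.
    apply: (Mod_eq (g := fun j z => \sum_t A z s t * u t j z)) => //.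
      move=> j z Vz Mz.
      have e : u' s j z = (A z *m (grad rho z)^T) s j by rewrite -(gradE _ Vz Mz) !mxE.
      by rewrite e mxE; apply: eq_bigr => t _; rewrite !mxE.
    apply: Mod_sum => t; apply: Mod_scale; first exact: As.
    by apply: Mod_gen; exists [::], t.
  exact: (ModO_act Vo Lt us (Lt' i) (fun j => aS i j) (fun z Vz Mz => L'E z Vz Mz i) IH).
apply: lspan_sub => v [b [s [bnu ->]]].
have h1 := words (multi_word b) s.
have h2 : Mod V M (GenO L u nu.+1) (fun j => act_multi L' b (u' s j)).
  apply: (ModW_ModO Vo Lt us inv).
  have -> : (fun j => act_multi L' b (u' s j)) = fun j => act_word L' (multi_word b) (u' s j).
    by apply/funext => j; exact: act_multi_word.
  by apply: GenW_le h1; rewrite size_multi_word ltnS.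
apply: (Mod_eval Vq Mq h2) => h [c [t [cn ->]]].
by apply: mem_lspan; exists c, t.
Qed.

Lemma is_Lspace_uniq n k M nu q V V' : r = (n + k)%N -> M q ->
  is_Lspace n k M nu q V -> is_Lspace n k M nu q V' -> V = V'.
Proof.
move=> rE Mq [W [rho [L [Wq hd hb ->]]]] [W' [rho' [L' [W'q hd' hb' ->]]]].
have hF := is_CRframe rE hd hb; have hF' := is_CRframe rE hd' hb'.
apply/eqP; rewrite eqEsubv; apply/andP; split.
- exact: frame_Lspace_le hF' hF W'q Wq Mq.
- exact: frame_Lspace_le hF hF' Wq W'q Mq.
Qed.

End Frames.

(** * Pulling back by a biholomorphism *)

Section Holomorphic.
Variables (R : realType) (r : nat).
Local Notation C := R[i].
Implicit Types (f : 'rV[C]_r -> C) (z v : 'rV[C]_r).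

Lemma eq_hol f g z (d : R) : 0 < d -> (forall w, nv (w - z) < d -> f w = g w) -> hol f z -> hol g z.
Proof.
move=> d0 fg [t [B [P [hP fP]]]]; have t0 := An_gt0 hP.
have m0 : 0 < Num.min t (d / 2) by rewrite lt_min t0 divr_gt0.
exists (Num.min t (d / 2)), B, P; split.
  by apply: An_shrink hP => //; rewrite ge_min lexx.
move=> w wm; rewrite -fg ?fP//.
  by apply: le_trans wm _; rewrite ge_min lexx.
apply: le_lt_trans wm _; apply: (@le_lt_trans _ _ (d / 2)); first by rewrite ge_min lexx orbT.
lra.
Qed.

Lemma wirtinger_holE (a : C) : 2^-1 * (a - 'i * ('i * a)) = a /\ 2^-1 * (a + 'i * ('i * a)) = 0.
Proof.
rewrite !mulrA -expr2 sqr_i mulN1r opprK subrr mulr0; split => //.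
have -> : a + a = 2 * a by ring.
by rewrite mulrA mulVf ?mul1r// pnatr_eq0.
Qed.

Lemma hol_wirtinger f z j : hol f z ->
  [/\ hol (dz j f) z, dzbar j f z = 0,
      has_dd f z (delta_mx 0 j) (dz j f z) & has_dd f z ('i *: delta_mx 0 j) ('i * dz j f z)].
Proof.
move=> /(hol_deriv (delta_mx 0 j))[g hg [d d0 hd]].
have h1 w : nv (w - z) < d -> has_dd f w (delta_mx 0 j) (g w).
  by move=> /hd /(_ 1); rewrite scale1r mul1r.
have h2 w : nv (w - z) < d -> has_dd f w ('i *: delta_mx 0 j) ('i * g w) by move=> /hd.
have E w : nv (w - z) < d -> dz j f w = g w /\ dzbar j f w = 0.
  move=> wd; have [e1 e2] := wirtinger_holE (g w).
  split.
    by apply: etrans e1; rewrite /dz (dd_cdiff (h1 _ wd)) (dd_cdiff (h2 _ wd)).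
  by apply: etrans e2; rewrite /dzbar (dd_cdiff (h1 _ wd)) (dd_cdiff (h2 _ wd)).
have z0 : nv (z - z) < d by rewrite subrr nv0.
have [e1 e2] := E _ z0.
split => //.
- by apply: eq_hol d0 _ hg => w /E[].
- by rewrite e1; exact: h1.
- by rewrite e1; exact: h2.
Qed.

Definition jac (F : 'rV[C]_r -> 'rV[C]_r) z : 'M[C]_r :=
  \matrix_(m, j) dz j (fun w => F w 0 m) z.

(** With [a] and [b] the two sums on the right, the derivatives along e_j and i e_j are [a + b] and
    ['i * a - 'i * b], because [F] is holomorphic; the Wirtinger operators separate [a] from [b]. *)
Lemma wirtinger_comp f (F : 'rV[C]_r -> 'rV[C]_r) z j : C1_at f (F z) ->
  (forall m, hol (fun w => F w 0 m) z) ->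
  dz j (f \o F) z = \sum_m dz m f (F z) * jac F z m j /\
  dzbar j (f \o F) z = \sum_m dzbar m f (F z) * conjc (jac F z m j).
Proof.
move=> fC hF.
pose w : 'rV[C]_r := \row_m jac F z m j.
have h1 : has_dd (f \o F) z (delta_mx 0 j) (wirt f (F z) w).
  apply: has_dd_comp fC _ => m; rewrite !mxE.
  by have [_ _ h _] := hol_wirtinger j (hF m).
have h2 : has_dd (f \o F) z ('i *: delta_mx 0 j) (wirt f (F z) ('i *: w)).
  apply: has_dd_comp fC _ => m; rewrite !mxE.
  by have [_ _ _ h] := hol_wirtinger j (hF m).
pose a := \sum_m dz m f (F z) * jac F z m j.
pose b := \sum_m dzbar m f (F z) * conjc (jac F z m j).
have e1 : wirt f (F z) w = a + b.
  by rewrite /wirt big_split /=; congr (_ + _); apply: eq_bigr => m _; rewrite [w _ _]mxE.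
have e2 : wirt f (F z) ('i *: w) = 'i * a - 'i * b.
  rewrite /wirt /a /b !mulr_sumr -sumrB; apply: eq_bigr => m _.
  rewrite [('i *: w) _ _]mxE [w _ _]mxE conjcM conjc_i.
  by move: (dz m f _) (dzbar m f _) (jac F z m j) (conjc _) => x y t t'; ring.
rewrite -/a -/b.
have [ha _] := wirtinger_holE a; have [hb _] := wirtinger_holE b.
split.
  apply: etrans ha; rewrite /dz (dd_cdiff h1) (dd_cdiff h2) e1 e2; congr (_ * _).
  move: a b {e1 e2 hb} => a b.
  have -> : a + b - 'i * ('i * a - 'i * b) = a - 'i * ('i * a) + (1 + 'i ^+ 2) * b by ring.
  by rewrite sqr_i subrr mul0r addr0.
apply: etrans hb; rewrite /dzbar (dd_cdiff h1) (dd_cdiff h2) e1 e2; congr (_ * _).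
move: a b {e1 e2 ha} => a b.
have -> : a + b + 'i * ('i * a - 'i * b) = b - 'i * ('i * b) + (1 + 'i ^+ 2) * a by ring.
by rewrite sqr_i subrr mul0r addr0.
Qed.

Lemma dd_coord z m v : has_dd (fun w : 'rV[C]_r => w 0 m) z v (v 0 m).
Proof.
move=> e e0; exists 1 => // t _; rewrite !mxE.
have -> : z 0 m + t%:C * v 0 m - z 0 m - t%:C * v 0 m = 0 by ring.
by rewrite nc0 mulr_ge0// ltW.
Qed.

Lemma dz_coord z m j : dz j (fun w : 'rV[C]_r => w 0 m) z = (m == j)%:R.
Proof.
have dd := @dd_coord z m.
rewrite /dz (dd_cdiff (dd _)) (dd_cdiff (dd _)) !mxE eqxx /=.
by have [e _] := wirtinger_holE ((m == j)%:R : C); rewrite -[RHS]e.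
Qed.

End Holomorphic.

(** * The transformation law *)

Section Transport.
Variables (R : realType) (r : nat).
Local Notation C := R[i].
Implicit Types (W M : set 'rV[C]_r) (F G : 'rV[C]_r -> 'rV[C]_r).

(** Symmetric in the two sides ([bihol_sym]), so each fact about [F] also serves for its inverse.
    [M] and [M'] correspond at every point of [W], not only as germs. *)
Definition bihol_pair W M W' M' F G :=
  [/\ open W, open W',
      forall z, W z -> W' (F z) /\ G (F z) = z,
      forall w, W' w -> W (G w) /\ F (G w) = w &
      [/\ forall z, W z -> forall j, hol (fun w => F w 0 j) z,
          forall w, W' w -> forall j, hol (fun z => G z 0 j) w &
          forall z, W z -> (M z <-> M' (F z))]].

Lemma bihol_sym W M W' M' F G : bihol_pair W M W' M' F G -> bihol_pair W' M' W M G F.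
Proof.
move=> [Wo W'o FG GF [hF hG hM]]; split => //; split => // w W'w.
have [WGw FGw] := GF _ W'w.
by have := hM _ WGw; rewrite FGw => ->.
Qed.

Lemma mx_entryT m n (A : 'M[C]_(m, n)) i j : A^T i j = A j i.
Proof. exact: mxE. Qed.

Lemma grad_entry k (rho : 'I_k -> 'rV[C]_r -> R) z j s : grad rho z j s = dz j (toC (rho s)) z.
Proof. exact: mxE. Qed.

Section Pair.
Variables (W M W' M' : set 'rV[C]_r) (F G : 'rV[C]_r -> 'rV[C]_r).
Hypothesis H : bihol_pair W M W' M' F G.

Lemma jac_inv z : W z -> jac G (F z) *m jac F z = 1%:M.
Proof.
move=> Wz; have [Wo W'o FG GF [hF hG hM]] := H.
have [W'Fz _] := FG _ Wz.
apply/matrixP => m j; rewrite !mxE.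
have GC : C1_at (fun w => G w 0 m) (F z).
  apply: (smooth_C1 W'o _ W'Fz); apply: (smooth_ra W'o) => w W'w.
  exact: hol_ra (hG _ W'w m).
have [e _] := wirtinger_comp j GC (hF _ Wz).
have -> : \sum_l jac G (F z) m l * jac F z l j = dz j ((fun w => G w 0 m) \o F) z.
  by apply: etrans (esym e); apply: eq_bigr => l _; rewrite [jac G _ _ _]mxE.
rewrite -(dz_coord z m j).
have eqW w : W w -> w 0 m = ((fun w => G w 0 m) \o F) w by move=> /FG[_ /= ->].
have k v : cdiff ((fun w => G w 0 m) \o F) z v = cdiff (fun w : 'rV[C]_r => w 0 m) z v.
  by apply: etrans (dd_cdiff (eq_dd_on Wo Wz eqW (dd_coord z m v))) (esym (dd_cdiff (dd_coord z m v))).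
exact: (f_equal2 (fun a b => 2^-1 * (a - 'i * b)) (k _) (k _)).
Qed.

Lemma jac_inv' z : W z -> jac F z *m jac G (F z) = 1%:M.
Proof. by move=> /jac_inv /mulmx1C. Qed.

Lemma ra_F z j : W z -> ra (fun w => F w 0 j) z.
Proof. by move=> Wz; have [_ _ _ _ [hF _ _]] := H; exact: hol_ra (hF _ Wz j). Qed.

Lemma preim_open V' : open V' -> open (W `&` F @^-1` V').
Proof.
move=> /openP V'o; have [/openP Wo _ _ _ _] := H.
apply/openP => z [Wz V'Fz].
have [d1 [d10 h1]] := Wo _ Wz; have [d2 [d20 h2]] := V'o _ V'Fz.
have [d3 [d30 h3]] := cont_vec (fun j => ra_cont (ra_F j Wz)) d20.
exists (Num.min d1 d3); split; first by rewrite lt_min d10.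
by move=> w; rewrite lt_min => /andP[/h1 Ww /h3 /h2 V'w].
Qed.

Lemma smooth_comp_F V' f : open V' -> smooth_on V' f -> smooth_on (W `&` F @^-1` V') (f \o F).
Proof.
move=> V'o fs; apply: (smooth_comp (preim_open V'o) V'o fs) => [z []//|z j [Wz _]].
exact: ra_F.
Qed.

Lemma hol_jac z m j : W z -> hol (fun w => jac F w m j) z.
Proof.
move=> Wz; have [_ _ _ _ [hF _ _]] := H.
have [h _ _ _] := hol_wirtinger j (hF _ Wz m).
by apply: eq_hol ltr01 _ h => w _; rewrite mxE.
Qed.

Section System.
Variables (n k : nat) (V' : set 'rV[C]_r) (rho' : 'I_k -> 'rV[C]_r -> R).
Hypothesis hsys : defining_system V' M' rho'.
Let V := W `&` F @^-1` V'.
Let rho s := rho' s \o F.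

(** The Jacobian is transposed because it has one row per component of [F], while gradients are
    columns. *)
Lemma grad_pullback z : V z -> grad rho z = (jac F z)^T *m grad rho' (F z).
Proof.
move=> [Wz V'Fz]; have [_ _ _ _ [hF _ _]] := H; have [V'o _ _ _] := hsys.
apply/matrixP => j s; rewrite !mxE.
have fC := smooth_C1 V'o (defining_smooth s hsys) V'Fz.
have [e _] := wirtinger_comp j fC (hF _ Wz).
apply: etrans e _; apply: eq_bigr => m _; apply: etrans (mulrC _ _) _.
exact: (f_equal2 *%R (esym (mx_entryT _ _ _)) (esym (grad_entry _ _ _ _))).
Qed.

Lemma rdiff_pullback z v s : V z -> rdiff (rho s) z v = rdiff (rho' s) (F z) (v *m (jac F z)^T).
Proof.
move=> Vz; have [Wz V'Fz] := Vz; have [V'o _ _ _] := hsys.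
have sm := defining_smooth s hsys.
have C' : C1_at (toC (rho' s)) (F z) := smooth_C1 V'o sm V'Fz.
have C0 : C1_at (toC (rho s)) z := smooth_C1 (preim_open V'o) (smooth_comp_F V'o sm) Vz.
by rewrite (rdiff_grad v C0) (rdiff_grad _ C') (grad_pullback Vz) mulmxA.
Qed.

Lemma defining_pullback : defining_system V M rho.
Proof.
have [Wo W'o FG GF [hF hG hM]] := H; have [V'o V'ra V'ind V'M] := hsys.
split.
- exact: preim_open.
- move=> s z [Wz V'Fz]; apply/raP.
  apply: (ra_comp (f := toC (rho' s)) (F := F)); first exact/raP/V'ra.
  by move=> j; exact: ra_F.
- move=> z Vz a h; have [Wz V'Fz] := Vz; apply: (V'ind _ V'Fz) => v.
  (* The vector whose image under the differential of [F] is [v]. *)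
  rewrite -[RHS](h (v *m (jac G (F z))^T)); apply: eq_bigr => s _.
  by rewrite (rdiff_pullback _ _ Vz) -mulmxA -trmx_mul (jac_inv' Wz) trmx1 mulmx1.
- by move=> z [Wz V'Fz]; rewrite hM//; exact: V'M.
Qed.

Lemma ker_pullback m (S T : 'M[C]_r) (A : 'M[C]_(r, m)) : T *m S = 1%:M ->
  lker (linfun (mulmxr (T *m A)) : 'Hom('rV[C]_r, 'rV[C]_m)) =
  (linfun (mulmxr S) @: lker (linfun (mulmxr A) : 'Hom('rV[C]_r, 'rV[C]_m)))%VS.
Proof.
move=> TS; have ST := mulmx1C TS.
apply/vspaceP => v; rewrite memv_ker lfunE /=; apply/eqP/memv_imgP.
  move=> v0; exists (v *m T); last by rewrite lfunE /= -mulmxA TS mulmx1.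
  by rewrite memv_ker lfunE /= -mulmxA v0.
move=> [u]; rewrite memv_ker lfunE /= => /eqP u0 ->; rewrite lfunE /=.
by rewrite mulmxA -[u *m S *m T]mulmxA ST mulmx1.
Qed.

Lemma lker_mulmxr (S T : 'M[C]_r) : S *m T = 1%:M ->
  lker (linfun (mulmxr S) : 'End('rV[C]_r)) = 0%VS.
Proof.
move=> ST; apply/eqP/lker0P => u v; rewrite !lfunE /= => e.
by rewrite -[u]mulmx1 -ST mulmxA e -mulmxA ST mulmx1.
Qed.

Lemma dim_complex_tangent_pullback z : V z ->
  \dim (complex_tangent rho z) = \dim (complex_tangent rho' (F z)).
Proof.
move=> Vz; have [Wz V'Fz] := Vz; have [V'o _ _ _] := hsys.
have C' s : C1_at (toC (rho' s)) (F z) := smooth_C1 V'o (defining_smooth s hsys) V'Fz.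
have C0 s : C1_at (toC (rho s)) z :=
  smooth_C1 (preim_open V'o) (smooth_comp_F V'o (defining_smooth s hsys)) Vz.
rewrite (complex_tangentE C0) (complex_tangentE C') (grad_pullback Vz).
have e : (jac F z)^T *m (jac G (F z))^T = 1%:M by rewrite -trmx_mul jac_inv// trmx1.
rewrite (ker_pullback _ e) limg_dim_eq//.
by rewrite (lker_mulmxr (mulmx1C e)) capv0.
Qed.

Variable L' : 'I_n -> 'rV[C]_r -> 'rV[C]_r.
Hypothesis hL' : CR_basis V' M' rho' L'.

(** The field [L' i] transported by [G]: vectors of type (0,1) transform by the conjugate
    Jacobian. *)
Definition pull_field i z : 'rV[C]_r := L' i (F z) *m (map_mx conjc (jac G (F z)))^T.

Lemma smooth_pull_field i j : smooth_on V (fun z => pull_field i z 0 j).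
Proof.
have [Wo W'o FG GF [hF hG hM]] := H; have [V'o _ _ _] := hsys.
have Vo : open V := preim_open V'o.
apply: (eq_smooth Vo (f := fun z => \sum_m ((fun w => L' i w 0 m) \o F) z *
    conjc (((fun w => jac G w j m) \o F) z))).
  move=> z _; rewrite [RHS]mxE; apply: eq_bigr => m _; rewrite [_^T _ _]mxE [map_mx _ _ _ _]mxE.
  by [].
apply: (smooth_sum Vo) => m; apply: (smoothM Vo).
  exact: smooth_comp_F V'o (hL'.1 i m).
apply: (smooth_conj Vo).
apply: (smooth_comp Vo W'o) => [|z [Wz _]|z l [Wz _]].
- apply: (smooth_ra W'o) => w W'w; apply: hol_ra.
  have [h _ _ _] := hol_wirtinger m (hG _ W'w j).
  by apply: eq_hol ltr01 _ h => x _; rewrite mxE.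
- exact: (FG _ Wz).1.
- exact: ra_F.
Qed.

Lemma T01_pullback z : V z ->
  T01 rho z = (linfun (mulmxr (map_mx conjc (jac G (F z)))^T) @: T01 rho' (F z))%VS.
Proof.
move=> Vz; have [Wz V'Fz] := Vz.
have e : (map_mx conjc (jac F z))^T *m (map_mx conjc (jac G (F z)))^T = 1%:M.
  by rewrite -trmx_mul -map_mxM jac_inv// map_mx1 trmx1.
rewrite !T01E -(ker_pullback _ e); congr (lker (linfun (mulmxr _))).
by rewrite (grad_pullback Vz) map_mxM map_trmx.
Qed.

Lemma CR_basis_pullback : CR_basis V M rho pull_field.
Proof.
have [Wo W'o FG GF [hF hG hM]] := H.
split; first exact: smooth_pull_field.
move=> z Vz Mz; have [Wz V'Fz] := Vz.
have M'Fz : M' (F z) by apply/hM.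
have bL := hL'.2 _ V'Fz M'Fz.
rewrite T01_pullback//.
set f := linfun _.
have -> : tval [tuple pull_field i z | i < n] = map f [tuple L' i (F z) | i < n].
  by rewrite /= -map_comp; apply: eq_map => i; rewrite /= /f lfunE.
apply: limg_basis_of bL.
have e : (map_mx conjc (jac G (F z)))^T *m (map_mx conjc (jac F z))^T = 1%:M.
  by rewrite -trmx_mul -map_mxM jac_inv'// map_mx1 trmx1.
by rewrite (lker_mulmxr e) capv0.
Qed.

Lemma act01_hol f (X : 'rV[C]_r -> 'rV[C]_r) z : hol f z -> act01 X f z = 0.
Proof.
move=> hf; rewrite /act01 big1// => j _.
by have [_ -> _ _] := hol_wirtinger j hf; rewrite mulr0.
Qed.

Lemma act01_pullback i f z : V z -> C1_at f (F z) ->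
  act01 (pull_field i) (f \o F) z = act01 (L' i) f (F z).
Proof.
move=> Vz fC; have [Wz V'Fz] := Vz; have [_ _ _ _ [hF _ _]] := H.
transitivity (\sum_m \sum_l pull_field i z 0 m * conjc (jac F z l m) * dzbar l f (F z)).
  apply: eq_bigr => m _; have [_ e] := wirtinger_comp m fC (hF _ Wz).
  rewrite e mulr_sumr; apply: eq_bigr => l _.
  by rewrite (mulrC (dzbar _ _ _)) mulrA.
rewrite exchange_big; apply: eq_bigr => l _ /=; rewrite -mulr_suml; congr (_ * _).
have e : pull_field i z *m (map_mx conjc (jac F z))^T = L' i (F z).
  by rewrite /pull_field -mulmxA -trmx_mul -map_mxM jac_inv'// map_mx1 trmx1 mulmx1.
apply: etrans _ (congr1 (fun v : 'rV[C]_r => v 0 l) e).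
apply: etrans _ (esym (mxE _ _ _ _)); apply: eq_bigr => m _.
by rewrite [_^T _ _]mxE [map_mx _ _ _ _]mxE.
Qed.

(** In the Leibniz rule the terms in which a field meets an entry of the Jacobian vanish by
    [act01_hol], so the same matrix [jac F z] comes out for every word. *)
Lemma act_word_pullback w s j z : V z ->
  act_word pull_field w (dz j (toC (rho s))) z =
  \sum_m act_word L' w (dz m (toC (rho' s))) (F z) * jac F z m j.
Proof.
have [Wo W'o FG GF [hF hG hM]] := H; have [V'o _ _ _] := hsys.
have Vo : open V := preim_open V'o.
have ws m w' : smooth_on V' (act_word L' w' (dz m (toC (rho' s)))).
  elim: w' => [|i w' IH]; first exact: (smooth_dz V'o m (defining_smooth s hsys)).
  exact: (smooth_act01 V'o (hL'.1 i) IH).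
have js m : smooth_on V (fun z => jac F z m j).
  by apply: (smooth_ra Vo) => x [Wx _]; apply: hol_ra; exact: hol_jac.
elim: w z => [|i w IH] z Vz.
  have [Wz V'Fz] := Vz.
  have fC := smooth_C1 V'o (defining_smooth s hsys) V'Fz.
  exact: (wirtinger_comp j fC (hF _ Wz)).1.
have [Wz V'Fz] := Vz.
pose f m := act_word L' w (dz m (toC (rho' s))).
have fs m : smooth_on V (f m \o F) := smooth_comp_F V'o (ws m w).
have ps m : smooth_on V (fun z => (f m \o F) z * jac F z m j) := smoothM Vo (fs m) (js m).
have IH' x : V x -> \sum_m (f m \o F) x * jac F x m j =
   act_word pull_field w (dz j (toC (rho s))) x by move=> Vx; rewrite IH.
have e1 := eq_act01 Vo (pull_field i) (smooth_sum Vo (index_enum _) ps) Vz IH'.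
apply: etrans (esym e1) _.
apply: etrans (act01_sum Vo (pull_field i) (index_enum _) ps Vz) _.
apply: eq_bigr => m _.
apply: etrans (act01M (pull_field i) (fs m) (js m) Vz) _.
have leib (x y a b c : C) : c = 0 -> x = y -> x * a + b * c = y * a.
  by move=> -> ->; rewrite mulr0 addr0.
exact: (leib _ _ _ _ _ (act01_hol (pull_field i) (hol_jac m j Wz))
  (act01_pullback i Vz (smooth_C1 V'o (ws m w) V'Fz))).
Qed.

Lemma lspan_pullback nu q : V q ->
  lspan (L_generators rho pull_field nu q) =
  (linfun (mulmxr (jac F q)) @: lspan (L_generators rho' L' nu (F q)))%VS.
Proof.
move=> Vq; rewrite -lspan_img; congr lspan; apply/seteqP.
have key (a : {ffun 'I_n -> nat}) s : \row_j act_multi pull_field a (dz j (toC (rho s))) q =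
   linfun (mulmxr (jac F q)) (\row_j act_multi L' a (dz j (toC (rho' s))) (F q)).
  apply/rowP => j; rewrite lfunE /= [LHS]mxE [RHS]mxE act_multi_word act_word_pullback//.
  by apply: eq_bigr => m _; rewrite [X in _ = X * _]mxE act_multi_word.
split=> v.
  move=> [a [s [an ->]]].
  exists (\row_j act_multi L' a (dz j (toC (rho' s))) (F q)); first by exists a, s.
  by rewrite key.
by move=> [_ [a [s [an ->]]] <-]; exists a, s; split => //; rewrite key.
Qed.

End System.

Lemma reg_pullback n k q : W q -> reg n k M' (F q) -> reg n k M q.
Proof.
move=> Wq [M'Fq [V' [rho' [V'Fq hsys hd]]]].
have [Wo W'o FG GF [hF hG hM]] := H.
split; first exact/hM.
exists (W `&` F @^-1` V'), (fun s => rho' s \o F); split.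
- by split.
- exact: defining_pullback.
- move=> z Vz Mz; rewrite (dim_complex_tangent_pullback hsys Vz).
  by apply: hd; [exact: Vz.2|apply/hM => //; exact: Vz.1].
Qed.

Lemma is_Lspace_pullback n k nu q V0 : W q -> is_Lspace n k M' nu (F q) V0 ->
  is_Lspace n k M nu q (linfun (mulmxr (jac F q)) @: V0)%VS.
Proof.
move=> Wq [V' [rho' [L' [V'Fq hsys hL' ->]]]].
exists (W `&` F @^-1` V'), (fun s => rho' s \o F), (pull_field L'); split.
- by split.
- exact: defining_pullback.
- exact: CR_basis_pullback.
- by rewrite (lspan_pullback hsys hL').
Qed.

End Pair.

(* When no frame exists both sides are the default value 0 of [Lspace]. *)
Lemma Lspace_pullback n k W M W' M' F G nu q : bihol_pair W M W' M' F G ->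
  r = (n + k)%N -> W q -> M q ->
  Defs.Lspace n k M nu q = (linfun (mulmxr (jac F q)) @: Defs.Lspace n k M' nu (F q))%VS.
Proof.
move=> H rE Wq Mq; have [Wo W'o FG GF [hF hG hM]] := H.
have M'Fq : M' (F q) by apply/hM.
have [W'Fq GFq] := FG _ Wq.
have [[V0 hV0]|no] := pselect (exists V0, is_Lspace n k M' nu (F q) V0).
  have h1 : is_Lspace n k M' nu (F q) (Defs.Lspace n k M' nu (F q)).
    exact: (@xgetPex _ _ [set V | is_Lspace n k M' nu (F q) V] (ex_intro _ V0 hV0)).
  have h2 := is_Lspace_pullback H Wq h1.
  have h3 : is_Lspace n k M nu q (Defs.Lspace n k M nu q).
    exact: (@xgetPex _ _ [set V | is_Lspace n k M nu q V] (ex_intro _ _ h2)).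
  exact: is_Lspace_uniq rE Mq h3 h2.
have no' V1 : ~ is_Lspace n k M nu q V1.
  move=> h; apply: no; exists (linfun (mulmxr (jac G (F q))) @: V1)%VS.
  by apply: (is_Lspace_pullback (bihol_sym H)) => //; rewrite GFq.
rewrite /Defs.Lspace (xgetPN _ no') (xgetPN _ (fun V0 h => no (ex_intro _ V0 h))).
by rewrite limg0.
Qed.

End Transport.

(** * Limit values *)

Section Limits.
Variables (R : realType) (r : nat).
Local Notation C := R[i].
Implicit Types (W M : set 'rV[C]_r) (F G : 'rV[C]_r -> 'rV[C]_r).

Lemma mulmx_near (v : 'rV[C]_r) (A : 'M[C]_r) (e : R) : 0 < e ->
  exists2 d : R, 0 < d & forall (u : 'rV[C]_r) (B : 'M[C]_r), nv (u - v) < d ->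
    (forall m j, nc (B m j - A m j) < d) -> nv (u *m B - v *m A) < e.
Proof.
move=> e0; pose K : R := \sum_m \sum_j nc (A m j).
have K0 : 0 <= K by apply: sumr_ge0 => m _; apply: sumr_ge0 => j _; exact: nc_ge0.
have AK m j : nc (A m j) <= K.
  rewrite /K (bigD1 m)//= (bigD1 j)//= -addrA lerDl addr_ge0//.
    by apply: sumr_ge0 => i _; exact: nc_ge0.
  by apply: sumr_ge0 => i _; apply: sumr_ge0 => l _; exact: nc_ge0.
(* With errors at most [e / 2 / Q], each of the [r] terms is at most [K + 1 + nv v] times that
   bound; the last [+ 1] keeps [Q] positive when [r = 0]. *)
pose Q := r%:R * (K + 1 + nv v) + 1.
have Q0 : 0 < Q by rewrite ltr_wpDl// mulr_ge0// !addr_ge0// nv_ge0.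
have eQ : 0 < e / 2 / Q by rewrite !divr_gt0.
exists (Num.min 1 (e / 2 / Q)); first by rewrite lt_min ltr01.
move=> u B uv BA.
have BK m j : nc (B m j) <= K + 1.
  rewrite -[B m j](subrK (A m j)); apply: le_trans (ncD _ _) _.
  rewrite addrC lerD ?AK// ltW//; apply: lt_le_trans (BA m j) _.
  by rewrite ge_min lexx.
have uv' : nv (u - v) <= e / 2 / Q.
  by apply: ltW; apply: lt_le_trans uv _; rewrite ge_min lexx orbT.
have BA' m j : nc (B m j - A m j) <= e / 2 / Q.
  by apply: ltW; apply: lt_le_trans (BA m j) _; rewrite ge_min lexx orbT.
apply: (@le_lt_trans _ _ (e / 2)); last by lra.
apply: nv_le => [|j]; first by rewrite divr_ge0// ltW.
have -> : (u *m B - v *m A) 0 j = \sum_m ((u - v) 0 m * B m j + v 0 m * (B m j - A m j)).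
  rewrite !mxE -sumrB; apply: eq_bigr => m _; rewrite !mxE; ring.
apply: le_trans (nc_sum _ _ _) _.
apply: (@le_trans _ _ (\sum_(m < r) (K + 1 + nv v) * (e / 2 / Q))).
  apply: ler_sum => m _; apply: le_trans (ncD _ _) _; rewrite !ncM mulrDl lerD//.
    rewrite mulrC; apply: ler_pM; rewrite ?nc_ge0//.
    exact: le_trans (nv_comp _ _) uv'.
  by apply: ler_pM; rewrite ?nc_ge0 ?nv_comp.
have QE : Q * (e / 2 / Q) = e / 2 by rewrite mulrC divfK// gt_eqF.
rewrite -[leRHS]QE sumr_const card_ord -(mulr_natl _ r).
move: (e / 2 / Q) eQ {uv uv' BA BA' QE} => x eQ; rewrite mulrA.
by apply: ler_wpM2r; [exact: ltW|rewrite lerDl].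
Qed.

Section Pair.
Variables (W M W' M' : set 'rV[C]_r) (F G : 'rV[C]_r -> 'rV[C]_r).
Hypothesis H : bihol_pair W M W' M' F G.

Lemma jac_near p (e : R) : W p -> 0 < e ->
  exists2 d : R, 0 < d & forall q, nv (q - p) < d -> forall m j, nc (jac F q m j - jac F p m j) < e.
Proof.
move=> Wp e0.
have [d d0 hd] : exists2 d : R, 0 < d & forall m q, nv (q - p) < d -> forall j, nc (jac F q m j - jac F p m j) < e.
  apply: fin_min => m.
  have [d d0 hd] : exists2 d : R, 0 < d & forall j q, nv (q - p) < d -> nc (jac F q m j - jac F p m j) < e.
    apply: fin_min => j; have /ra_cont/contP/(_ _ e0)[d [d0 hd]] := hol_ra (hol_jac H m j Wp).
    by exists d => // d' _ d'd q qd; apply: hd; apply: lt_le_trans qd d'd.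
  by exists d => // d' _ d'd q qd j; apply: hd; apply: lt_le_trans qd d'd.
by exists d => // q qd m j; apply: hd.
Qed.

Lemma F_near p (e : R) : W p -> 0 < e ->
  exists2 d : R, 0 < d & forall q, nv (q - p) < d -> W q /\ nv (F q - F p) < e.
Proof.
move=> Wp e0; have [/openP Wo _ _ _ _] := H.
have [d1 [d10 h1]] := Wo _ Wp.
have [d2 [d20 h2]] := cont_vec (fun j => ra_cont (ra_F H j Wp)) e0.
exists (Num.min d1 d2); first by rewrite lt_min d10.
by move=> q; rewrite lt_min => /andP[/h1 ? /h2 ?].
Qed.

Lemma reg_push n k q : W q -> reg n k M q -> reg n k M' (F q).
Proof.
move=> Wq rq; have [_ _ FG _ _] := H; have [W'Fq GFq] := FG _ Wq.
by apply: (reg_pullback (bihol_sym H)) => //; rewrite GFq.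
Qed.

Lemma Lspace_mem n k nu q u : r = (n + k)%N -> W q -> M q ->
  u \in Defs.Lspace n k M' nu (F q) -> u *m jac F q \in Defs.Lspace n k M nu q.
Proof.
move=> rE Wq Mq hu; rewrite (Lspace_pullback nu H rE Wq Mq).
by apply/memv_imgP; exists u => //; rewrite lfunE.
Qed.

(** [jac F] is analytic on all of [W], the singular point included, so vectors transported at nearby
    points approach the one transported at [p]. Analytic sections are composed with [F], whereas
    sequences of base points are brought back by [G]. *)
Lemma limit_values_pullback (j : limit_kind) n k nu p v : r = (n + k)%N -> W p ->
  limit_values j (reg n k M') (Defs.Lspace n k M' nu) (F p) v ->
  limit_values j (reg n k M) (Defs.Lspace n k M nu) p (v *m jac F p).
Proof.
move=> rE Wp; have [Wo W'o FG GF [hF hG hM]] := H; case: j => /=.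
- move=> [U' [V [U'o U'Fp Vra Vmem <-]]].
  exists (W `&` F @^-1` U'), (fun z => V (F z) *m jac F z); split => //.
  + exact: (preim_open H).
  + move=> l z [Wz U'Fz]; apply/raP.
    have h m : ra (fun z => V (F z) 0 m * jac F z m l) z.
      apply: raM; last exact: hol_ra (hol_jac H m l Wz).
      apply: (ra_comp (f := fun w => V w 0 m) (F := F)); first exact/raP/Vra.
      by move=> i; exact: (ra_F H i Wz).
    apply: eq_ra ltr01 _ (ra_sum (index_enum _) h) => w _.
    by rewrite mxE.
  + move=> q rq [Wq U'Fq]; apply: Lspace_mem => //; first exact: rq.1.
    by apply: Vmem => //; exact: reg_push.
- move=> h e e0.
  have [d d0 hd] := mulmx_near v (jac F p) e0.
  have [d1 [d10 h1]] := h _ d0.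
  have [d2 d20 h2] := F_near Wp d10.
  have [d3 d30 h3] := jac_near Wp d0.
  exists (Num.min d2 d3); split; first by rewrite lt_min d20.
  move=> q rq; rewrite nvE ltcR lt_min => /andP[/h2[Wq Fq] /h3 Jq].
  have [|u [uL uv]] := h1 _ (reg_push Wq rq); first by rewrite nvE ltcR.
  exists (u *m jac F q); split; first exact: Lspace_mem rE Wq rq.1 uL.
  by rewrite nvE ltcR; apply: hd => //; move: uv; rewrite nvE ltcR.
- move=> [q_ [v_ [rq vL /cvgvP qp /cvgvP vv]]].
  have W'Fp : W' (F p) := (FG _ Wp).1.
  have /openP/(_ _ W'Fp)[d [d0 hd]] := W'o.
  (* The sequence may start outside [W'], where nothing is known of [G]; only the tail from [m0] on
     is transported. *)
  have [m0 hm0] := qp _ d0.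
  have W'q m : W' (q_ (m + m0)%N) by apply: hd; apply: hm0; exact: leq_addl.
  have FGq m : F (G (q_ (m + m0)%N)) = q_ (m + m0)%N := (GF _ (W'q m)).2.
  have Wq m : W (G (q_ (m + m0)%N)) := (GF _ (W'q m)).1.
  have rGq m : reg n k M (G (q_ (m + m0)%N)).
    by apply: (reg_pullback H (Wq m)); rewrite FGq.
  have Gp : (fun m => G (q_ (m + m0)%N)) @ \oo --> p.
    apply/cvgvP => e e0.
    have [d1 [d10 h1]] := cont_vec (fun j => ra_cont (ra_F (bihol_sym H) j W'Fp)) e0.
    have [m1 hm1] := qp _ d10; exists m1 => m mm.
    have := h1 (q_ (m + m0)%N); rewrite (FG _ Wp).2; apply; apply: hm1.
    exact: leq_trans mm (leq_addr _ _).
  exists (fun m => G (q_ (m + m0)%N)), (fun m => v_ (m + m0)%N *m jac F (G (q_ (m + m0)%N))).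
  split; [exact: rGq| |exact: Gp|].
  + move=> m; apply: (Lspace_mem rE (Wq m) (rGq m).1).
    by rewrite FGq.
  + apply/cvgvP => e e0.
    have [d1 d10 h1] := mulmx_near v (jac F p) e0.
    have [d2 d20 h2] := jac_near Wp d10.
    have [m1 hm1] := vv _ d10.
    have /cvgvP/(_ _ d20)[m2 hm2] := Gp.
    exists (maxn m1 m2) => m; rewrite geq_max => /andP[mm1 mm2].
    apply: h1; last exact: h2 (hm2 _ mm2).
    by apply: hm1; exact: leq_trans mm1 (leq_addr _ _).
Qed.

Lemma dim_limit_le (j : limit_kind) n k nu p : r = (n + k)%N -> W p ->
  (\dim (lspan (limit_values j (reg n k M') (Defs.Lspace n k M' nu) (F p))) <=
   \dim (lspan (limit_values j (reg n k M) (Defs.Lspace n k M nu) p)))%N.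
Proof.
move=> rE Wp; set S' := limit_values _ _ _ (F p); set S := limit_values _ _ _ p.
have Jinj := lker_mulmxr (jac_inv' H Wp).
pose f : 'End('rV[C]_r) := linfun (mulmxr (jac F p)).
have e : \dim (f @: lspan S') = \dim (lspan S').
  by apply: limg_dim_eq; rewrite [lker f]Jinj capv0.
have sub : (lspan [set f v | v in S'] <= lspan S)%VS.
  apply: lspan_mono => _ [v Sv <-]; rewrite lfunE /=.
  exact: limit_values_pullback rE Wp Sv.
have := dimvS sub; rewrite lspan_img; exact: leq_trans (eq_leq (esym e)).
Qed.

End Pair.

(** * Invariance of the CR type *)

Lemma reg_near n k M q : reg n k M q ->
  exists W, [/\ open W, W q & forall z, W z -> M z -> reg n k M z].
Proof.
move=> [Mq [W [rho [Wq hs hd]]]]; exists W; split => //; first by case: hs.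
by move=> z Wz Mz; split => //; exists W, rho.
Qed.

Lemma reg_row_full n k W M (rho : 'I_k -> 'rV[C]_r -> R) z : r = (n + k)%N ->
  defining_system W M rho -> W z -> \dim (complex_tangent rho z) = n -> row_full (grad rho z).
Proof.
move=> rE hs Wz; have [Wo _ _ _] := hs; rewrite complex_tangentE => [|s].
  exact: row_full_of_dim_ker.
exact: (smooth_C1 Wo (defining_smooth s hs) Wz).
Qed.

(** Two defining systems of [M] have the same complex tangent space: each vanishes on [M], so
    [ker_grad_sub] applies in both directions. *)
Lemma reg_type_uniq n k n' k' M q : r = (n + k)%N -> r = (n' + k')%N ->
  reg n k M q -> reg n' k' M q -> n = n'.
Proof.
move=> rE rE' [Mq [W [rho [Wq hs hd]]]] [_ [W' [rho' [W'q hs' hd']]]].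
have [Wo _ _ hM] := hs; have [W'o _ _ hM'] := hs'.
have Vo : open (W `&` W') by exact: openI.
have Vq : (W `&` W') q by split.
have sm s : smooth_on (W `&` W') (toC (rho s)).
  exact: smooth_sub (@subIsetl _ _ _) (defining_smooth s hs).
have sm' s : smooth_on (W `&` W') (toC (rho' s)).
  exact: smooth_sub (@subIsetr _ _ _) (defining_smooth s hs').
have rf := reg_row_full rE hs Wq (hd _ Wq Mq).
have rf' := reg_row_full rE' hs' W'q (hd' _ W'q Mq).
have C0 s := smooth_C1 Vo (sm s) Vq.
have C' s := smooth_C1 Vo (sm' s) Vq.
have memker m (A : 'M[C]_(r, m)) v :
    (v \in lker (linfun (mulmxr A) : 'Hom('rV[C]_r, 'rV[C]_m))) = (v *m A == 0).
  by rewrite memv_ker lfunE.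
rewrite -(hd _ Wq Mq) -(hd' _ W'q Mq) (complex_tangentE C0) (complex_tangentE C').
apply: (f_equal (fun V : {vspace 'rV[C]_r} => \dim V)).
apply/vspaceP => v; apply: etrans (memker _ _ v) _; apply: etrans _ (esym (memker _ _ v)).
apply/eqP/eqP.
- apply: (ker_grad_sub Vo Vq Mq sm _ rf sm') => [z [Wz _]|z [_ W'z] Mz]; first exact: hM.
  exact: (hM' _ W'z).1.
- apply: (ker_grad_sub Vo Vq Mq sm' _ rf' sm) => [z [_ W'z]|z [Wz _] Mz]; first exact: hM'.
  exact: (hM _ Wz).1.
Qed.

(** The point [p] may be singular and have no type. Density gives a nearby [q] in [reg n k M], so
    [F q] is in [reg n k M']; all points of [M'] near [F q] have type (n, k), and density of
    [reg n' k' M'] provides among them one of type (n', k'). *)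
Lemma CR_type_eq n k n' k' U M U' M' W W' F G p :
  CR_regular_set n k U M -> CR_regular_set n' k' U' M' ->
  bihol_pair W M W' M' F G -> W p -> M p -> n = n'.
Proof.
move=> [rE _ _ _ dM] [rE' _ _ _ dM'] H Wp Mp.
have [Wo W'o FG GF [hF hG hM]] := H.
have [q [rq Wq]] := dM _ Mp _ (open_nbhs_nbhs (conj Wo Wp)).
have rFq := reg_push H Wq rq.
have [V [Vo VFq hV]] := reg_near rFq.
have [q' [rq' Vq']] := dM' _ rFq.1 _ (open_nbhs_nbhs (conj Vo VFq)).
exact: reg_type_uniq rE rE' (hV _ Vq' rq'.1) rq'.
Qed.

End Limits.

Theorem theorem8 (R : realType) (r n k n' k' : nat)
    (U M U' M' : set 'rV[R[i]]_r) (p p' : 'rV[R[i]]_r)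
    (D D' : set 'rV[R[i]]_r) (F : 'rV[R[i]]_r -> 'rV[R[i]]_r)
    (hM : CR_regular_set n k U M) (hM' : CR_regular_set n' k' U' M')
    (hp : sing n k M p) (hp' : sing n' k' M' p')
    (hirr : irreducible_germ M p) (hirr' : irreducible_germ M' p')
    (hconn : connected_near M p) (hconn' : connected_near M' p')
    (hF : biholomorphic D D' F) (hD : D p) (hFp : F p = p')
    (hgerm : maps_germ D F M p M')
    (j : limit_kind) (l : nat) :
  singular_type j n k M l p = singular_type j n' k' M' l p'.
Proof.
have [Do D'o bF holF [G [GF holG]]] := hF.
have [W [Wo Wp WD FMW]] := hgerm.
have FD z : D z -> D' (F z) by have [fF _ _] := bF; exact: fF.
have FG w : D' w -> D (G w) /\ F (G w) = w.
  by have [_ _ sF] := bF; move=> /sF[z Dz <-]; rewrite GF.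
(* With [setT] in place of the sets this concerns [F] alone; it shows that the image of [W] is open
   before the pair with [M] and [M'] is formed. *)
have HD : bihol_pair D setT D' setT F G.
  split => //; first by move=> z Dz; split; [exact: FD|exact: GF].
  by split => // z Dz i; apply/holP; [exact: holF|exact: holG].
have W'o := preim_open (bihol_sym HD) Wo.
have H : bihol_pair W M (D' `&` G @^-1` W) M' F G.
  split => //.
  - move=> z Wz; have Dz := WD _ Wz; rewrite /preimage /= GF//; split => //.
    by split => //; exact: FD.
  - by move=> w [D'w Gw]; split => //; exact: (FG _ D'w).2.
  split.
  - by move=> z /WD Dz i; apply/holP; exact: holF.
  - by move=> w [D'w _] i; apply/holP; exact: holG.
  move=> z Wz; split=> [Mz|M'Fz].
    have : (F @` (M `&` W)) (F z) by exists z.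
    by rewrite FMW => -[].
  have : (F @` (M `&` W)) (F z) by rewrite FMW; split => //; exists z.
  by move=> [y [My Wy] e]; rewrite -(GF _ (WD _ Wz)) -e GF//; exact: WD.
have Mp := hp.1.
have nE := CR_type_eq hM hM' H Wp Mp.
have [rE _ _ _ _] := hM; have [rE' _ _ _ _] := hM'.
have kE : k = k' by apply: (@addnI n); rewrite -rE nE.
rewrite -{}hFp -{}nE -{}kE; apply: eq_map => nu.
apply/eqP; rewrite eqn_leq; apply/andP; split.
  have W'Fp : (D' `&` G @^-1` W) (F p) by have [_ _ h _ _] := H; exact: (h _ Wp).1.
  have := dim_limit_le (bihol_sym H) j nu rE W'Fp.
  by rewrite GF.
exact: (dim_limit_le H j nu rE Wp).
Qed.
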